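(* Let $n\ge 2$ and $m>2n+2$ be integers, and let $F:\mathbb{B}^n\to D^{IV}_m$ be a holomorphic isometry. Then there exists a holomorphic isometry $G:\mathbb{B}^n\to D^{IV}_{2n+2}$ such that $F$ is equivalent to the map $(G,\mathbf 0):\mathbb{B}^n\to D^{IV}_m$, where $\mathbf 0$ is the zero vector in $\mathbb{C}^{m-2n-2}$.
   Context: $\mathbb{B}^n=\{z\in\mathbb{C}^n: |z|^2<1\}$. For a row vector $Z=(z_1,\dots,z_m)\in\mathbb{C}^m$, the type IV classical domain is $D^{IV}_m=\{Z\in\mathbb{C}^m: Z\overline{Z}^t<2,\ 1-Z\overline{Z}^t+\tfrac14|ZZ^t|^2>0\}$; its Bergman kernel is $K(Z,\bar Z)=c\,(1-Z\overline{Z}^t+\tfrac14|ZZ^t|^2)^{-m}$ ($c>0$ a constant), and the Bergman kernel of $\mathbb{B}^n$ is a positive constant times $(1-|z|^2)^{-(n+1)}$. For a bounded domain $\Omega$ with Bergman kernel $K_\Omega$, its Bergman metric is $\omega_\Omega=\sqrt{-1}\partial\bar\partial\log K_\Omega(Z,\bar Z)$. A holomorphic map $F:D\to\Omega$ between such domains is a holomorphic isometry if $F^*\omega_\Omega=\lambda\,\omega_D$ for some positive constant $\lambda$. Two holomorphic maps $F_1,F_2:\mathbb{B}^n\to D^{IV}_m$ are equivalent if $F_1=\phi\circ F_2\circ\psi$ for some biholomorphic automorphisms $\psi$ of $\mathbb{B}^n$ and $\phi$ of $D^{IV}_m$. Note $D^{IV}_{k}\times\{0\}\subset D^{IV}_m$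 for $k\le m$. *)

(* Defs.v *)
From Stdlib Require Import Reals Lra.
Open Scope R_scope.

Definition C : Type := (R * R)%type.
Definition C0 : C := (0, 0).
Definition C1 : C := (1, 0).
Definition Ci : C := (0, 1).
Definition Cadd (a b : C) : C := (fst a + fst b, snd a + snd b).
Definition Copp (a : C) : C := (- fst a, - snd a).
Definition Csub (a b : C) : C := Cadd a (Copp b).
Definition Cmul (a b : C) : C :=
  (fst a * fst b - snd a * snd b, fst a * snd b + snd a * fst b).
Definition Cscale (t : R) (a : C) : C := (t * fst a, t * snd a).
Definition Cnorm2 (a : C) : R := fst a * fst a + snd a * snd a.
Definition Cnorm (a : C) : R := sqrt (Cnorm2 a).

(** Vectors: a point of C^n is a [vec] supported on the indices 0..n-1. *)
Definition vec : Type := nat -> C.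
Definition supported (n : nat) (z : vec) : Prop := forall k, (n <= k)%nat -> z k = C0.
Definition vadd (z w : vec) : vec := fun k => Cadd (z k) (w k).
Definition vsub (z w : vec) : vec := fun k => Csub (z k) (w k).
Definition vscale (t : R) (z : vec) : vec := fun k => Cscale t (z k).

Fixpoint sumR (n : nat) (f : nat -> R) : R :=
  match n with O => 0 | S p => sumR p f + f p end.
Fixpoint sumC (n : nat) (f : nat -> C) : C :=
  match n with O => C0 | S p => Cadd (sumC p f) (f p) end.

Definition sqnorm (n : nat) (z : vec) : R := sumR n (fun k => Cnorm2 (z k)).
Definition normn (n : nat) (z : vec) : R := sqrt (sqnorm n z).
Definition zzt (n : nat) (z : vec) : C := sumC n (fun k => Cmul (z k) (z k)).

Definition ball (n : nat) (z : vec) : Prop := supported n z /\ sqnorm n z < 1.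
Definition typeIV_q (m : nat) (Z : vec) : R := 1 - sqnorm m Z + / 4 * Cnorm2 (zzt m Z).
Definition DIV (m : nat) (Z : vec) : Prop :=
  supported m Z /\ sqnorm m Z < 2 /\ typeIV_q m Z > 0.

(** log of the Bergman kernels (the positive normalising constants are
    taken to be 1; they do not affect the Bergman metric i dd^c log K). *)
Definition logK_ball (n : nat) (z : vec) : R := - INR (n + 1) * ln (1 - sqnorm n z).
Definition logK_IV (m : nat) (Z : vec) : R := - INR m * ln (typeIV_q m Z).

Definition holo_at (n : nat) (f : vec -> C) (z : vec) : Prop :=
  exists a : nat -> C, forall eps, eps > 0 -> exists delta, delta > 0 /\
    forall h, supported n h -> 0 < normn n h < delta ->
      Cnorm (Csub (Csub (f (vadd z h)) (f z)) (sumC n (fun k => Cmul (a k) (h k))))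
        <= eps * normn n h.

Definition holomorphic (n m : nat) (U : vec -> Prop) (F : vec -> vec) : Prop :=
  forall z, U z -> forall k, (k < m)%nat -> holo_at n (fun w => F w k) z.

Definition dir_deriv (f : vec -> R) (z u : vec) (l : R) : Prop :=
  derivable_pt_lim (fun t => f (vadd z (vscale t u))) 0 l.

Definition D2 (n : nat) (f : vec -> R) (u v z : vec) (r : R) : Prop :=
  exists g : vec -> R, exists delta, delta > 0 /\
    (forall w, supported n w -> normn n (vsub w z) < delta -> dir_deriv f w u (g w)) /\
    dir_deriv g z v r.

Definition ex (i : nat) : vec := fun k => if Nat.eqb k i then C1 else C0.
Definition ey (i : nat) : vec := fun k => if Nat.eqb k i then Ci else C0.

(** levi n f z i j c : the coefficient  d^2 f / dz_i d\bar z_j (z)  equals c,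
    where d/dz_i = (d/dx_i - i d/dy_i)/2, d/d\bar z_j = (d/dx_j + i d/dy_j)/2. *)
Definition levi (n : nat) (f : vec -> R) (z : vec) (i j : nat) (c : C) : Prop :=
  exists a b p q,
    D2 n f (ex i) (ex j) z a /\ D2 n f (ey i) (ey j) z b /\
    D2 n f (ex i) (ey j) z p /\ D2 n f (ey i) (ex j) z q /\
    c = ((a + b) / 4, (p - q) / 4).

(** Holomorphic isometry B^n -> D^IV_m w.r.t. the Bergman metrics:
    F^* omega_IV = lambda omega_B, where the pull-back of
    sqrt(-1) dd-bar log K_IV is sqrt(-1) dd-bar (log K_IV o F). *)
Definition holo_isometry_ball_IV (n m : nat) (F : vec -> vec) : Prop :=
  holomorphic n m (ball n) F /\
  (forall z, ball n z -> DIV m (F z)) /\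
  exists lambda, lambda > 0 /\
    forall z, ball n z -> forall i j, (i < n)%nat -> (j < n)%nat ->
      exists c1 c2, levi n (fun w => logK_IV m (F w)) z i j c1 /\
                    levi n (logK_ball n) z i j c2 /\
                    c1 = Cscale lambda c2.

Definition biholo_aut (n : nat) (U : vec -> Prop) (phi : vec -> vec) : Prop :=
  holomorphic n n U phi /\ (forall z, U z -> U (phi z)) /\
  exists chi, holomorphic n n U chi /\ (forall z, U z -> U (chi z)) /\
    (forall z, U z -> chi (phi z) = z) /\ (forall z, U z -> phi (chi z) = z).

Definition equivalent_ball_IV (n m : nat) (F1 F2 : vec -> vec) : Prop :=
  exists psi phi, biholo_aut n (ball n) psi /\ biholo_aut m (DIV m) phi /\
    forall z, ball n z -> F1 z = phi (F2 (psi z)).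

(* Main.v *)
(** Write [s = F F^t] and lift [F] to [Phi = (F, 1, s/2)], so that the Bergman kernel of the type IV
    domain becomes the Hermitian form [K(z,w)] of signature [(2, m)] evaluated at [Phi(z)], [Phi(w)].
    The isometry condition is a polynomial identity between [K], its derivatives and [1 - z.w] on the
    diagonal; it polarizes to all pairs [(z, w)] near the origin, and integrating it along segments
    gives [K(z,w) = h(z) conj(h(w)) (1 - z.w)^mu]. The signature forces [mu <= 1] (otherwise there are
    three orthogonal positive vectors, as [n >= 2]) and finiteness of the rank forces [mu >= 1]. For
    [mu = 1] the vectors [Phi/h] span, modulo an isotropic part of dimension at most 1, a space of
    dimension [n + 1], so at least [m + 2 - (2n + 4)] independent real linear functionals vanish on the
    image of [Phi]. Each of them is negative for the real quadratic form, and the reflection sending it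
    to a coordinate is an automorphism of the domain which makes this coordinate of [F] vanish.

    Holomorphy only means complex differentiability at each point, so the one-variable theory is
    built on Goursat's theorem. *)

Require Import Defs.
From Stdlib Require Import Reals.
Open Scope R_scope.
From Stdlib Require Import Lra Lia Psatz Classical ClassicalEpsilon FunctionalExtensionality.
From Coquelicot Require Import Coquelicot.

(** * Complex differentiation *)

(** The automorphisms used here preserve the quadric sum of the Z_k^2 = 2 V_m V_(m+1), so a
    functional can be moved to a coordinate only if it is real for the structure that conjugates and
    exchanges the last two homogeneous coordinates. Each of the n + 2 complex vectors spanning the
    rescaled lift (value at 0, n first differences, one isotropic vector) therefore costs two real
    equations, against j + 2 real unknowns when j coordinates remain: hence 2n + 2. Coordinates are
    removed one at a time, with a new functional after each reflection. Logarithms and quotients are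
    cleared before polarization, because finite sums of f(t) conj(g(s)) form an algebra stable under
    derivation. Division by K is possible only near the origin, where it does not vanish; the
    vanishing of a functional then spreads to the ball by the identity theorem. No branch of (1 -
    z.w)^mu is chosen: the power enters through its differential equation along a segment, solved
    explicitly for real z.w and for mu = 1. [F] is not normalized at 0; dividing the lift by K(z,0)
    takes the place of that normalization. *)

Lemma Cmod_le_sum (z : C) : Cmod z <= Rabs (fst z) + Rabs (snd z).
Proof.
  unfold Cmod. apply Rsqr_incr_0_var.
  - rewrite Rsqr_sqrt by nra. unfold Rsqr.
    pose proof (Rabs_pos (fst z)); pose proof (Rabs_pos (snd z)).
    rewrite <- (pow2_abs (fst z)), <- (pow2_abs (snd z)). nra.
  - pose proof (Rabs_pos (fst z)); pose proof (Rabs_pos (snd z)); lra.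
Qed.

Lemma fst_le_Cmod (z : C) : Rabs (fst z) <= Cmod z.
Proof. eapply Rle_trans; [apply Rmax_l | apply Rmax_Cmod]. Qed.

Lemma snd_le_Cmod (z : C) : Rabs (snd z) <= Cmod z.
Proof. eapply Rle_trans; [apply Rmax_r | apply Rmax_Cmod]. Qed.

Lemma Cmod_triangle_minus (a b : C) : Cmod (a - b)%C <= Cmod a + Cmod b.
Proof. rewrite <- (Cmod_opp b). apply Cmod_triangle. Qed.

Lemma Cmod_reverse (a b : C) : Cmod a - Cmod b <= Cmod (a - b)%C.
Proof. pose proof (Cmod_triangle (a - b) b). replace (a - b + b)%C with a in H by ring. lra. Qed.

Lemma Cmod_eq_0_le (a : C) : (forall e, 0 < e -> Cmod a <= e) -> a = 0%C.
Proof.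
  intros H. apply Cmod_eq_0. apply Rle_antisym; [|apply Cmod_ge_0].
  apply Rnot_lt_le. intros Hp. specialize (H (Cmod a / 2)). lra.
Qed.

(** The estimate is non-strict and covers [h = 0], so that it applies to an increment of another
    function, which may vanish, as in the chain rule. *)
Definition cderiv (f : C -> C) (t l : C) : Prop :=
  forall eps : R, 0 < eps -> exists d, 0 < d /\
    forall h : C, Cmod h < d -> Cmod (f (t + h) - f t - l * h)%C <= eps * Cmod h.

Definition ccont (f : C -> C) (t : C) : Prop :=
  forall eps : R, 0 < eps -> exists d, 0 < d /\
    forall h : C, Cmod h < d -> Cmod (f (t + h) - f t)%C <= eps.

(** Componentwise, in order to inherit real calculus; [rderiv_eps] gives the form that composes with
    complex derivatives. *)
Definition rderiv (f : R -> C) (x : R) (l : C) : Prop :=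
  is_derive (fun t => fst (f t)) x (fst l) /\ is_derive (fun t => snd (f t)) x (snd l).

Definition rcont (f : R -> C) (x : R) : Prop :=
  continuous (fun t => fst (f t)) x /\ continuous (fun t => snd (f t)) x.

Lemma is_derive_eps (f : R -> R) (x l : R) :
  is_derive f x l <-> forall eps, 0 < eps -> exists d, 0 < d /\
    forall h, Rabs h < d -> Rabs (f (x + h) - f x - l * h) <= eps * Rabs h.
Proof.
  rewrite is_derive_Reals. split.
  - intros H eps He. destruct (H eps He) as [d Hd]. exists d. split; [apply cond_pos|].
    intros h Hh. destruct (Req_dec h 0) as [->|Hn].
    + rewrite Rplus_0_r, Rmult_0_r, Rabs_R0. replace (f x - f x - 0) with 0 by ring.
      rewrite Rabs_R0. lra.
    + specialize (Hd h Hn Hh).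
      replace (f (x + h) - f x - l * h) with (((f (x + h) - f x) / h - l) * h) by (field; auto).
      rewrite Rabs_mult. apply Rmult_le_compat_r; [apply Rabs_pos|lra].
  - intros H eps He. destruct (H (eps / 2)) as [d [Hd1 Hd2]]; [lra|].
    exists (mkposreal d Hd1). simpl. intros h Hn Hh. specialize (Hd2 h Hh).
    replace ((f (x + h) - f x) / h - l) with ((f (x + h) - f x - l * h) / h) by (field; auto).
    rewrite Rabs_div by auto. pose proof (Rabs_pos_lt h Hn).
    apply Rle_lt_trans with (eps / 2); [|lra].
    apply Rmult_le_reg_r with (Rabs h); [lra|]. unfold Rdiv at 1.
    rewrite Rmult_assoc, Rinv_l, Rmult_1_r by lra. exact Hd2.
Qed.

Lemma rderiv_eps (f : R -> C) (x : R) (l : C) :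
  rderiv f x l <-> forall eps, 0 < eps -> exists d, 0 < d /\
    forall h, Rabs h < d -> Cmod (f (x + h)%R - f x - l * h)%C <= eps * Rabs h.
Proof.
  unfold rderiv. rewrite !is_derive_eps. split.
  - intros [H1 H2] eps He.
    destruct (H1 (eps/2)) as [d1 [Hd1 K1]]; [lra|]. destruct (H2 (eps/2)) as [d2 [Hd2 K2]]; [lra|].
    exists (Rmin d1 d2). split; [apply Rmin_pos; auto|]. intros h Hh.
    specialize (K1 h (Rlt_le_trans _ _ _ Hh (Rmin_l _ _))).
    specialize (K2 h (Rlt_le_trans _ _ _ Hh (Rmin_r _ _))).
    eapply Rle_trans; [apply Cmod_le_sum|]. unfold Cminus, Cplus, Copp, Cmult, RtoC; simpl.
    replace (fst (f (x + h)) + - fst (f x) + - (fst l * h - snd l * 0))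
      with (fst (f (x + h)) - fst (f x) - fst l * h) by ring.
    replace (snd (f (x + h)) + - snd (f x) + - (fst l * 0 + snd l * h))
      with (snd (f (x + h)) - snd (f x) - snd l * h) by ring. lra.
  - intros H. split; intros eps He; destruct (H eps He) as [d [Hd K]]; exists d; split; auto;
      intros h Hh; specialize (K h Hh); (eapply Rle_trans; [|exact K]).
    + eapply Rle_trans; [|apply fst_le_Cmod]. right. f_equal.
      unfold Cminus, Cplus, Copp, Cmult, RtoC; simpl. ring.
    + eapply Rle_trans; [|apply snd_le_Cmod]. right. f_equal.
      unfold Cminus, Cplus, Copp, Cmult, RtoC; simpl. ring.
Qed.

Lemma continuous_eps (f : R -> R) (x : R) :
  continuous f x <-> forall eps, 0 < eps -> exists d, 0 < d /\
    forall h, Rabs h < d -> Rabs (f (x + h) - f x) <= eps.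
Proof.
  split.
  - intros H eps He. destruct (proj1 (filterlim_locally f (f x)) H (mkposreal eps He)) as [d Hd].
    exists d. split; [apply cond_pos|]. intros h Hh. left. apply (Hd (x + h)).
    unfold ball; simpl; unfold AbsRing_ball, abs, minus, plus, opp; simpl.
    replace (x + h + - x) with h by ring. exact Hh.
  - intros H. apply filterlim_locally. intros eps.
    destruct (H (eps / 2)) as [d [Hd K]]; [pose proof (cond_pos eps); lra|].
    exists (mkposreal d Hd). intros y Hy.
    unfold ball in *; simpl in *; unfold AbsRing_ball, abs, minus, plus, opp in *; simpl in *.
    specialize (K (y - x)). replace (x + (y - x)) with y in K by ring.
    pose proof (cond_pos eps). apply Rle_lt_trans with (eps / 2); [apply K; exact Hy|lra].
Qed.

Lemma rcont_eps (f : R -> C) (x : R) :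
  rcont f x <-> forall eps, 0 < eps -> exists d, 0 < d /\
    forall h, Rabs h < d -> Cmod (f (x + h)%R - f x)%C <= eps.
Proof.
  unfold rcont. rewrite !continuous_eps. split.
  - intros [H1 H2] eps He.
    destruct (H1 (eps/2)) as [d1 [Hd1 K1]]; [lra|]. destruct (H2 (eps/2)) as [d2 [Hd2 K2]]; [lra|].
    exists (Rmin d1 d2). split; [apply Rmin_pos; auto|]. intros h Hh.
    specialize (K1 h (Rlt_le_trans _ _ _ Hh (Rmin_l _ _))).
    specialize (K2 h (Rlt_le_trans _ _ _ Hh (Rmin_r _ _))).
    eapply Rle_trans; [apply Cmod_le_sum|]. unfold Cminus, Cplus, Copp; simpl. unfold Rminus in *. lra.
  - intros H. split; intros eps He; destruct (H eps He) as [d [Hd K]]; exists d; split; auto;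
      intros h Hh; specialize (K h Hh); (eapply Rle_trans; [|exact K]).
    + apply (fst_le_Cmod (f (x + h)%R - f x)%C).
    + apply (snd_le_Cmod (f (x + h)%R - f x)%C).
Qed.

Lemma cderiv_ccont f t l : cderiv f t l -> ccont f t.
Proof.
  intros H eps He. destruct (H 1 Rlt_0_1) as [d [Hd K]].
  set (M := 1 + Cmod l). assert (HM : 0 < M) by (unfold M; pose proof (Cmod_ge_0 l); lra).
  exists (Rmin d (eps / M)). split; [apply Rmin_pos; auto; apply Rdiv_lt_0_compat; auto|].
  intros h Hh. specialize (K h (Rlt_le_trans _ _ _ Hh (Rmin_l _ _))).
  assert (Hh2 := Rlt_le_trans _ _ _ Hh (Rmin_r _ _)).
  replace (f (t + h) - f t)%C with ((f (t + h) - f t - l * h) + l * h)%C by ring.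
  eapply Rle_trans; [apply Cmod_triangle|]. rewrite Cmod_mult.
  apply Rmult_lt_compat_r with (r := M) in Hh2; auto. unfold Rdiv in Hh2.
  rewrite Rmult_assoc, Rinv_l in Hh2 by lra. unfold M in Hh2. lra.
Qed.

Lemma rderiv_rcont f x l : rderiv f x l -> rcont f x.
Proof.
  intros [H1 H2]. split; [apply (ex_derive_continuous (fun t => fst (f t))) |
    apply (ex_derive_continuous (fun t => snd (f t)))]; eexists; eauto.
Qed.

Lemma cderiv_rderiv f (g : R -> C) x l m :
  cderiv f (g x) l -> rderiv g x m -> rderiv (fun y => f (g y)) x (l * m)%C.
Proof.
  intros Hf Hg. rewrite rderiv_eps in *. intros eps He.
  pose proof (Cmod_ge_0 l) as Pl. pose proof (Cmod_ge_0 m) as Pm.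
  destruct (Hf (eps / (2 * (Cmod m + 1)))) as [d1 [Hd1 K1]].
  { apply Rdiv_lt_0_compat; lra. }
  destruct (Hg (Rmin 1 (eps / (2 * (Cmod l + 1))))) as [d2 [Hd2 K2]].
  { apply Rmin_pos; [lra|]. apply Rdiv_lt_0_compat; lra. }
  exists (Rmin d2 (d1 / (Cmod m + 1))). split.
  { apply Rmin_pos; auto. apply Rdiv_lt_0_compat; lra. }
  intros h Hh. specialize (K2 h (Rlt_le_trans _ _ _ Hh (Rmin_l _ _))).
  assert (Hh2 := Rlt_le_trans _ _ _ Hh (Rmin_r _ _)).
  set (k := (g (x + h)%R - g x)%C) in *.
  assert (Bk : Cmod k <= (Cmod m + 1) * Rabs h).
  { replace k with ((k - m * h) + m * h)%C by ring. eapply Rle_trans; [apply Cmod_triangle|].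
    rewrite Cmod_mult, Cmod_R. pose proof (Rmin_l 1 (eps / (2 * (Cmod l + 1)))).
    pose proof (Rabs_pos h). nra. }
  assert (Bk2 : Cmod k < d1).
  { eapply Rle_lt_trans; [exact Bk|]. apply Rmult_lt_compat_r with (r := Cmod m + 1) in Hh2; [|lra].
    unfold Rdiv in Hh2. rewrite Rmult_assoc, Rinv_l in Hh2 by lra. lra. }
  specialize (K1 k Bk2). replace (g x + k)%C with (g (x + h)%R) in K1 by (unfold k; ring).
  replace (f (g (x + h)%R) - f (g x) - l * m * h)%C
    with ((f (g (x + h)%R) - f (g x) - l * k) + l * (k - m * h))%C by ring.
  eapply Rle_trans; [apply Cmod_triangle|]. rewrite Cmod_mult.
  assert (A : Cmod (f (g (x + h)%R) - f (g x) - l * k)%C <= eps / 2 * Rabs h).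
  { eapply Rle_trans; [exact K1|].
    apply Rle_trans with (eps / (2 * (Cmod m + 1)) * ((Cmod m + 1) * Rabs h)).
    - apply Rmult_le_compat_l; [|exact Bk]. left. apply Rdiv_lt_0_compat; lra.
    - right. field. lra. }
  assert (B : Cmod l * Cmod (k - m * h)%C <= eps / 2 * Rabs h).
  { apply Rle_trans with ((Cmod l + 1) * (eps / (2 * (Cmod l + 1)) * Rabs h)).
    - apply Rmult_le_compat; try lra; try apply Cmod_ge_0.
      eapply Rle_trans; [exact K2|]. apply Rmult_le_compat_r; [apply Rabs_pos|apply Rmin_r].
    - right. field. lra. }
  lra.
Qed.

Lemma ccont_rcont f (g : R -> C) x : ccont f (g x) -> rcont g x -> rcont (fun y => f (g y)) x.
Proof.
  intros Hf Hg. rewrite rcont_eps in *. intros eps He. destruct (Hf eps He) as [d [Hd K]].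
  destruct (Hg (d / 2)) as [d2 [Hd2 K2]]; [lra|]. exists d2. split; auto. intros h Hh.
  specialize (K2 h Hh). specialize (K (g (x + h)%R - g x)%C).
  replace (g x + (g (x + h)%R - g x))%C with (g (x + h)%R) in K by ring. apply K. lra.
Qed.

Lemma rderiv_const c x : rderiv (fun _ => c) x 0%C.
Proof. split; apply (is_derive_const (K := R_AbsRing) (V := R_NormedModule)). Qed.

Lemma rderiv_id x : rderiv (fun y => RtoC y) x 1%C.
Proof. split; simpl. apply (is_derive_id (K := R_AbsRing)). apply (is_derive_const (K := R_AbsRing) (V := R_NormedModule)). Qed.

Lemma rderiv_plus f g x l m :
  rderiv f x l -> rderiv g x m -> rderiv (fun y => f y + g y)%C x (l + m)%C.
Proof. intros [A B] [A' B']. split; simpl; apply (is_derive_plus (K := R_AbsRing) (V := R_NormedModule)); auto. Qed.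

Lemma rderiv_opp f x l : rderiv f x l -> rderiv (fun y => - f y)%C x (- l)%C.
Proof. intros [A B]. split; simpl; apply (is_derive_opp (K := R_AbsRing) (V := R_NormedModule)); auto. Qed.

Lemma rderiv_minus f g x l m :
  rderiv f x l -> rderiv g x m -> rderiv (fun y => f y - g y)%C x (l - m)%C.
Proof. intros. apply rderiv_plus; auto. apply rderiv_opp; auto. Qed.

Lemma is_derive_Rmult (f g : R -> R) (x l m : R) : is_derive f x l -> is_derive g x m ->
  is_derive (fun y => f y * g y) x (l * g x + f x * m).
Proof. intros. apply (is_derive_mult f g x l m); auto. intros; apply Rmult_comm. Qed.

Lemma is_derive_Rplus (f g : R -> R) (x l m : R) : is_derive f x l -> is_derive g x m ->
  is_derive (fun y => f y + g y) x (l + m).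
Proof. intros. apply (is_derive_plus f g x l m); auto. Qed.

Lemma is_derive_Rminus (f g : R -> R) (x l m : R) : is_derive f x l -> is_derive g x m ->
  is_derive (fun y => f y - g y) x (l - m).
Proof. intros. apply (is_derive_minus f g x l m); auto. Qed.

Lemma is_derive_eq (f : R -> R) (x l m : R) : is_derive f x l -> l = m -> is_derive f x m.
Proof. intros H <-; exact H. Qed.

Lemma rderiv_mult f g x l m :
  rderiv f x l -> rderiv g x m -> rderiv (fun y => f y * g y)%C x (l * g x + f x * m)%C.
Proof.
  intros [A B] [A' B']. split; simpl.
  - eapply is_derive_eq. apply is_derive_Rminus; apply is_derive_Rmult; eauto. simpl. ring.
  - eapply is_derive_eq. apply is_derive_Rplus; apply is_derive_Rmult; eauto. simpl. ring.
Qed.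

Lemma rderiv_conj f x l : rderiv f x l -> rderiv (fun y => Cconj (f y)%C) x (Cconj l).
Proof. intros [A B]. split; simpl; auto. apply (is_derive_opp (K := R_AbsRing) (V := R_NormedModule)); auto. Qed.

Lemma rderiv_eq f x l m : rderiv f x l -> l = m -> rderiv f x m.
Proof. intros H <-; exact H. Qed.

Lemma rderiv_ext f g x l : (forall y, f y = g y) -> rderiv f x l -> rderiv g x l.
Proof. intros H [A B]. split; eapply is_derive_ext; eauto; intros; simpl; now rewrite H. Qed.

Lemma rderiv_ext_loc f g x l d : 0 < d -> (forall y, Rabs (y - x) < d -> f y = g y) -> rderiv f x l -> rderiv g x l.
Proof.
  intros Hd H [A B].
  assert (L : locally x (fun y => f y = g y)).
  { exists (mkposreal d Hd). intros y Hy. apply H. exact Hy. }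
  split; eapply is_derive_ext_loc; eauto; (eapply filter_imp; [|exact L]); simpl; intros y ->; auto.
Qed.

Lemma rderiv_unique f x l m : rderiv f x l -> rderiv f x m -> l = m.
Proof.
  intros [A B] [A' B']. apply is_derive_unique in A, B, A', B'. destruct l, m; simpl in *. congruence.
Qed.

Lemma rderiv_inv f x l : rderiv f x l -> f x <> 0%C -> rderiv (fun y => / f y)%C x (- l / (f x * f x))%C.
Proof.
  intros [A B] Hn.
  assert (P : fst (f x) * fst (f x) + snd (f x) * snd (f x) <> 0).
  { intros E. apply Hn. apply injective_projections; simpl; nra. }
  assert (P' : fst (f x) ^ 2 + snd (f x) ^ 2 <> 0) by (intros E; apply P; lra).
  assert (D : is_derive (fun y => fst (f y) ^ 2 + snd (f y) ^ 2) x
     (2 * (fst l * fst (f x) + snd l * snd (f x)))).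
  { apply (is_derive_ext (fun y => fst (f y) * fst (f y) + snd (f y) * snd (f y))).
    - intros; simpl; ring.
    - eapply is_derive_eq. apply is_derive_Rplus; apply is_derive_Rmult; eauto. simpl; ring. }
  pose proof (is_derive_inv _ _ _ D P') as DI.
  assert (Q1 : is_derive (fun y => fst (/ f y)%C) x
    (fst l * / (fst (f x) ^ 2 + snd (f x) ^ 2) + fst (f x) * (- (2 * (fst l * fst (f x) + snd l * snd (f x))) / (fst (f x) ^ 2 + snd (f x) ^ 2) ^ 2))).
  { exact (is_derive_Rmult (fun t => fst (f t)) _ x _ _ A DI). }
  assert (Q2 : is_derive (fun y => snd (/ f y)%C) x
    (- snd l * / (fst (f x) ^ 2 + snd (f x) ^ 2) + - snd (f x) * (- (2 * (fst l * fst (f x) + snd l * snd (f x))) / (fst (f x) ^ 2 + snd (f x) ^ 2) ^ 2))).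
  { exact (is_derive_Rmult (fun t => - snd (f t)) _ x _ _
      (is_derive_opp (K := R_AbsRing) (V := R_NormedModule) _ _ _ B) DI). }
  split.
  - eapply is_derive_eq; [exact Q1|]. unfold Cdiv, Cmult, Cinv, Copp; simpl. field.
    repeat split; intros E; apply P; nra.
  - eapply is_derive_eq; [exact Q2|]. unfold Cdiv, Cmult, Cinv, Copp; simpl. field.
    repeat split; intros E; apply P; nra.
Qed.

Lemma rderiv_zero_const f a b :
  a <= b -> (forall x, a <= x <= b -> rderiv f x 0%C) -> f b = f a.
Proof.
  intros Hab H. destruct (Req_dec a b) as [->|Hn]; auto.
  assert (G : forall g : R -> R, (forall x, a <= x <= b -> is_derive g x 0) -> g b = g a).
  { intros g Hg. destruct (MVT_gen g a b (fun _ => 0)) as [c [_ Hc]].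
    - intros x Hx. rewrite Rmin_left, Rmax_right in Hx by lra. apply Hg; lra.
    - intros x Hx. rewrite Rmin_left, Rmax_right in Hx by lra.
      apply continuity_pt_filterlim. apply (ex_derive_continuous g). exists 0. apply Hg; lra.
    - lra. }
  apply injective_projections.
  - apply (G (fun t => fst (f t))). intros x Hx. apply (H x Hx).
  - apply (G (fun t => snd (f t))). intros x Hx. apply (H x Hx).
Qed.

(** Applied to the real function [Re (conj w * f)], with [w = f b - f a]. *)
Lemma rderiv_mean_value f f' a b M :
  a <= b -> (forall x, a <= x <= b -> rderiv f x (f' x)) ->
  (forall x, a <= x <= b -> Cmod (f' x)%C <= M) -> Cmod (f b - f a)%C <= M * (b - a).
Proof.
  intros Hab H HM. set (w := (f b - f a)%C).
  destruct (Req_dec (Cmod w) 0) as [E|E].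
  { rewrite E. apply Rmult_le_pos; [|lra]. eapply Rle_trans; [apply Cmod_ge_0|apply (HM a); lra]. }
  pose proof (Cmod_ge_0 w).
  assert (D : forall x, a <= x <= b -> rderiv (fun y => Cconj w * f y)%C x (Cconj w * f' x)%C).
  { intros x Hx. eapply rderiv_eq. apply rderiv_mult. apply rderiv_const. apply H; auto. cbv beta; ring. }
  destruct (MVT_gen (fun y => fst (Cconj w * f y)%C) a b (fun x => fst (Cconj w * f' x)%C)) as [c [Hc1 Hc]].
  - intros x Hx. rewrite Rmin_left, Rmax_right in Hx by lra. apply D; lra.
  - intros x Hx. rewrite Rmin_left, Rmax_right in Hx by lra.
    apply continuity_pt_filterlim. apply (ex_derive_continuous (fun y => fst (Cconj w * f y)%C)).
    eexists. apply D; lra.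
  - rewrite Rmin_left, Rmax_right in Hc1 by lra.
    assert (E2 : fst (Cconj w * f b)%C - fst (Cconj w * f a)%C = Cmod w ^ 2).
    { rewrite Cmod2_alt. unfold w, Re, Im, Cconj, Cmult, Cminus, Cplus, Copp; simpl. ring. }
    rewrite E2 in Hc.
    assert (B : fst (Cconj w * f' c)%C <= Cmod w * M).
    { eapply Rle_trans; [apply Rle_abs|]. eapply Rle_trans; [apply fst_le_Cmod|].
      rewrite Cmod_mult, Cmod_conj. apply Rmult_le_compat_l; auto. }
    apply Rmult_le_reg_l with (Cmod w); [lra|].
    replace (Cmod w * Cmod w) with (Cmod w ^ 2) by ring. rewrite Hc.
    replace (Cmod w * (M * (b - a))) with (Cmod w * M * (b - a)) by ring.
    apply Rmult_le_compat_r; lra.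
Qed.

Lemma rcont_const c x : rcont (fun _ => c) x.
Proof. eapply rderiv_rcont, rderiv_const. Qed.

Lemma rcont_plus f g x : rcont f x -> rcont g x -> rcont (fun y => f y + g y)%C x.
Proof. intros [A B] [A' B']. split; simpl; apply (continuous_plus (V := R_NormedModule)); auto. Qed.

Lemma rcont_opp f x : rcont f x -> rcont (fun y => - f y)%C x.
Proof. intros [A B]. split; simpl; apply (continuous_opp (V := R_NormedModule)); auto. Qed.

Lemma rcont_minus f g x : rcont f x -> rcont g x -> rcont (fun y => f y - g y)%C x.
Proof. intros. apply rcont_plus; auto. apply rcont_opp; auto. Qed.

Lemma rcont_mult f g x : rcont f x -> rcont g x -> rcont (fun y => f y * g y)%C x.
Proof.
  intros [A B] [A' B']. split; simpl.
  - apply (continuous_minus (V := R_NormedModule)); apply (continuous_mult (K := R_AbsRing)); auto.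
  - apply (continuous_plus (V := R_NormedModule)); apply (continuous_mult (K := R_AbsRing)); auto.
Qed.

Lemma cderiv_const c t : cderiv (fun _ => c) t 0%C.
Proof.
  intros eps He. exists 1. split; [lra|]. intros h _.
  cbv beta; replace (c - c - 0 * h)%C with (RtoC 0) by ring. rewrite Cmod_0. pose proof (Cmod_ge_0 h). nra.
Qed.

Lemma cderiv_id t : cderiv (fun z => z) t 1%C.
Proof.
  intros eps He. exists 1. split; [lra|]. intros h _.
  cbv beta; replace (t + h - t - 1 * h)%C with (RtoC 0) by ring. rewrite Cmod_0. pose proof (Cmod_ge_0 h). nra.
Qed.

Lemma cderiv_plus f g t l m : cderiv f t l -> cderiv g t m -> cderiv (fun z => f z + g z)%C t (l + m)%C.
Proof.
  intros Hf Hg eps He. destruct (Hf (eps/2)) as [d1 [Hd1 K1]]; [lra|]. destruct (Hg (eps/2)) as [d2 [Hd2 K2]]; [lra|].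
  exists (Rmin d1 d2). split; [apply Rmin_pos; auto|]. intros h Hh.
  specialize (K1 h (Rlt_le_trans _ _ _ Hh (Rmin_l _ _))).
  specialize (K2 h (Rlt_le_trans _ _ _ Hh (Rmin_r _ _))).
  replace (f (t + h) + g (t + h) - (f t + g t) - (l + m) * h)%C with
    ((f (t + h) - f t - l * h) + (g (t + h) - g t - m * h))%C by ring.
  eapply Rle_trans; [apply Cmod_triangle|]. lra.
Qed.

Lemma ccont_bounded_near f t : ccont f t -> exists d M, 0 < d /\ 0 < M /\ forall h, Cmod h < d -> Cmod (f (t + h)%C)%C <= M.
Proof.
  intros H. destruct (H 1 Rlt_0_1) as [d [Hd K]]. exists d, (1 + Cmod (f t)%C).
  split; auto. pose proof (Cmod_ge_0 (f t)). split; [lra|]. intros h Hh. specialize (K h Hh).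
  replace (f (t + h)%C) with ((f (t + h) - f t) + f t)%C by ring.
  eapply Rle_trans; [apply Cmod_triangle|]. lra.
Qed.

Lemma cderiv_mult f g t l m :
  cderiv f t l -> cderiv g t m -> cderiv (fun z => f z * g z)%C t (l * g t + f t * m)%C.
Proof.
  intros Hf Hg eps He.
  destruct (ccont_bounded_near g t (cderiv_ccont _ _ _ Hg)) as [d0 [M [Hd0 [HM KM]]]].
  set (P := Cmod (f t)%C + 1). assert (HP : 0 < P) by (unfold P; pose proof (Cmod_ge_0 (f t)); lra).
  set (L := Cmod l + 1). assert (HL : 0 < L) by (unfold L; pose proof (Cmod_ge_0 l); lra).
  destruct (Hf (eps/(3*M))) as [d1 [Hd1 K1]]; [apply Rdiv_lt_0_compat; lra|].
  destruct (Hg (eps/(3*P))) as [d2 [Hd2 K2]]; [apply Rdiv_lt_0_compat; lra|].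
  destruct (cderiv_ccont _ _ _ Hg (eps/(3*L))) as [d3 [Hd3 K3]]; [apply Rdiv_lt_0_compat; lra|].
  exists (Rmin (Rmin d0 d1) (Rmin d2 d3)). split; [repeat apply Rmin_pos; auto|]. intros h Hh.
  assert (Cmod h < d0 /\ Cmod h < d1 /\ Cmod h < d2 /\ Cmod h < d3) as (h0 & h1 & h2 & h3).
  { pose proof (Rmin_l (Rmin d0 d1) (Rmin d2 d3)). pose proof (Rmin_r (Rmin d0 d1) (Rmin d2 d3)).
    pose proof (Rmin_l d0 d1). pose proof (Rmin_r d0 d1). pose proof (Rmin_l d2 d3). pose proof (Rmin_r d2 d3).
    repeat split; lra. }
  specialize (KM h h0). specialize (K1 h h1). specialize (K2 h h2). specialize (K3 h h3).
  replace (f (t + h) * g (t + h) - f t * g t - (l * g t + f t * m) * h)%C with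
    ((f (t + h) - f t - l * h) * g (t + h) + f t * (g (t + h) - g t - m * h) + l * h * (g (t + h) - g t))%C by ring.
  eapply Rle_trans; [apply Cmod_triangle|].
  eapply Rle_trans; [apply Rplus_le_compat_r, Cmod_triangle|]. rewrite !Cmod_mult.
  pose proof (Cmod_ge_0 h).
  assert (A1 : Cmod (f (t + h) - f t - l * h)%C * Cmod (g (t + h)%C)%C <= eps / 3 * Cmod h).
  { apply Rle_trans with ((eps/(3*M) * Cmod h) * M).
    - apply Rmult_le_compat; auto using Cmod_ge_0.
    - right. field. lra. }
  assert (A2 : Cmod (f t)%C * Cmod (g (t + h) - g t - m * h)%C <= eps / 3 * Cmod h).
  { apply Rle_trans with (P * (eps/(3*P) * Cmod h)).
    - apply Rmult_le_compat; auto using Cmod_ge_0. unfold P; lra.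
    - right. field. lra. }
  assert (A3 : Cmod l * Cmod h * Cmod (g (t + h) - g t)%C <= eps / 3 * Cmod h).
  { apply Rle_trans with (L * Cmod h * (eps/(3*L))).
    - apply Rmult_le_compat; auto using Cmod_ge_0. apply Rmult_le_pos; auto using Cmod_ge_0.
      apply Rmult_le_compat_r; auto. unfold L; lra.
    - right. field. lra. }
  lra.
Qed.

Lemma cderiv_eq f t l m : cderiv f t l -> l = m -> cderiv f t m.
Proof. intros H <-; exact H. Qed.

Lemma cderiv_ext_loc f g t l d : 0 < d -> (forall h, Cmod h < d -> f (t + h)%C = g (t + h)%C) ->
  cderiv f t l -> cderiv g t l.
Proof.
  intros Hd E H eps He. destruct (H eps He) as [d1 [Hd1 K]]. exists (Rmin d d1).
  split; [apply Rmin_pos; auto|]. intros h Hh.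
  rewrite <- E by (eapply Rlt_le_trans; [exact Hh|apply Rmin_l]).
  replace (g t) with (f t). apply K. eapply Rlt_le_trans; [exact Hh|apply Rmin_r].
  specialize (E 0%C). rewrite Cplus_0_r in E. apply E. rewrite Cmod_0; auto.
Qed.

Lemma cderiv_ext f g t l : (forall z, f z = g z) -> cderiv f t l -> cderiv g t l.
Proof. intros E. apply (cderiv_ext_loc f g t l 1); [lra|]. auto. Qed.

Lemma cderiv_scal c f t l : cderiv f t l -> cderiv (fun z => c * f z)%C t (c * l)%C.
Proof. intros H. eapply cderiv_eq. apply cderiv_mult. apply cderiv_const. apply H. cbv beta; ring. Qed.

Lemma cderiv_minus f g t l m : cderiv f t l -> cderiv g t m -> cderiv (fun z => f z - g z)%C t (l - m)%C.
Proof.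
  intros Hf Hg. eapply cderiv_eq. eapply (cderiv_ext (fun z => f z + (-(1)) * g z)%C). intros; ring.
  apply cderiv_plus; eauto. apply cderiv_scal; eauto. ring.
Qed.

Lemma cderiv_translate f p t l : cderiv f (p + t)%C l -> cderiv (fun z => f (p + z)%C) t l.
Proof.
  intros H eps He. destruct (H eps He) as [d [Hd K]]. exists d; split; auto. intros h Hh.
  rewrite Cplus_assoc. auto.
Qed.

Lemma cderiv_unique f t l m : cderiv f t l -> cderiv f t m -> l = m.
Proof.
  intros A B.
  assert (L : rderiv (fun x : R => t + x)%C 0 1%C).
  { eapply rderiv_eq. apply rderiv_plus. apply rderiv_const. apply rderiv_id. ring. }
  assert (E : (t + 0%R)%C = t) by ring.
  assert (A' := cderiv_rderiv f (fun x : R => t + x)%C 0 l 1%C).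
  assert (B' := cderiv_rderiv f (fun x : R => t + x)%C 0 m 1%C).
  cbv beta in *. rewrite E in *. assert (U := rderiv_unique _ _ _ _ (A' A L) (B' B L)).
  rewrite !Cmult_1_r in U. exact U.
Qed.

(** * Integrals of complex-valued functions *)

Definition isI (f : R -> C) (a b : R) (I : C) : Prop :=
  is_RInt (fun t => fst (f t)) a b (fst I) /\ is_RInt (fun t => snd (f t)) a b (snd I).

Lemma isI_unique f a b I J : isI f a b I -> isI f a b J -> I = J.
Proof.
  intros [A B] [A' B'].
  apply injective_projections.
  - rewrite <- (is_RInt_unique (V := R_CompleteNormedModule) _ _ _ _ A).
    apply (is_RInt_unique (V := R_CompleteNormedModule)); auto.
  - rewrite <- (is_RInt_unique (V := R_CompleteNormedModule) _ _ _ _ B).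
    apply (is_RInt_unique (V := R_CompleteNormedModule)); auto.
Qed.

Lemma isI_ext f g a b I : a <= b -> (forall x, a <= x <= b -> f x = g x) -> isI f a b I -> isI g a b I.
Proof.
  intros Hab E [A B]. split; eapply is_RInt_ext; eauto; simpl; intros x Hx;
    rewrite Rmin_left, Rmax_right in Hx by lra; rewrite E; auto; lra.
Qed.

Lemma isI_eq f a b I J : isI f a b I -> I = J -> isI f a b J.
Proof. intros H <-; exact H. Qed.

Lemma isI_plus f g a b I J : isI f a b I -> isI g a b J -> isI (fun x => f x + g x)%C a b (I + J)%C.
Proof. intros [A B] [A' B']. split; simpl; apply (is_RInt_plus (V := R_NormedModule)); auto. Qed.

Lemma isI_scal c f a b I : isI f a b I -> isI (fun x => c * f x)%C a b (c * I)%C.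
Proof.
  intros [A B]. split; simpl.
  - apply (is_RInt_minus (V := R_NormedModule)); apply (is_RInt_scal (V := R_NormedModule)); auto.
  - apply (is_RInt_plus (V := R_NormedModule)); apply (is_RInt_scal (V := R_NormedModule)); auto.
Qed.

Lemma isI_minus f g a b I J : isI f a b I -> isI g a b J -> isI (fun x => f x - g x)%C a b (I - J)%C.
Proof. intros [A B] [A' B']. split; simpl; apply (is_RInt_minus (V := R_NormedModule)); auto. Qed.

Lemma isI_Chasles f a b c I J : isI f a b I -> isI f b c J -> isI f a c (I + J)%C.
Proof. intros [A B] [A' B']. split; simpl; eapply (is_RInt_Chasles (V := R_NormedModule)); eauto. Qed.

Lemma isI_cont f a b : (forall x, Rmin a b <= x <= Rmax a b -> rcont f x) -> exists I, isI f a b I.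
Proof.
  intros H. destruct (ex_RInt_continuous (V := R_CompleteNormedModule) (fun t => fst (f t)) a b) as [I1 H1].
  { intros x Hx. apply (H x Hx). }
  destruct (ex_RInt_continuous (V := R_CompleteNormedModule) (fun t => snd (f t)) a b) as [I2 H2].
  { intros x Hx. apply (H x Hx). }
  exists (I1, I2). split; auto.
Qed.

Lemma isI_derive f f' a b :
  (forall x, Rmin a b <= x <= Rmax a b -> rderiv f x (f' x)) ->
  (forall x, Rmin a b <= x <= Rmax a b -> rcont f' x) -> isI f' a b (f b - f a)%C.
Proof.
  intros H K. split; simpl.
  - apply (is_RInt_derive (V := R_CompleteNormedModule) (fun t => fst (f t))). intros; apply H; auto. intros; apply K; auto.
  - apply (is_RInt_derive (V := R_CompleteNormedModule) (fun t => snd (f t))). intros; apply H; auto. intros; apply K; auto.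
Qed.

(** The factor 2 is the price of estimating the real and imaginary parts separately. *)
Lemma isI_bound f a b I M : a <= b -> (forall x, a <= x <= b -> Cmod (f x)%C <= M) ->
  isI f a b I -> Cmod I <= 2 * M * (b - a).
Proof.
  intros Hab H [A B].
  assert (G : forall (g : R -> R) v, (forall x, a <= x <= b -> Rabs (g x) <= M) -> is_RInt g a b v -> Rabs v <= (b - a) * M).
  { intros g v Hg Hv. apply (norm_RInt_le_const (V := R_NormedModule) g a b v M Hab); auto. }
  eapply Rle_trans; [apply Cmod_le_sum|].
  assert (Rabs (fst I) <= (b - a) * M).
  { eapply G; [|exact A]. intros x Hx. eapply Rle_trans; [apply fst_le_Cmod|auto]. }
  assert (Rabs (snd I) <= (b - a) * M).
  { eapply G; [|exact B]. intros x Hx. eapply Rle_trans; [apply snd_le_Cmod|auto]. }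
  lra.
Qed.

Lemma isI_const c a b : isI (fun _ => c) a b (RtoC (b - a) * c)%C.
Proof.
  split; simpl.
  - replace ((b - a) * fst c - 0 * snd c) with ((b - a) * fst c) by ring. apply (is_RInt_const (V := R_NormedModule)).
  - replace ((b - a) * snd c + 0 * fst c) with ((b - a) * snd c) by ring. apply (is_RInt_const (V := R_NormedModule)).
Qed.

(** * Goursat's theorem *)

Lemma Ci2 : (Ci * Ci = - (1))%C.
Proof. apply injective_projections; simpl; ring. Qed.

(** Counterclockwise boundary integral: [I1], [I2], [I3], [I4] belong to the bottom, top, left and
    right sides, and [Ci] accounts for dz on the vertical ones. It is a relation rather than a
    function, so that existence and uniqueness are handled separately. *)
Definition rectI (f : C -> C) (a b c d : R) (J : C) : Prop :=
  exists I1 I2 I3 I4, isI (fun t => f (t, c)) a b I1 /\ isI (fun t => f (t, d)) a b I2 /\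
    isI (fun s => f (a, s)) c d I3 /\ isI (fun s => f (b, s)) c d I4 /\
    J = (I1 - I2 + Ci * (I4 - I3))%C.

Definition rectcont (f : C -> C) (a b c d : R) : Prop :=
  forall x y, a <= x <= b -> c <= y <= d -> ccont f (x, y).

Lemma rcont_horizontal c x : rcont (fun t : R => (t, c)) x.
Proof. split; simpl. apply continuous_id. apply continuous_const. Qed.

Lemma rcont_vertical a y : rcont (fun s : R => (a, s)) y.
Proof. split; simpl. apply continuous_const. apply continuous_id. Qed.

Lemma rderiv_horizontal c x : rderiv (fun t : R => (t, c)) x 1%C.
Proof. split; simpl. apply (is_derive_id (K := R_AbsRing)). apply (is_derive_const (K := R_AbsRing) (V := R_NormedModule)). Qed.

Lemma rderiv_vertical a y : rderiv (fun s : R => (a, s)) y Ci.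
Proof. split; simpl. apply (is_derive_const (K := R_AbsRing) (V := R_NormedModule)). apply (is_derive_id (K := R_AbsRing)). Qed.

Lemma isI_hor f a b c : a <= b -> (forall x, a <= x <= b -> ccont f (x, c)) ->
  exists I, isI (fun t => f (t, c)) a b I.
Proof.
  intros Hab H. apply isI_cont. intros x Hx. rewrite Rmin_left, Rmax_right in Hx by lra.
  apply (ccont_rcont f (fun t => (t, c))); [apply H; auto|apply rcont_horizontal].
Qed.

Lemma isI_ver f a c d : c <= d -> (forall y, c <= y <= d -> ccont f (a, y)) ->
  exists I, isI (fun t => f (a, t)) c d I.
Proof.
  intros Hab H. apply isI_cont. intros x Hx. rewrite Rmin_left, Rmax_right in Hx by lra.
  apply (ccont_rcont f (fun t => (a, t))); [apply H; auto|apply rcont_vertical].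
Qed.

Lemma rectI_ex f a b c d : a <= b -> c <= d -> rectcont f a b c d -> exists J, rectI f a b c d J.
Proof.
  intros Hab Hcd H.
  destruct (isI_hor f a b c) as [I1 H1]; auto. { intros; apply H; lra. }
  destruct (isI_hor f a b d) as [I2 H2]; auto. { intros; apply H; lra. }
  destruct (isI_ver f a c d) as [I3 H3]; auto. { intros; apply H; lra. }
  destruct (isI_ver f b c d) as [I4 H4]; auto. { intros; apply H; lra. }
  eexists. exists I1, I2, I3, I4. repeat split; try apply H1; try apply H2; try apply H3; try apply H4.
Qed.

Lemma rectI_unique f a b c d J J' : rectI f a b c d J -> rectI f a b c d J' -> J = J'.
Proof.
  intros (I1 & I2 & I3 & I4 & H1 & H2 & H3 & H4 & ->) (I1' & I2' & I3' & I4' & H1' & H2' & H3' & H4' & ->).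
  rewrite (isI_unique _ _ _ _ _ H1 H1'), (isI_unique _ _ _ _ _ H2 H2'),
    (isI_unique _ _ _ _ _ H3 H3'), (isI_unique _ _ _ _ _ H4 H4'). auto.
Qed.

Lemma rectI_split_hor f a m b c d J1 J2 :
  rectI f a m c d J1 -> rectI f m b c d J2 -> rectI f a b c d (J1 + J2)%C.
Proof.
  intros (I1 & I2 & I3 & I4 & H1 & H2 & H3 & H4 & ->) (I1' & I2' & I3' & I4' & H1' & H2' & H3' & H4' & ->).
  rewrite (isI_unique _ _ _ _ _ H3' H4).
  exists (I1 + I1')%C, (I2 + I2')%C, I3, I4'.
  split; [eapply isI_Chasles; eauto|]. split; [eapply isI_Chasles; eauto|]. split; auto. split; auto. ring.
Qed.

Lemma rectI_split_ver f a b c m d J1 J2 :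
  rectI f a b c m J1 -> rectI f a b m d J2 -> rectI f a b c d (J1 + J2)%C.
Proof.
  intros (I1 & I2 & I3 & I4 & H1 & H2 & H3 & H4 & ->) (I1' & I2' & I3' & I4' & H1' & H2' & H3' & H4' & ->).
  rewrite (isI_unique _ _ _ _ _ H1' H2).
  exists I1, I2', (I3 + I3')%C, (I4 + I4')%C.
  split; auto. split; auto. split; [eapply isI_Chasles; eauto|]. split; [eapply isI_Chasles; eauto|]. ring.
Qed.

Lemma rectI_primitive f g a b c d : a <= b -> c <= d -> rectcont f a b c d ->
  (forall x y, a <= x <= b -> c <= y <= d -> cderiv g (x, y) (f (x, y))) -> rectI f a b c d 0%C.
Proof.
  intros Hab Hcd Hc H.
  exists (g (b, c) - g (a, c))%C, (g (b, d) - g (a, d))%C, (- Ci * (g (a, d) - g (a, c)))%C, (- Ci * (g (b, d) - g (b, c)))%C.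
  assert (HH : forall y, c <= y <= d -> isI (fun t => f (t, y)) a b (g (b, y) - g (a, y))%C).
  { intros y Hy. apply (isI_derive (fun t => g (t, y)) (fun t => f (t, y))); intros x Hx; rewrite Rmin_left, Rmax_right in Hx by lra.
    - eapply rderiv_eq. apply (cderiv_rderiv g (fun t => (t, y))). apply H; auto. apply rderiv_horizontal. ring.
    - apply (ccont_rcont f (fun t => (t, y))). apply Hc; auto. apply rcont_horizontal. }
  (* Along a vertical side the derivative of [g] is [f * Ci], whence the factor [- Ci], the inverse
     of [Ci]. *)
  assert (HV : forall x, a <= x <= b -> isI (fun t => f (x, t)) c d (- Ci * (g (x, d) - g (x, c)))%C).
  { intros x Hx. apply (isI_ext (fun t => - Ci * (f (x, t) * Ci))%C); auto.
    { intros. transitivity (- (Ci * Ci) * f (x, x0))%C; [ring|]. rewrite Ci2. ring. }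
    apply isI_scal.
    apply (isI_derive (fun t => g (x, t)) (fun t => f (x, t) * Ci)%C); intros y Hy; rewrite Rmin_left, Rmax_right in Hy by lra.
    - apply (cderiv_rderiv g (fun t => (x, t))). apply H; auto. apply rderiv_vertical.
    - apply rcont_mult. apply (ccont_rcont f (fun t => (x, t))). apply Hc; auto. apply rcont_vertical. apply rcont_const. }
  split; [apply HH; lra|]. split; [apply HH; lra|]. split; [apply HV; lra|]. split; [apply HV; lra|].
  transitivity (g (b, c) - g (a, c) - (g (b, d) - g (a, d)) - (Ci * Ci) * (g (b, d) - g (b, c) - (g (a, d) - g (a, c))))%C; [|ring].
  rewrite Ci2. ring.
Qed.

Lemma rectI_plus f g a b c d J J' : rectI f a b c d J -> rectI g a b c d J' ->
  rectI (fun z => f z + g z)%C a b c d (J + J')%C.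
Proof.
  intros (I1 & I2 & I3 & I4 & H1 & H2 & H3 & H4 & ->) (I1' & I2' & I3' & I4' & H1' & H2' & H3' & H4' & ->).
  exists (I1 + I1')%C, (I2 + I2')%C, (I3 + I3')%C, (I4 + I4')%C.
  split; [apply isI_plus; auto|]. split; [apply isI_plus; auto|].
  split; [apply isI_plus; auto|]. split; [apply isI_plus; auto|]. ring.
Qed.

Lemma rectI_bound f a b c d J M : a <= b -> c <= d ->
  (forall x y, a <= x <= b -> c <= y <= d -> Cmod (f (x, y))%C <= M) ->
  rectI f a b c d J -> Cmod J <= 4 * M * ((b - a) + (d - c)).
Proof.
  intros Hab Hcd H (I1 & I2 & I3 & I4 & H1 & H2 & H3 & H4 & ->).
  apply (isI_bound _ _ _ _ M) in H1; [|auto|intros; apply H; lra].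
  apply (isI_bound _ _ _ _ M) in H2; [|auto|intros; apply H; lra].
  apply (isI_bound _ _ _ _ M) in H3; [|auto|intros; apply H; lra].
  apply (isI_bound _ _ _ _ M) in H4; [|auto|intros; apply H; lra].
  eapply Rle_trans; [apply Cmod_triangle|]. rewrite Cmod_mult, Cmod_Ci.
  pose proof (Cmod_triangle_minus I1 I2). pose proof (Cmod_triangle_minus I4 I3). lra.
Qed.

Lemma ccont_minus f g t : ccont f t -> ccont g t -> ccont (fun z => f z - g z)%C t.
Proof.
  intros Hf Hg eps He. destruct (Hf (eps/2)) as [d1 [Hd1 K1]]; [lra|]. destruct (Hg (eps/2)) as [d2 [Hd2 K2]]; [lra|].
  exists (Rmin d1 d2). split; [apply Rmin_pos; auto|]. intros h Hh.
  specialize (K1 h (Rlt_le_trans _ _ _ Hh (Rmin_l _ _))).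
  specialize (K2 h (Rlt_le_trans _ _ _ Hh (Rmin_r _ _))).
  replace (f (t + h) - g (t + h) - (f t - g t))%C with ((f (t + h) - f t) - (g (t + h) - g t))%C by ring.
  eapply Rle_trans; [apply Cmod_triangle_minus|]. lra.
Qed.

Lemma Cmod_pair_le x y a b c d : a <= x <= b -> c <= y <= d -> forall x0 y0, a <= x0 <= b -> c <= y0 <= d ->
  Cmod ((x, y) - (x0, y0))%C <= (b - a) + (d - c).
Proof.
  intros. eapply Rle_trans; [apply Cmod_le_sum|]. simpl.
  assert (Rabs (x + - x0) <= b - a) by (apply Rabs_le; lra).
  assert (Rabs (y + - y0) <= d - c) by (apply Rabs_le; lra). lra.
Qed.

(** The affine part of [f] at the point has a primitive and integrates to 0. The remainder is at
    most eps times the diameter, on a boundary of comparable length, which gives a bound of the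
    order of the squared sides. *)
Lemma rectI_local f x0 y0 l eps : 0 < eps -> cderiv f (x0, y0) l ->
  exists delta, 0 < delta /\ forall a b c d J, a <= x0 <= b -> c <= y0 <= d -> (b - a) + (d - c) < delta ->
    rectcont f a b c d -> rectI f a b c d J -> Cmod J <= 8 * eps * ((b - a) ^ 2 + (d - c) ^ 2).
Proof.
  intros He H. destruct (H eps He) as [delta [Hd K]]. exists delta. split; auto.
  intros a b c d J Hx Hy Hs Hc HJ.
  set (p := (x0, y0) : C).
  set (A := fun z : C => (f p + l * (z - p))%C).
  assert (DA : forall z, cderiv A z l).
  { intros z. eapply cderiv_eq. apply cderiv_plus. apply cderiv_const. apply cderiv_scal. apply cderiv_minus.
    apply cderiv_id. apply cderiv_const. ring. }
  assert (IA : rectI A a b c d 0%C).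
  { apply (rectI_primitive A (fun z => f p * z + (l / 2) * ((z - p) * (z - p)))%C); try lra.
    - intros x y _ _. eapply cderiv_ccont. apply DA.
    - intros x y _ _. eapply cderiv_eq. apply cderiv_plus. apply cderiv_scal, cderiv_id. apply cderiv_scal.
      apply cderiv_mult; apply cderiv_minus; (apply cderiv_id || apply cderiv_const).
      unfold A. field. }
  destruct (rectI_ex (fun z => f z - A z)%C a b c d) as [JE HJE]; try lra.
  { intros x y Hx' Hy'. apply ccont_minus. apply Hc; auto. eapply cderiv_ccont; apply DA. }
  assert (EJ : J = JE).
  { eapply rectI_unique; [exact HJ|]. pose proof (rectI_plus _ _ _ _ _ _ _ _ IA HJE) as Q.
    replace JE with (0 + JE)%C by ring.
    destruct Q as (I1 & I2 & I3 & I4 & H1 & H2 & H3 & H4 & E).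
    exists I1, I2, I3, I4.
    split; [refine (isI_ext _ _ _ _ _ _ _ H1); [lra|intros; cbv beta; ring]|].
    split; [refine (isI_ext _ _ _ _ _ _ _ H2); [lra|intros; cbv beta; ring]|].
    split; [refine (isI_ext _ _ _ _ _ _ _ H3); [lra|intros; cbv beta; ring]|].
    split; [refine (isI_ext _ _ _ _ _ _ _ H4); [lra|intros; cbv beta; ring]|]. exact E. }
  subst JE.
  assert (B : Cmod J <= 4 * (eps * ((b - a) + (d - c))) * ((b - a) + (d - c))).
  { eapply rectI_bound; [| | |exact HJE]; try lra. intros x y Hx' Hy'.
    pose proof (Cmod_pair_le x y a b c d Hx' Hy' x0 y0 Hx Hy) as Hz. fold p in Hz.
    specialize (K ((x, y) - p)%C). replace ((x0, y0) + ((x, y) - p))%C with ((x, y) : C) in K by (unfold p; apply injective_projections; simpl; ring).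
    fold p in K. unfold A. replace (f (x, y) - (f p + l * ((x, y) - p)))%C with (f (x, y) - f p - l * ((x, y) - p))%C by ring.
    eapply Rle_trans; [apply K; lra|]. apply Rmult_le_compat_l; lra. }
  eapply Rle_trans; [exact B|].
  replace (4 * (eps * (b - a + (d - c))) * (b - a + (d - c))) with (4 * eps * (b - a + (d - c)) ^ 2) by ring.
  replace (8 * eps * ((b - a) ^ 2 + (d - c) ^ 2)) with (4 * eps * (2 * ((b - a) ^ 2 + (d - c) ^ 2))) by ring.
  apply Rmult_le_compat_l; [lra|]. pose proof (pow2_ge_0 ((b - a) - (d - c))). lra.
Qed.

Lemma half_pow_small (e w : R) : 0 < e -> exists k : nat, w / 2 ^ k < e.
Proof.
  intros He. destruct (Rle_lt_dec w 0) as [Hw|Hw].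
  { exists 0%nat. simpl. lra. }
  destruct (pow_lt_1_zero (/2)) with (y := e / w) as [N HN].
  - rewrite Rabs_right; lra.
  - apply Rdiv_lt_0_compat; lra.
  - exists N. specialize (HN N (le_n _)). rewrite Rabs_right in HN by (left; apply pow_lt; lra).
    rewrite pow_inv in HN.
    apply Rmult_lt_compat_l with (r := w) in HN; auto. unfold Rdiv in *.
    replace (w * (e * / w)) with e in HN by (field; lra). exact HN.
Qed.

(** The common point is the supremum of the left endpoints: each of them is below every right
    endpoint. *)
Lemma nested_halves (a : nat -> R) (w : R) : 0 <= w ->
  (forall k, a (S k) = a k \/ a (S k) = a k + w / 2 ^ S k) ->
  exists x, forall k, a k <= x <= a k + w / 2 ^ k.
Proof.
  intros Hw H.
  assert (P : forall k, 0 <= w / 2 ^ k). { intros k. apply Rdiv_le_0_compat; auto. apply pow_lt; lra. }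
  assert (St : forall k, a k <= a (S k) /\ a (S k) + w / 2 ^ S k <= a k + w / 2 ^ k).
  { intros k. assert (E : w / 2 ^ k = 2 * (w / 2 ^ S k)). { simpl. field. apply pow_nonzero; lra. }
    pose proof (P (S k)). destruct (H k) as [-> | ->]; lra. }
  assert (M1 : forall k j, a k <= a (k + j)%nat).
  { intros k j. induction j. rewrite Nat.add_0_r; lra. rewrite Nat.add_succ_r. destruct (St (k + j)%nat); lra. }
  assert (M2 : forall k j, a (k + j)%nat + w / 2 ^ (k + j) <= a k + w / 2 ^ k).
  { intros k j. induction j. rewrite Nat.add_0_r; lra. rewrite Nat.add_succ_r. destruct (St (k + j)%nat); lra. }
  assert (M : forall k j, a k <= a j + w / 2 ^ j).
  { intros k j. destruct (Nat.le_ge_cases k j) as [L|L].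
    - replace j with (k + (j - k))%nat by lia. pose proof (M1 k (j - k)%nat). pose proof (P (k + (j - k))%nat). lra.
    - replace k with (j + (k - j))%nat by lia. pose proof (M2 j (k - j)%nat). pose proof (P (j + (k - j))%nat). lra. }
  destruct (completeness (fun x => exists k, x = a k)) as [x [U L]].
  - exists (a 0%nat + w / 2 ^ 0). intros y [k ->]. apply M.
  - exists (a 0%nat), 0%nat. auto.
  - exists x. intros k. split.
    + apply U. exists k; auto.
    + apply L. intros y [j ->]. apply M.
Qed.

Theorem goursat f a b c d J : a <= b -> c <= d ->
  (forall x y, a <= x <= b -> c <= y <= d -> exists l, cderiv f (x, y) l) ->
  rectI f a b c d J -> J = 0%C.
Proof.
  intros Hab Hcd H HJ. set (w := b - a). set (h := d - c).
  assert (Hc : forall a' b' c' d', a <= a' -> b' <= b -> c <= c' -> d' <= d -> rectcont f a' b' c' d').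
  { intros a' b' c' d' ? ? ? ? x y Hx Hy. destruct (H x y) as [l Hl]; try lra. eapply cderiv_ccont; eauto. }
  apply Cmod_eq_0_le. intros e He.
  (* The [+ 1] keeps the denominator positive for degenerate rectangles. *)
  set (eps := e / (w ^ 2 + h ^ 2 + 1)).
  assert (Heps : 0 < eps). { apply Rdiv_lt_0_compat; auto. nra. }
  cut (Cmod J <= eps * (w ^ 2 + h ^ 2)).
  { intros B. eapply Rle_trans; [exact B|]. unfold eps.
    apply Rle_trans with (e / (w ^ 2 + h ^ 2 + 1) * (w ^ 2 + h ^ 2 + 1)).
    - apply Rmult_le_compat_l; [left; exact Heps|lra].
    - right. field. nra. }
  apply Rnot_lt_le. intros Hbad.
  (* [p] is the lower left corner of a rectangle of generation [k]. Its integral exceeds a bound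
     which is divided by exactly 4 under quartering, so a bad rectangle has a bad quarter. *)
  set (Bad := fun (k : nat) (p : R * R) =>
    a <= fst p /\ fst p + w / 2 ^ k <= b /\ c <= snd p /\ snd p + h / 2 ^ k <= d /\
    exists J', rectI f (fst p) (fst p + w / 2 ^ k) (snd p) (snd p + h / 2 ^ k) J' /\
      eps * ((w / 2 ^ k) ^ 2 + (h / 2 ^ k) ^ 2) < Cmod J').
  assert (B0 : Bad 0%nat (a, c)).
  { unfold Bad; simpl. unfold w, h.
    replace (a + (b - a) / 1) with b by field. replace (c + (d - c) / 1) with d by field.
    repeat split; try lra. exists J. split; auto. fold w h. rewrite !Rdiv_1_r. simpl in Hbad. exact Hbad. }
  assert (Pw : forall k, 0 <= w / 2 ^ k). { intros k. apply Rdiv_le_0_compat. unfold w; lra. apply pow_lt; lra. }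
  assert (Ph : forall k, 0 <= h / 2 ^ k). { intros k. apply Rdiv_le_0_compat. unfold h; lra. apply pow_lt; lra. }
  set (Step := fun (k : nat) (p q : R * R) =>
    Bad (S k) q /\ (fst q = fst p \/ fst q = fst p + w / 2 ^ S k) /\ (snd q = snd p \/ snd q = snd p + h / 2 ^ S k)).
  assert (St : forall k p, Bad k p -> exists q, Step k p q).
  { intros k [x y] (A1 & A2 & A3 & A4 & J' & HJ' & Hb). simpl in A1, A2, A3, A4, HJ'.
    assert (Ew : w / 2 ^ k = 2 * (w / 2 ^ S k)). { simpl. field. apply pow_nonzero; lra. }
    assert (Eh : h / 2 ^ k = 2 * (h / 2 ^ S k)). { simpl. field. apply pow_nonzero; lra. }
    pose proof (Pw (S k)) as Pw'. pose proof (Ph (S k)) as Ph'.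
    set (w' := w / 2 ^ S k) in *. set (h' := h / 2 ^ S k) in *.
    destruct (rectI_ex f x (x + w') y (y + h')) as [J1 H1]; try lra. { apply Hc; lra. }
    destruct (rectI_ex f (x + w') (x + w' + w') y (y + h')) as [J2 H2]; try lra. { apply Hc; lra. }
    destruct (rectI_ex f x (x + w') (y + h') (y + h' + h')) as [J3 H3]; try lra. { apply Hc; lra. }
    destruct (rectI_ex f (x + w') (x + w' + w') (y + h') (y + h' + h')) as [J4 H4]; try lra. { apply Hc; lra. }
    assert (EJ : J' = (J1 + J2 + (J3 + J4))%C).
    { eapply rectI_unique; [exact HJ'|]. rewrite Ew, Eh.
      replace (x + 2 * w') with (x + w' + w') by ring. replace (y + 2 * h') with (y + h' + h') by ring.
      eapply rectI_split_ver; eapply rectI_split_hor; eauto. }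
    rewrite Ew, Eh in Hb.
    set (B := eps * (w' ^ 2 + h' ^ 2)).
    assert (Hb' : 4 * B < Cmod J') by (unfold B; lra).
    assert (Tri : Cmod J' <= Cmod J1 + Cmod J2 + (Cmod J3 + Cmod J4)).
    { rewrite EJ. eapply Rle_trans; [apply Cmod_triangle|]. apply Rplus_le_compat; apply Cmod_triangle. }
    assert (Mk : forall u v J0, (u = x \/ u = x + w') -> (v = y \/ v = y + h') -> rectI f u (u + w') v (v + h') J0 -> B < Cmod J0 ->
      exists q, Step k (x, y) q).
    { intros u v J0 Hu Hv HI HB. exists (u, v). unfold Step, Bad; simpl fst; simpl snd. fold w' h'.
      repeat split; auto; try (destruct Hu; destruct Hv; subst; lra). exists J0. split; auto. }
    destruct (Rlt_dec B (Cmod J1)) as [Q1|Q1]. { eapply (Mk x y J1); auto. }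
    destruct (Rlt_dec B (Cmod J2)) as [Q2|Q2]. { eapply (Mk (x + w') y J2); auto. }
    destruct (Rlt_dec B (Cmod J3)) as [Q3|Q3]. { eapply (Mk x (y + h') J3); auto. }
    destruct (Rlt_dec B (Cmod J4)) as [Q4|Q4]. { eapply (Mk (x + w') (y + h') J4); auto. }
    lra. }
  set (s := fix s (k : nat) : R * R := match k with O => (a, c) | S k' => epsilon (inhabits (a, c)) (Step k' (s k')) end).
  assert (Bs : forall k, Bad k (s k)).
  { induction k as [|k IH]; [exact B0|]. destruct (epsilon_spec (inhabits (a, c)) (Step k (s k)) (St k (s k) IH)) as [Q _]. exact Q. }
  assert (Ss : forall k, Step k (s k) (s (S k))).
  { intros k. apply (epsilon_spec (inhabits (a, c)) (Step k (s k)) (St k (s k) (Bs k))). }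
  destruct (nested_halves (fun k => fst (s k)) w) as [x Hx]; [unfold w; lra|intros k; apply Ss|].
  destruct (nested_halves (fun k => snd (s k)) h) as [y Hy]; [unfold h; lra|intros k; apply Ss|].
  destruct (H x y) as [l Hl].
  { specialize (Hx 0%nat). simpl in Hx. unfold w in Hx. lra. }
  { specialize (Hy 0%nat). simpl in Hy. unfold h in Hy. lra. }
  (* [eps / 8] cancels the factor 8 of the local estimate, which then contradicts badness of a small
     rectangle around the limit point. *)
  destruct (rectI_local f x y l (eps / 8)) as [delta [Hd K]]; [lra|auto|].
  destruct (half_pow_small delta (w + h) Hd) as [k Hk].
  destruct (Bs k) as (A1 & A2 & A3 & A4 & J' & HJ' & Hb).
  assert (Z : Cmod J' <= 8 * (eps / 8) * ((fst (s k) + w / 2 ^ k - fst (s k)) ^ 2 + (snd (s k) + h / 2 ^ k - snd (s k)) ^ 2)).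
  { apply K with (a := fst (s k)) (c := snd (s k)); auto.
    unfold Rdiv in *. lra. }
  replace (fst (s k) + w / 2 ^ k - fst (s k)) with (w / 2 ^ k) in Z by ring.
  replace (snd (s k) + h / 2 ^ k - snd (s k)) with (h / 2 ^ k) in Z by ring. lra.
Qed.

Lemma isI_swap f a b I : isI f a b I -> isI f b a (- I)%C.
Proof. intros [A B]. split; simpl; apply (is_RInt_swap (V := R_NormedModule)); auto. Qed.

Lemma isI_bound_gen f a b I M : (forall x, Rmin a b <= x <= Rmax a b -> Cmod (f x)%C <= M) ->
  isI f a b I -> Cmod I <= 2 * M * Rabs (b - a).
Proof.
  intros H HI. destruct (Rle_dec a b) as [L|L].
  - rewrite Rabs_right by lra. rewrite Rmin_left, Rmax_right in H by lra. eapply isI_bound; eauto.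
  - rewrite Rabs_left by lra. rewrite Rmin_right, Rmax_left in H by lra.
    rewrite <- Cmod_opp. replace (- (b - a)) with (a - b) by ring.
    eapply isI_bound; [lra|exact H|apply isI_swap; exact HI].
Qed.

Lemma rectI_swap_hor f a b c d J : rectI f a b c d J -> rectI f b a c d (- J)%C.
Proof.
  intros (I1 & I2 & I3 & I4 & H1 & H2 & H3 & H4 & ->). exists (- I1)%C, (- I2)%C, I4, I3.
  split; [apply isI_swap; auto|]. split; [apply isI_swap; auto|]. split; auto. split; auto. ring.
Qed.

Lemma rectI_swap_ver f a b c d J : rectI f a b c d J -> rectI f a b d c (- J)%C.
Proof.
  intros (I1 & I2 & I3 & I4 & H1 & H2 & H3 & H4 & ->). exists I2, I1, (- I3)%C, (- I4)%C.
  split; auto. split; auto. split; [apply isI_swap; auto|]. split; [apply isI_swap; auto|]. ring.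
Qed.

(** Primitives are built with increments of either sign, so the rectangles met there may have
    reversed sides. *)
Lemma goursat_gen f a b c d J :
  (forall x y, Rmin a b <= x <= Rmax a b -> Rmin c d <= y <= Rmax c d -> exists l, cderiv f (x, y) l) ->
  rectI f a b c d J -> J = 0%C.
Proof.
  assert (O : forall z : C, (- z)%C = 0%C -> z = 0%C). { intros z Hz. replace z with (- - z)%C by ring. rewrite Hz. ring. }
  assert (G : forall a b c d J, c <= d ->
    (forall x y, Rmin a b <= x <= Rmax a b -> c <= y <= d -> exists l, cderiv f (x, y) l) ->
    rectI f a b c d J -> J = 0%C).
  { clear a b c d J. intros a b c d J Hcd H HJ. destruct (Rle_dec a b) as [L|L].
    - rewrite Rmin_left, Rmax_right in H by lra. apply (goursat f a b c d); auto.
    - rewrite Rmin_right, Rmax_left in H by lra. apply O. apply (goursat f b a c d); auto; [lra|].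
      apply rectI_swap_hor; auto. }
  intros H HJ. destruct (Rle_dec c d) as [L|L].
  - rewrite (Rmin_left c d), (Rmax_right c d) in H by lra. apply (G a b c d); auto.
  - rewrite (Rmin_right c d), (Rmax_left c d) in H by lra. apply O. apply (G a b d c); auto; [lra|].
    apply rectI_swap_ver; auto.
Qed.

Lemma Cmod_pair_mono x y x' y' : Rabs x' <= Rabs x -> Rabs y' <= Rabs y -> Cmod (x', y')%C <= Cmod (x, y)%C.
Proof.
  intros Hx Hy. unfold Cmod; simpl fst; simpl snd. apply sqrt_le_1_alt.
  rewrite <- (pow2_abs x), <- (pow2_abs y), <- (pow2_abs x'), <- (pow2_abs y').
  pose proof (Rabs_pos x'). pose proof (Rabs_pos y'). nra.
Qed.

Lemma Rabs_between x t : Rmin 0 x <= t <= Rmax 0 x -> Rabs t <= Rabs x.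
Proof.
  unfold Rmin, Rmax. destruct (Rle_dec 0 x); intros; unfold Rabs; destruct (Rcase_abs t); destruct (Rcase_abs x); lra.
Qed.

Lemma Rabs_between_shift x h t : Rmin x (x + h) <= t <= Rmax x (x + h) -> Rabs (t - x) <= Rabs h.
Proof.
  unfold Rmin, Rmax. destruct (Rle_dec x (x + h)); intros; unfold Rabs; destruct (Rcase_abs (t - x)); destruct (Rcase_abs h); lra.
Qed.

(** * Primitives of holomorphic functions on a disc *)

Definition Hol (rho : R) (f : C -> C) : Prop := forall t, Cmod t < rho -> exists l, cderiv f t l.

Definition cI (f : R -> C) (a b : R) : C := (RInt (fun t => fst (f t)) a b, RInt (fun t => snd (f t)) a b).

Lemma cI_correct f a b : (exists I, isI f a b I) -> isI f a b (cI f a b).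
Proof.
  intros [I [A B]]. split; simpl; apply (RInt_correct (V := R_CompleteNormedModule)); eexists; eauto.
Qed.

Lemma cI_unique f a b I : isI f a b I -> cI f a b = I.
Proof. intros H. eapply isI_unique; [apply cI_correct; eauto|exact H]. Qed.

Theorem primitive_disc rho f : Hol rho f -> exists G, forall t, Cmod t < rho -> cderiv G t (f t).
Proof.
  intros Hf.
  assert (Cf : forall t, Cmod t < rho -> ccont f t). { intros t Ht. destruct (Hf t Ht). eapply cderiv_ccont; eauto. }
  (* Integration along the real axis and then vertically: the whole path stays in the disc. *)
  exists (fun z => cI (fun t => f (t, 0)) 0 (fst z) + Ci * cI (fun s => f (fst z, s)) 0 (snd z))%C.
  intros [x y] Hz.
  assert (HI : forall c a b, (forall t, Rmin a b <= t <= Rmax a b -> Cmod (t, c)%C < rho) -> isI (fun t => f (t, c)) a b (cI (fun t => f (t, c)) a b)).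
  { intros c a b H. apply cI_correct, isI_cont. intros t Ht.
    apply (ccont_rcont f (fun t => (t, c))); [apply Cf; auto|apply rcont_horizontal]. }
  assert (VI : forall c a b, (forall t, Rmin a b <= t <= Rmax a b -> Cmod (c, t)%C < rho) -> isI (fun t => f (c, t)) a b (cI (fun t => f (c, t)) a b)).
  { intros c a b H. apply cI_correct, isI_cont. intros t Ht.
    apply (ccont_rcont f (fun t => (c, t))); [apply Cf; auto|apply rcont_vertical]. }
  intros eps He. destruct (Cf (x, y) Hz (eps / 4)) as [d [Hd K]]; [lra|].
  exists (Rmin (d / 2) ((rho - Cmod (x, y)%C) / 2)). split; [apply Rmin_pos; lra|].
  intros [h k] Hh.
  assert (Hh1 := Rlt_le_trans _ _ _ Hh (Rmin_l _ _)). assert (Hh2 := Rlt_le_trans _ _ _ Hh (Rmin_r _ _)).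
  assert (Bh : Rabs h <= Cmod (h, k)%C) by apply (fst_le_Cmod (h, k)).
  assert (Bk : Rabs k <= Cmod (h, k)%C) by apply (snd_le_Cmod (h, k)).
  simpl fst. simpl snd.
  (* This covers the thin rectangle between the axis and height [y] over the horizontal
     increment. *)
  assert (In : forall t s, Rabs s <= Rabs y -> Rabs (t - x) <= Rabs h -> Cmod (t, s)%C < rho).
  { intros t s Hs Ht. replace (t, s) with ((x, s) + ((t - x)%R, 0))%C by (apply injective_projections; simpl; ring).
    eapply Rle_lt_trans; [apply Cmod_triangle|].
    pose proof (Cmod_pair_mono x y x s (Rle_refl _) Hs).
    pose proof (Cmod_le_sum ((t - x)%R, 0)) as Q. simpl in Q. rewrite Rabs_R0 in Q. lra. }
  assert (In2 : forall t s, Rabs (t - x) <= Rabs h -> Rabs (s - y) <= Rabs k -> Cmod (t, s)%C < rho /\ Cmod (f (t, s) - f (x, y))%C <= eps / 4).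
  { intros t s Ht Hs.
    assert (Q : Cmod ((t - x)%R, (s - y)%R)%C <= Cmod (h, k)%C). { apply Cmod_pair_mono; auto. }
    assert (E : (t, s) = ((x, y) + ((t - x)%R, (s - y)%R))%C) by (apply injective_projections; simpl; ring).
    rewrite E. split.
    - eapply Rle_lt_trans; [apply Cmod_triangle|]. lra.
    - apply K. lra. }
  assert (A0 := HI 0 0 x). assert (A1 := HI 0 x (x + h)). assert (B0 := VI x 0 y). assert (B1 := VI (x + h) 0 y).
  assert (C1 := VI (x + h) y (y + k)). assert (D := HI y x (x + h)).
  specialize (A0 ltac:(intros t Ht; apply Rle_lt_trans with (Cmod (x, y)%C); [apply Cmod_pair_mono; [apply Rabs_between; auto|rewrite Rabs_R0; apply Rabs_pos]|auto])).
  specialize (A1 ltac:(intros t Ht; apply In; [rewrite Rabs_R0; apply Rabs_pos|apply Rabs_between_shift; auto])).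
  specialize (B0 ltac:(intros t Ht; apply In; [apply Rabs_between; auto|replace (x - x) with 0 by ring; rewrite Rabs_R0; apply Rabs_pos])).
  specialize (B1 ltac:(intros t Ht; apply In; [apply Rabs_between; auto|replace (x + h - x) with h by ring; lra])).
  specialize (C1 ltac:(intros t Ht; apply In2; [replace (x + h - x) with h by ring; lra|apply Rabs_between_shift; auto])).
  specialize (D ltac:(intros t Ht; apply In; [lra|apply Rabs_between_shift; auto])).
  (* Goursat's theorem on this thin rectangle trades the increment along the axis for one at height
     [y]; afterwards only values of [f] near [(x, y)] occur. *)
  assert (Z : (cI (fun t => f (t, 0)) x (x + h) - cI (fun t => f (t, y)) x (x + h) +
    Ci * (cI (fun t => f ((x + h)%R, t)) 0 y - cI (fun t => f (x, t)) 0 y))%C = 0%C).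
  { apply (goursat_gen f x (x + h) 0 y).
    - intros t s Ht Hs. apply Hf. apply In; [apply Rabs_between; auto|apply Rabs_between_shift; auto].
    - do 4 eexists. split; [exact A1|]. split; [exact D|]. split; [exact B0|]. split; [exact B1|]. auto. }
  rewrite (cI_unique _ _ _ _ (isI_Chasles _ _ _ _ _ _ A0 A1)).
  rewrite (cI_unique _ _ _ _ (isI_Chasles _ _ _ _ _ _ B1 C1)).
  set (a0 := cI (fun t => f (t, 0)) 0 x) in *. set (a1 := cI (fun t => f (t, 0)) x (x + h)) in *.
  set (b0 := cI (fun t => f (x, t)) 0 y) in *. set (b1 := cI (fun t => f ((x + h)%R, t)) 0 y) in *.
  set (c1 := cI (fun t => f ((x + h)%R, t)) y (y + k)) in *. set (dd := cI (fun t => f (t, y)) x (x + h)) in *.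
  replace (a0 + a1 + Ci * (b1 + c1) - (a0 + Ci * b0) - f (x, y) * (h, k))%C with
    ((a1 - dd + Ci * (b1 - b0)) + (dd - h * f (x, y)) + Ci * (c1 - k * f (x, y)))%C.
  2:{ replace ((h, k) : C) with (RtoC h + Ci * RtoC k)%C by (apply injective_projections; simpl; ring). ring. }
  rewrite Z.
  assert (E1 : Cmod (dd - h * f (x, y))%C <= 2 * (eps / 4) * Rabs h).
  { replace h with (x + h - x) at 2 by ring. eapply isI_bound_gen; [|eapply isI_minus; [exact D|]].
    2:{ replace h with (x + h - x) at 2 by ring. apply isI_const. }
    intros t Ht. apply In2. apply Rabs_between_shift; auto. replace (y - y) with 0 by ring. rewrite Rabs_R0; apply Rabs_pos. }
  assert (E2 : Cmod (c1 - k * f (x, y))%C <= 2 * (eps / 4) * Rabs k).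
  { replace k with (y + k - y) at 2 by ring. eapply isI_bound_gen; [|eapply isI_minus; [exact C1|]].
    2:{ replace k with (y + k - y) at 2 by ring. apply isI_const. }
    intros t Ht. apply In2. replace (x + h - x) with h by ring; lra. apply Rabs_between_shift; auto. }
  eapply Rle_trans; [apply Cmod_triangle|]. rewrite Cmod_mult, Cmod_Ci.
  replace (0 + (dd - h * f (x, y)))%C with (dd - h * f (x, y))%C by ring.
  apply Rle_trans with (eps / 2 * Rabs h + eps / 2 * Rabs k); [lra|].
  assert (eps / 2 * Rabs h <= eps / 2 * Cmod (h, k)%C) by (apply Rmult_le_compat_l; lra).
  assert (eps / 2 * Rabs k <= eps / 2 * Cmod (h, k)%C) by (apply Rmult_le_compat_l; lra). lra.
Qed.

(** * Cauchy's formulas on circles *)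

Definition E (x : R) : C := (cos x, sin x).

Lemma rderiv_E x : rderiv E x (Ci * E x)%C.
Proof.
  split; simpl.
  - replace (0 * cos x - 1 * sin x) with (- sin x) by ring. apply is_derive_Reals, derivable_pt_lim_cos.
  - replace (0 * sin x + 1 * cos x) with (cos x) by ring. apply is_derive_Reals, derivable_pt_lim_sin.
Qed.

Lemma Cmod_E x : Cmod (E x)%C = 1.
Proof.
  unfold Cmod, E; simpl. replace (cos x * (cos x * 1) + sin x * (sin x * 1)) with 1.
  apply sqrt_1. pose proof (sin2_cos2 x). unfold Rsqr in H. lra.
Qed.

Lemma E_period : E (2 * PI) = E 0.
Proof. unfold E. rewrite cos_2PI, sin_2PI, cos_0, sin_0. auto. Qed.

Lemma E_conj x : (E x * Cconj (E x)%C)%C = 1%C.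
Proof. rewrite <- Cmod2_conj, Cmod_E. apply injective_projections; simpl; ring. Qed.

Lemma E_neq_0 x : E x <> 0%C.
Proof. apply Cmod_gt_0. rewrite Cmod_E. lra. Qed.

Lemma rcont_E x : rcont E x.
Proof. eapply rderiv_rcont, rderiv_E. Qed.

Lemma quadratic_rderiv (f : R -> C) x l K d : 0 < d ->
  (forall h : R, Rabs h < d -> Cmod (f (x + h)%R - f x - h * l)%C <= K * Rabs h ^ 2) -> rderiv f x l.
Proof.
  intros Hd H. apply rderiv_eps. intros eps He.
  set (K' := Rabs K + 1). assert (0 < K') by (unfold K'; pose proof (Rabs_pos K); lra).
  exists (Rmin d (eps / K')). split. { apply Rmin_pos; auto. apply Rdiv_lt_0_compat; auto. }
  intros h Hh. assert (Hh1 := Rlt_le_trans _ _ _ Hh (Rmin_l _ _)). assert (Hh2 := Rlt_le_trans _ _ _ Hh (Rmin_r _ _)).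
  rewrite (Cmult_comm l). eapply Rle_trans; [apply H; auto|]. pose proof (Rabs_pos h).
  apply Rle_trans with (K' * Rabs h ^ 2).
  - apply Rmult_le_compat_r; [nra|]. unfold K'. pose proof (Rle_abs K). lra.
  - assert (K' * Rabs h <= eps). { apply Rmult_lt_compat_l with (r := K') in Hh2; auto.
      replace (K' * (eps / K')) with eps in Hh2 by (field; lra). lra. }
    replace (K' * Rabs h ^ 2) with (K' * Rabs h * Rabs h) by ring. apply Rmult_le_compat_r; auto.
Qed.

Lemma quadratic_cderiv (f : C -> C) x l K d : 0 < d ->
  (forall h : C, Cmod h < d -> Cmod (f (x + h) - f x - h * l)%C <= K * Cmod h ^ 2) -> cderiv f x l.
Proof.
  intros Hd H eps He.
  set (K' := Rabs K + 1). assert (0 < K') by (unfold K'; pose proof (Rabs_pos K); lra).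
  exists (Rmin d (eps / K')). split. { apply Rmin_pos; auto. apply Rdiv_lt_0_compat; auto. }
  intros h Hh. assert (Hh1 := Rlt_le_trans _ _ _ Hh (Rmin_l _ _)). assert (Hh2 := Rlt_le_trans _ _ _ Hh (Rmin_r _ _)).
  rewrite (Cmult_comm l). eapply Rle_trans; [apply H; auto|]. pose proof (Cmod_ge_0 h).
  apply Rle_trans with (K' * Cmod h ^ 2).
  - apply Rmult_le_compat_r; [nra|]. unfold K'. pose proof (Rle_abs K). lra.
  - assert (K' * Cmod h <= eps). { apply Rmult_lt_compat_l with (r := K') in Hh2; auto.
      replace (K' * (eps / K')) with eps in Hh2 by (field; lra). lra. }
    replace (K' * Cmod h ^ 2) with (K' * Cmod h * Cmod h) by ring. apply Rmult_le_compat_r; auto.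
Qed.

(** A uniform second-order Taylor estimate with derivative [G]. It replaces uniform continuity on
    compact sets when differentiating under an integral, and it already contains the continuity of
    [G]. *)
Definition quad (rho : R) (H G : C -> C) (K : R) : Prop :=
  forall t h, Cmod t < rho -> Cmod (t + h)%C < rho -> Cmod (H (t + h) - H t - h * G t)%C <= K * Cmod h ^ 2.

Lemma quad_cderiv rho H G K t : quad rho H G K -> Cmod t < rho -> cderiv H t (G t).
Proof.
  intros Q Ht. apply (quadratic_cderiv H t (G t) K (rho - Cmod t)); [lra|]. intros h Hh. apply Q; auto.
  eapply Rle_lt_trans; [apply Cmod_triangle|]. lra.
Qed.

(** Expanding from [t] to [t + h] and back, the values of [H] cancel and leave
    [(G (t + h) - G t) * h]. *)
Lemma quad_lipschitz rho H G K t h : quad rho H G K -> Cmod t < rho -> Cmod (t + h)%C < rho ->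
  Cmod (G (t + h) - G t)%C <= 2 * K * Cmod h.
Proof.
  intros Q Ht Hth. destruct (Req_dec (Cmod h) 0) as [Z|Z].
  { apply Cmod_eq_0 in Z. subst h. rewrite Cplus_0_r. replace (G t - G t)%C with (RtoC 0) by ring. rewrite Cmod_0. lra. }
  pose proof (Cmod_ge_0 h). assert (Q1 := Q t h Ht Hth).
  assert (Q2 := Q (t + h)%C (- h)%C Hth). replace (t + h + - h)%C with t in Q2 by ring. specialize (Q2 Ht).
  rewrite Cmod_opp in Q2. apply Rmult_le_reg_r with (Cmod h); [lra|].
  rewrite <- Cmod_mult.
  replace ((G (t + h) - G t) * h)%C with ((H (t + h) - H t - h * G t) + (H t - H (t + h) - - h * G (t + h)))%C by ring.
  eapply Rle_trans; [apply Cmod_triangle|]. simpl in *. lra.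
Qed.

Lemma quad_ccont rho H G K t : quad rho H G K -> Cmod t < rho -> ccont G t.
Proof.
  intros Q Ht eps He. set (K' := 2 * Rabs K + 1). assert (0 < K') by (unfold K'; pose proof (Rabs_pos K); lra).
  exists (Rmin (rho - Cmod t) (eps / K')). split.
  { apply Rmin_pos; [lra|]. apply Rdiv_lt_0_compat; auto. }
  intros h Hh. assert (Hh1 := Rlt_le_trans _ _ _ Hh (Rmin_l _ _)). assert (Hh2 := Rlt_le_trans _ _ _ Hh (Rmin_r _ _)).
  eapply Rle_trans; [eapply quad_lipschitz; eauto|].
  { eapply Rle_lt_trans; [apply Cmod_triangle|]. lra. }
  pose proof (Cmod_ge_0 h). apply Rle_trans with (K' * Cmod h).
  - apply Rmult_le_compat_r; auto. unfold K'. pose proof (Rle_abs K). lra.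
  - apply Rmult_lt_compat_l with (r := K') in Hh2; auto. replace (K' * (eps / K')) with eps in Hh2 by (field; lra). lra.
Qed.

Lemma segment_in_disc rho t h (x : R) : Cmod t < rho -> Cmod (t + h)%C < rho -> 0 <= x <= 1 -> Cmod (t + x * h)%C < rho.
Proof.
  intros H1 H2 Hx. replace (t + x * h)%C with ((1 - x)%R * t + x * (t + h))%C.
  2:{ rewrite RtoC_minus. ring. }
  eapply Rle_lt_trans; [apply Cmod_triangle|]. rewrite !Cmod_mult, !Cmod_R, !Rabs_right by lra.
  destruct (Req_dec x 0) as [->|]; nra.
Qed.

Lemma rderiv_segment (t h : C) (x : R) : rderiv (fun x : R => t + x * h)%C x h.
Proof.
  eapply rderiv_eq. apply rderiv_plus. apply rderiv_const. apply rderiv_mult. apply rderiv_id. apply rderiv_const.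
  cbv beta. ring.
Qed.

Lemma bounded_derivative_lipschitz rho H G M t h : (forall t, Cmod t < rho -> cderiv H t (G t)) ->
  (forall t, Cmod t < rho -> Cmod (G t)%C <= M) -> Cmod t < rho -> Cmod (t + h)%C < rho -> Cmod (H (t + h) - H t)%C <= M * Cmod h.
Proof.
  intros HD HM Ht Hth.
  assert (A := rderiv_mean_value (fun x : R => H (t + x * h)%C) (fun x : R => G (t + x * h) * h)%C 0 1 (M * Cmod h)).
  cbv beta in A. replace (t + 1%R * h)%C with (t + h)%C in A by ring. replace (t + 0%R * h)%C with t in A by ring.
  eapply Rle_trans; [apply A|]; try lra.
  - intros x Hx. apply (cderiv_rderiv H (fun x : R => t + x * h)%C). apply HD, segment_in_disc; auto. apply rderiv_segment.
  - intros x Hx. rewrite Cmod_mult. apply Rmult_le_compat_r; [apply Cmod_ge_0|]. apply HM, segment_in_disc; auto.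
Qed.

(** The mean value inequality along the segment, applied to [H] minus its linear part at [t]. *)
Lemma lipschitz_quad rho H G M : (forall t, Cmod t < rho -> cderiv H t (G t)) ->
  (forall t h, Cmod t < rho -> Cmod (t + h)%C < rho -> Cmod (G (t + h) - G t)%C <= M * Cmod h) -> quad rho H G M.
Proof.
  intros HD HL t h Ht Hth.
  assert (A := rderiv_mean_value (fun x : R => H (t + x * h) - x * (h * G t))%C (fun x : R => G (t + x * h) * h - h * G t)%C 0 1 (M * Cmod h ^ 2)).
  cbv beta in A. replace (t + 1%R * h)%C with (t + h)%C in A by ring. replace (t + 0%R * h)%C with t in A by ring.
  replace (H (t + h) - 1%R * (h * G t) - (H t - 0%R * (h * G t)))%C with (H (t + h) - H t - h * G t)%C in A by ring.
  eapply Rle_trans; [apply A|]; try lra.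
  - intros x Hx. apply rderiv_minus. apply (cderiv_rderiv H (fun x : R => t + x * h)%C). apply HD, segment_in_disc; auto. apply rderiv_segment.
    eapply rderiv_eq. apply rderiv_mult. apply rderiv_id. apply rderiv_const. cbv beta; ring.
  - intros x Hx. replace (G (t + x * h) * h - h * G t)%C with (h * (G (t + x * h) - G t))%C by ring.
    rewrite Cmod_mult. pose proof (Cmod_ge_0 h).
    assert (B : Cmod (G (t + x * h) - G t)%C <= M * Cmod h).
    { eapply Rle_trans; [apply HL; auto; apply segment_in_disc; auto|]. rewrite Cmod_mult, Cmod_R, Rabs_right by lra.
      destruct (Req_dec (Cmod h) 0) as [Z|Z]; [rewrite Z; lra|].
      assert (0 <= M). { pose proof (HL t h Ht Hth). pose proof (Cmod_ge_0 (G (t + h) - G t)%C).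
        apply Rnot_lt_le; intros Hn. assert (M * Cmod h < 0) by nra. lra. }
      assert (x * Cmod h <= Cmod h) by nra. apply Rmult_le_compat_l; auto. }
    simpl. nra.
Qed.

Lemma diff_under_integral (u : C -> R -> C) (v : R -> C) (J : C -> C) (I : C) a b K h :
  a <= b -> isI (u h) a b (J h) -> isI (u 0%C) a b (J 0%C) -> isI v a b I ->
  (forall x, a <= x <= b -> Cmod (u h x - u 0 x - h * v x)%C <= K * Cmod h ^ 2) ->
  Cmod (J h - J 0 - h * I)%C <= 2 * (b - a) * K * Cmod h ^ 2.
Proof.
  intros Hab H1 H2 H3 HB.
  replace (2 * (b - a) * K * Cmod h ^ 2) with (2 * (K * Cmod h ^ 2) * (b - a)) by ring.
  apply (isI_bound (fun x => u h x - u 0 x - h * v x)%C a b _ _ Hab HB).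
  apply isI_minus; [apply isI_minus; auto|apply isI_scal; auto].
Qed.

Lemma RtoC_neq (x : R) : x <> 0 -> RtoC x <> 0%C.
Proof. intros H Z. apply H. injection Z. auto. Qed.

Lemma Cmod_rE (r x : R) : 0 < r -> Cmod (r * E x)%C = r.
Proof. intros. rewrite Cmod_mult, Cmod_E, Cmod_R, Rabs_right by lra. ring. Qed.

Lemma rderiv_rE (r x : R) : rderiv (fun x => r * E x)%C x (Ci * (r * E x))%C.
Proof. eapply rderiv_eq. apply rderiv_mult. apply rderiv_const. apply rderiv_E. cbv beta; ring. Qed.

Lemma rcont_circle f p (r : R) : (forall x, ccont f (p + r * E x)%C) -> forall x, rcont (fun x => f (p + r * E x)%C) x.
Proof.
  intros H x. apply (ccont_rcont f (fun x => p + r * E x)%C); auto.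
  apply rcont_plus. apply rcont_const. apply rcont_mult. apply rcont_const. apply rcont_E.
Qed.

Lemma rcont_inv f x : rcont f x -> f x <> 0%C -> rcont (fun y => / f y)%C x.
Proof.
  intros [A B] Hn. assert (P : fst (f x) ^ 2 + snd (f x) ^ 2 <> 0).
  { intros Z. apply Hn. apply injective_projections; simpl; nra. }
  assert (Q : continuous (fun y => / (fst (f y) ^ 2 + snd (f y) ^ 2)) x).
  { apply continuous_comp with (g := Rinv).
    - apply (continuous_plus (V := R_NormedModule)); simpl.
      + apply (continuous_mult (K := R_AbsRing)); auto. apply (continuous_mult (K := R_AbsRing)); auto. apply continuous_const.
      + apply (continuous_mult (K := R_AbsRing)); auto. apply (continuous_mult (K := R_AbsRing)); auto. apply continuous_const.
    - apply continuous_Rinv. exact P. }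
  split.
  - exact (continuous_mult (K := R_AbsRing) (fun y => fst (f y)) _ x A Q).
  - exact (continuous_mult (K := R_AbsRing) (fun y => - snd (f y)) _ x (continuous_opp (V := R_NormedModule) _ _ B) Q).
Qed.

Lemma isI_cont_all f a b : (forall x, rcont f x) -> exists I, isI f a b I.
Proof. intros. apply isI_cont. auto. Qed.

Lemma two_PI_pos : 0 < 2 * PI.
Proof. pose proof PI_RGT_0. lra. Qed.

(** The circle is contracted to [w] by [w + l * (z - w)]. The derivative in [l] of the integral is
    the integral of [G (w + l * (z - w)) * z], a total derivative in the angle, hence 0; the values
    [l = 1] and [l = 0] are the two sides. The kernel integral [I0] is left unevaluated here. *)
Theorem circle_mean rho H G K (r : R) w I0 : quad rho H G K -> 0 < r < rho -> Cmod w < r ->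
  isI (fun x => (r * E x) / (r * E x - w))%C 0 (2 * PI) I0 ->
  isI (fun x => H (r * E x) * ((r * E x) / (r * E x - w)))%C 0 (2 * PI) (H w * I0)%C.
Proof.
  intros Q Hr Hw HI0. pose proof two_PI_pos as HPI.
  assert (Kp : 0 <= K).
  { assert (Z := Q 0%C (r : C)). rewrite Cplus_0_l, Cmod_0, Cmod_R, Rabs_right in Z by lra.
    specialize (Z ltac:(lra) ltac:(lra)). pose proof (Cmod_ge_0 (H r - H 0%R - r * G 0%R)%C).
    assert (0 <= K * r ^ 2) by lra. assert (0 < r ^ 2) by nra. apply Rnot_lt_le; intros N. nra. }
  assert (Nq : forall x, (r * E x - w)%C <> 0%C).
  { intros x Z. assert (Cmod (r * E x)%C = Cmod w). { f_equal. replace (r * E x)%C with ((r * E x - w) + w)%C by ring. rewrite Z; ring. }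
    rewrite Cmod_rE in H0; lra. }
  assert (Bq : forall x, Cmod (r * E x - w)%C <= 2 * r).
  { intros x. eapply Rle_trans; [apply Cmod_triangle_minus|]. rewrite Cmod_rE; lra. }
  (* Room for [l] slightly outside [0, 1], since the derivatives at the endpoints are two-sided; the
     modulus stays below [(1 + 2 * d0) * r], which is halfway between [r] and [rho]. *)
  set (d0 := (rho - r) / (4 * r)). assert (Hd0 : 0 < d0). { unfold d0. apply Rdiv_lt_0_compat; lra. }
  assert (Hd0' : d0 * (4 * r) = rho - r). { unfold d0. field. lra. }
  assert (In : forall (l : R) x, - d0 < l < 1 + d0 -> Cmod (w + l * (r * E x - w))%C < rho).
  { intros l x Hl. replace (w + l * (r * E x - w))%C with ((1 - l)%R * w + l * (r * E x))%C.
    2:{ rewrite RtoC_minus. ring. }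
    eapply Rle_lt_trans; [apply Cmod_triangle|]. rewrite (Cmod_mult l), (Cmod_mult (1 - l)%R), (Cmod_rE r x), !Cmod_R by lra.
    assert (Rabs l <= 1 + d0 /\ Rabs (1 - l) <= 1 + d0 /\ Rabs l + Rabs (1 - l) <= 1 + 2 * d0) as (? & ? & ?).
    { unfold Rabs. destruct (Rcase_abs l); destruct (Rcase_abs (1 - l)); repeat split; lra. }
    pose proof (Rabs_pos (1 - l)). pose proof (Rabs_pos l).
    apply Rle_lt_trans with ((Rabs (1 - l) + Rabs l) * r); [nra|]. apply Rle_lt_trans with ((1 + 2 * d0) * r); nra. }
  assert (Cq : forall x, rcont (fun x => r * E x - w)%C x).
  { intros. apply rcont_minus. apply rcont_mult. apply rcont_const. apply rcont_E. apply rcont_const. }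
  assert (Cz : forall x, rcont (fun x => r * E x)%C x).
  { intros. apply rcont_mult. apply rcont_const. apply rcont_E. }
  assert (Ch : forall (l : R) x, rcont (fun x => w + l * (r * E x - w))%C x).
  { intros. apply rcont_plus. apply rcont_const. apply rcont_mult. apply rcont_const. apply Cq. }
  set (u := fun (l : R) x => (H (w + l * (r * E x - w)) * ((r * E x) / (r * E x - w)))%C).
  assert (Iu : forall l, - d0 < l < 1 + d0 -> isI (u l) 0 (2 * PI) (cI (u l) 0 (2 * PI))).
  { intros l Hl. apply cI_correct, isI_cont_all. intros x. unfold u. apply rcont_mult.
    - apply (ccont_rcont H (fun x => w + l * (r * E x - w))%C); [|apply Ch].
      eapply cderiv_ccont, quad_cderiv; [exact Q|apply In; auto].
    - unfold Cdiv. apply rcont_mult; auto. apply rcont_inv; auto. }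
  (* For [l <> 0] the integrand is the angular derivative of [H (w + l * (z - w))] divided by
     [Ci * l]; for [l = 0] it is a constant times [z], with primitive [- Ci * z]. *)
  assert (Z : forall l : R, 0 <= l <= 1 -> isI (fun x => G (w + l * (r * E x - w)) * (r * E x))%C 0 (2 * PI) 0%C).
  { intros l Hl. destruct (Req_dec l 0) as [->|Nl].
    - apply (isI_ext (fun x => G w * (r * E x))%C); [lra| |].
      { intros. f_equal. f_equal. ring. }
      replace (RtoC 0) with (G w * 0)%C by ring. apply isI_scal.
      eapply isI_eq. apply (isI_derive (fun x => - Ci * (r * E x))%C).
      + intros. eapply rderiv_eq. apply rderiv_mult. apply rderiv_const. apply rderiv_rE. cbv beta.
        transitivity (- (Ci * Ci) * (r * E x))%C; [ring|]. rewrite Ci2. ring.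
      + intros. apply Cz.
      + cbv beta. rewrite E_period. ring.
    - assert (Nil : (Ci * l)%C <> 0%C). { apply Cmult_neq_0. intros A; injection A; lra. intros A; injection A; auto. }
      apply (isI_ext (fun x => / (Ci * l) * (G (w + l * (r * E x - w)) * (l * (Ci * (r * E x)))))%C); [lra| |].
      { intros. field. split. intros A; injection A; auto. intros A; injection A; lra. }
      replace (RtoC 0) with (/ (Ci * l) * 0)%C by ring. apply isI_scal.
      eapply isI_eq. apply (isI_derive (fun x => H (w + l * (r * E x - w)))%C).
      + intros x _. apply (cderiv_rderiv H (fun x => w + l * (r * E x - w))%C).
        eapply quad_cderiv; [exact Q|apply In; lra].
        eapply rderiv_eq. apply rderiv_plus. apply rderiv_const. apply rderiv_mult. apply rderiv_const.
        apply rderiv_minus. apply rderiv_rE. apply rderiv_const. cbv beta. ring.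
      + intros x _. apply rcont_mult.
        * apply (ccont_rcont G (fun x => w + l * (r * E x - w))%C); [|apply Ch].
          eapply quad_ccont; [exact Q|apply In; lra].
        * apply rcont_mult. apply rcont_const. apply rcont_mult. apply rcont_const. apply Cz.
      + cbv beta. rewrite E_period. ring. }
  assert (C1 : cI (u 1) 0 (2 * PI) = cI (u 0) 0 (2 * PI)).
  { apply (rderiv_zero_const (fun l => cI (u l) 0 (2 * PI))); [lra|]. intros l Hl.
    apply (quadratic_rderiv _ _ _ (2 * (2 * PI - 0) * (K * r * (2 * r))) d0 Hd0). intros h Hh.
    apply Rabs_def2 in Hh.
    assert (DI := diff_under_integral (fun h x => H (w + (l + h) * (r * E x - w)) * ((r * E x) / (r * E x - w)))%C
      (fun x => G (w + l * (r * E x - w)) * (r * E x))%C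
      (fun h => cI (fun x => H (w + (l + h) * (r * E x - w)) * ((r * E x) / (r * E x - w)))%C 0 (2 * PI)) 0%C 0 (2 * PI) (K * r * (2 * r)) h).
    cbv beta in DI. rewrite Cmod_R in DI.
    assert (E1 : (fun x => H (w + (l + h) * (r * E x - w)) * ((r * E x) / (r * E x - w)))%C = u (l + h)).
    { apply functional_extensionality. intros x. unfold u. rewrite RtoC_plus. auto. }
    assert (E2 : (fun x => H (w + (l + 0) * (r * E x - w)) * ((r * E x) / (r * E x - w)))%C = u l).
    { apply functional_extensionality. intros x. unfold u. rewrite Cplus_0_r. auto. }
    rewrite E1, E2 in DI. apply DI; [lra|apply Iu; lra|apply Iu; lra|apply Z; auto|].
    intros x _. unfold u.
    replace (H (w + (l + h) * (r * E x - w)) * (r * E x / (r * E x - w)) - H (w + (l + 0) * (r * E x - w)) * (r * E x / (r * E x - w)) -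
      h * (G (w + l * (r * E x - w)) * (r * E x)))%C with
      ((r * E x) / (r * E x - w) * (H ((w + l * (r * E x - w)) + h * (r * E x - w)) - H (w + l * (r * E x - w)) -
         (h * (r * E x - w)) * G (w + l * (r * E x - w))))%C.
    2:{ replace (w + (l + h) * (r * E x - w))%C with (w + l * (r * E x - w) + h * (r * E x - w))%C by ring. rewrite Cplus_0_r. field. apply Nq. }
    assert (Q' := Q (w + l * (r * E x - w))%C (h * (r * E x - w))%C (In l x ltac:(lra))).
    replace (w + l * (r * E x - w) + h * (r * E x - w))%C with (w + (l + h)%R * (r * E x - w))%C in * by (rewrite RtoC_plus; ring).
    specialize (Q' (In (l + h) x ltac:(lra))).
    rewrite Cmod_mult, Cmod_div, Cmod_rE by (auto; lra). rewrite Cmod_mult, Cmod_R in Q'.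
    assert (0 < Cmod (r * E x - w)%C) by (apply Cmod_gt_0; auto).
    set (qq := Cmod (r * E x - w)%C) in *. pose proof (Bq x) as Bqx. fold qq in Bqx.
    eapply Rle_trans; [apply Rmult_le_compat_l; [|exact Q']|].
    { left. apply Rdiv_lt_0_compat; lra. }
    replace (r / qq * (K * (Rabs h * qq) ^ 2)) with (K * r * qq * Rabs h ^ 2) by (field; lra).
    apply Rmult_le_compat_r; [apply pow2_ge_0|]. apply Rmult_le_compat_l; [nra|auto]. }
  assert (I1 := Iu 1 ltac:(lra)). rewrite C1 in I1.
  assert (EI : cI (u 0) 0 (2 * PI) = (H w * I0)%C).
  { eapply isI_unique; [apply Iu; lra|]. apply (isI_ext (fun x => H w * ((r * E x) / (r * E x - w)))%C); [lra| |apply isI_scal; auto].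
    intros x _. unfold u. f_equal. f_equal. ring. }
  rewrite EI in I1. revert I1. apply isI_ext; [lra|]. intros x _. unfold u. f_equal. f_equal. ring.
Qed.

Lemma mean_value_circle rho H G K (r : R) : quad rho H G K -> 0 < r < rho ->
  isI (fun x => H (r * E x))%C 0 (2 * PI) ((2 * PI)%R * H 0%C)%C.
Proof.
  intros Q Hr. assert (N : forall x, (r * E x)%C <> 0%C).
  { intros x. apply Cmod_gt_0. rewrite Cmod_rE; lra. }
  pose proof two_PI_pos.
  assert (A := circle_mean rho H G K r 0 ((2 * PI - 0)%R * 1) Q Hr).
  rewrite Cmod_0 in A. specialize (A ltac:(lra)).
  eapply isI_eq; [eapply isI_ext; [lra| |apply A]|].
  - intros x _. cbv beta. field. split; [apply E_neq_0|]. apply RtoC_neq. lra.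
  - eapply isI_ext; [lra| |apply isI_const]. intros x _. cbv beta. field. split; [apply E_neq_0|]. apply RtoC_neq. lra.
  - rewrite Rminus_0_r. ring.
Qed.

Lemma quad_translate rho f g K p s : quad rho f g K -> Cmod p + s <= rho ->
  quad s (fun t => f (p + t)%C) (fun t => g (p + t)%C) K.
Proof.
  intros Q Hp t h Ht Hth. rewrite Cplus_assoc. apply Q.
  - eapply Rle_lt_trans; [apply Cmod_triangle|]. lra.
  - rewrite <- Cplus_assoc. eapply Rle_lt_trans; [apply Cmod_triangle|]. lra.
Qed.

(** The angular derivative of [I * Cconj E] is [Ci * (r * H - I * Cconj E)] and integrates to 0, so
    the first coefficient of [I] is [r] times the mean of [H]. *)
Lemma cauchy_first_coefficient rho I H G K1 K2 (r : R) : quad rho I H K1 -> quad rho H G K2 -> 0 < r < rho ->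
  isI (fun x => I (r * E x) * Cconj (E x)%C)%C 0 (2 * PI) ((2 * PI * r)%R * H 0%C)%C.
Proof.
  intros QI QH Hr. pose proof two_PI_pos.
  assert (MV := mean_value_circle rho H G K2 r QH Hr).
  assert (In : forall x, Cmod (r * E x)%C < rho). { intros x. rewrite Cmod_rE; lra. }
  assert (CI : forall x, rcont (fun x => I (r * E x))%C x).
  { intros x. apply (ccont_rcont I (fun x => r * E x)%C). eapply cderiv_ccont, quad_cderiv; eauto.
    eapply rderiv_rcont, rderiv_rE. }
  assert (CH : forall x, rcont (fun x => H (r * E x))%C x).
  { intros x. apply (ccont_rcont H (fun x => r * E x)%C). eapply cderiv_ccont, quad_cderiv; eauto.
    eapply rderiv_rcont, rderiv_rE. }
  assert (DE : forall x, rderiv (fun x => Cconj (E x)%C) x (Cconj (Ci * E x)%C)).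
  { intros x. apply rderiv_conj, rderiv_E. }
  assert (Z : isI (fun x => Ci * (r * H (r * E x) - I (r * E x) * Cconj (E x)%C))%C 0 (2 * PI) 0%C).
  { eapply isI_eq. apply (isI_derive (fun x => I (r * E x) * Cconj (E x)%C)%C).
    - intros x _. eapply rderiv_eq. apply rderiv_mult. apply (cderiv_rderiv I (fun x => r * E x)%C).
      eapply quad_cderiv; eauto. apply rderiv_rE. apply DE. cbv beta.
      transitivity (Ci * (r * H (r * E x) * (E x * Cconj (E x)%C)) + I (r * E x) * Cconj (Ci * E x)%C)%C; [ring|].
      rewrite E_conj, Cmult_conj. replace (Cconj Ci) with (- Ci)%C by (apply injective_projections; simpl; ring). ring.
    - intros x _. apply rcont_mult. apply rcont_const. apply rcont_minus. apply rcont_mult. apply rcont_const. auto.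
      apply rcont_mult; auto. eapply rderiv_rcont; apply DE.
    - cbv beta. rewrite E_period. ring. }
  assert (Z2 := isI_scal Ci _ _ _ _ Z). assert (MV2 := isI_scal r _ _ _ _ MV).
  eapply isI_eq; [eapply isI_ext; [lra| |apply (isI_plus _ _ _ _ _ _ Z2 MV2)]|].
  - intros x _. cbv beta. transitivity ((Ci * Ci) * (r * H (r * E x) - I (r * E x) * Cconj (E x)%C) + r * H (r * E x))%C; [ring|].
    rewrite Ci2. ring.
  - rewrite (RtoC_mult (2 * PI) r). ring.
Qed.

(** Cauchy's formula for the pair [I], [H] is differentiated in the centre [p] and becomes the same
    formula for [H] and its derivative. The last conclusion matches the derivative obtained in this
    way with one already known. *)
Lemma cauchy_transform_derivative rho I H K (r s : R) G : quad rho I H K -> 0 < r -> s + r <= rho ->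
  (forall p, Cmod p < s -> isI (fun x => I (p + r * E x) * Cconj (E x)%C)%C 0 (2 * PI) ((2 * PI * r)%R * H p)%C) ->
  forall p, Cmod p < s -> exists l, isI (fun x => H (p + r * E x) * Cconj (E x)%C)%C 0 (2 * PI) ((2 * PI * r)%R * l)%C /\
    (forall h, Cmod (p + h)%C < s -> Cmod (H (p + h) - H p - h * l)%C <= 2 * K / r * Cmod h ^ 2) /\ (cderiv H p (G p) -> l = G p).
Proof.
  intros Q Hr Hs HI p Hp. pose proof two_PI_pos as HPI. pose proof PI_RGT_0.
  assert (In : forall p x, Cmod p < s -> Cmod (p + r * E x)%C < rho).
  { intros p' x Hp'. eapply Rle_lt_trans; [apply Cmod_triangle|]. rewrite Cmod_rE; lra. }
  destruct (isI_cont_all (fun x => H (p + r * E x) * Cconj (E x)%C)%C 0 (2 * PI)) as [L HL].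
  { intros x. apply rcont_mult. apply rcont_circle. intros. eapply quad_ccont; eauto.
    eapply rderiv_rcont, rderiv_conj, rderiv_E. }
  assert (N : RtoC (2 * PI * r) <> 0%C). { apply RtoC_neq. nra. }
  assert (B : forall h, Cmod (p + h)%C < s -> Cmod (H (p + h) - H p - h * (L / (2 * PI * r)%R))%C <= 2 * K / r * Cmod h ^ 2).
  { intros h Hh.
    assert (DI := diff_under_integral (fun h x => I ((p + h) + r * E x) * Cconj (E x)%C)%C
      (fun x => H (p + r * E x) * Cconj (E x)%C)%C (fun h => (2 * PI * r)%R * H (p + h))%C L 0 (2 * PI) K h).
    cbv beta in DI. specialize (DI ltac:(lra) (HI _ Hh)). rewrite Cplus_0_r in DI. specialize (DI (HI _ Hp) HL).
    apply Rmult_le_reg_l with (2 * PI * r); [nra|].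
    replace (2 * PI * r * Cmod (H (p + h) - H p - h * (L / (2 * PI * r)%R))%C)%R with
      (Cmod ((2 * PI * r)%R * H (p + h) - (2 * PI * r)%R * H p - h * L)%C)%C.
    2:{ rewrite <- (Rabs_right (2 * PI * r)) at 3 by nra. rewrite <- Cmod_R, <- Cmod_mult. f_equal. field. exact N. }
    eapply Rle_trans; [apply DI|].
    - intros x _. replace (I (p + h + r * E x) * Cconj (E x)%C - I (p + r * E x) * Cconj (E x)%C - h * (H (p + r * E x) * Cconj (E x)%C))%C
        with ((I ((p + r * E x) + h) - I (p + r * E x) - h * H (p + r * E x)) * Cconj (E x)%C)%C.
      2:{ replace (p + h + r * E x)%C with (p + r * E x + h)%C by ring. ring. }
      rewrite Cmod_mult, Cmod_conj, Cmod_E, Rmult_1_r. apply Q; auto.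
      replace (p + r * E x + h)%C with (p + h + r * E x)%C by ring. auto.
    - right. field. lra. }
  exists (L / (2 * PI * r)%R)%C. split; [|split].
  - eapply isI_eq; [exact HL|]. field. exact N.
  - exact B.
  - intros HG. eapply cderiv_unique; [|exact HG].
    apply (quadratic_cderiv H p _ (2 * K / r) (s - Cmod p)); [lra|]. intros h Hh. apply B.
    eapply Rle_lt_trans; [apply Cmod_triangle|]. lra.
Qed.

Lemma isI_circle_bound (u : R -> C) (r : R) M l : 0 < r -> (forall x, Cmod (u x)%C <= M) ->
  isI (fun x => u x * Cconj (E x)%C)%C 0 (2 * PI) ((2 * PI * r)%R * l)%C -> Cmod l <= 2 * M / r.
Proof.
  intros Hr HM HI. pose proof two_PI_pos as HPI. pose proof PI_RGT_0 as HPI2.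
  apply (isI_bound _ _ _ _ M) in HI; [|lra|].
  - rewrite Cmod_mult, Cmod_R, Rabs_right in HI by nra.
    apply Rmult_le_reg_l with (2 * PI * r); [nra|]. eapply Rle_trans; [exact HI|]. right. field. lra.
  - intros x _. rewrite Cmod_mult, Cmod_conj, Cmod_E, Rmult_1_r. auto.
Qed.

(** Since nothing is known about the continuity of [f'], Cauchy's formula is first applied to
    iterated primitives of [f] and then differentiated down to [f]. *)
Theorem cauchy_quad rho f f' M : 0 < rho -> (forall t, Cmod t < rho -> cderiv f t (f' t)) ->
  (forall t, Cmod t < rho -> Cmod (f t)%C <= M) ->
  quad (rho / 2) f f' (64 * M / rho ^ 2) /\
  (forall p, Cmod p < rho / 2 ->
     isI (fun x => f (p + (rho / 4)%R * E x) * Cconj (E x)%C)%C 0 (2 * PI) ((2 * PI * (rho / 4))%R * f' p)%C) /\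
  (forall p, Cmod p < rho / 2 -> Cmod (f' p)%C <= 8 * M / rho).
Proof.
  intros Hrho Hf HM. pose proof two_PI_pos as HPI. pose proof PI_RGT_0 as HPI2.
  set (r := rho / 4). assert (Hr : 0 < r) by (unfold r; lra).
  assert (HM0 : 0 <= M). { eapply Rle_trans; [apply Cmod_ge_0|apply (HM 0%C)]. rewrite Cmod_0; auto. }
  destruct (primitive_disc rho f) as [G HG]. { intros t Ht. eexists; apply Hf; auto. }
  destruct (primitive_disc rho G) as [H HH]. { intros t Ht. eexists; apply HG; auto. }
  destruct (primitive_disc rho H) as [I HI]. { intros t Ht. eexists; apply HH; auto. }
  assert (LG : forall t h, Cmod t < rho -> Cmod (t + h)%C < rho -> Cmod (G (t + h) - G t)%C <= M * Cmod h).
  { intros. eapply bounded_derivative_lipschitz; eauto. }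
  assert (QH : quad rho H G M). { eapply lipschitz_quad; eauto. }
  assert (BG : forall t, Cmod t < rho -> Cmod (G t)%C <= Cmod (G 0%C)%C + M * rho).
  { intros t Ht. assert (B := LG 0%C t). rewrite Cmod_0, Cplus_0_l in B. specialize (B Hrho Ht).
    replace (G t) with (G 0%C + (G t - G 0%C))%C by ring. eapply Rle_trans; [apply Cmod_triangle|]. nra. }
  assert (QI : quad rho I H (Cmod (G 0%C)%C + M * rho)).
  { eapply lipschitz_quad; eauto. intros. eapply bounded_derivative_lipschitz; eauto. }
  (* [D1] to [D4] express [H], [G], [f] and [f'] through the function one level above. A Lipschitz
     bound at one level gives, through the formula, a Lipschitz bound at the next, with a factor 8 /
     rho each time, hence 64 / rho^2 for [f']. *)
  assert (D1 : forall p, Cmod p < 3 * rho / 4 -> isI (fun x => I (p + r * E x) * Cconj (E x)%C)%C 0 (2 * PI) ((2 * PI * r)%R * H p)%C).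
  { intros p Hp.
    assert (QI' := quad_translate rho I H _ p (rho - Cmod p) QI ltac:(lra)).
    assert (QH' := quad_translate rho H G _ p (rho - Cmod p) QH ltac:(lra)).
    assert (A := cauchy_first_coefficient _ _ _ _ _ _ r QI' QH'). cbv beta in A. rewrite Cplus_0_r in A.
    apply A. unfold r. lra. }
  assert (D2 : forall p, Cmod p < 3 * rho / 4 -> isI (fun x => H (p + r * E x) * Cconj (E x)%C)%C 0 (2 * PI) ((2 * PI * r)%R * G p)%C).
  { intros p Hp. destruct (cauchy_transform_derivative rho I H _ r (3 * rho / 4) G QI Hr ltac:(unfold r; lra) D1 p Hp) as [l [L1 [L2 L3]]].
    rewrite <- L3; auto. apply HH. lra. }
  assert (D3 : forall p, Cmod p < 3 * rho / 4 -> isI (fun x => G (p + r * E x) * Cconj (E x)%C)%C 0 (2 * PI) ((2 * PI * r)%R * f p)%C).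
  { intros p Hp. destruct (cauchy_transform_derivative rho H G _ r (3 * rho / 4) f QH Hr ltac:(unfold r; lra) D2 p Hp) as [l [L1 [L2 L3]]].
    rewrite <- L3; auto. apply HG. lra. }
  assert (In : forall s p x, Cmod p < s -> Cmod (p + r * E x)%C < s + r).
  { intros s p x Hp. eapply Rle_lt_trans; [apply Cmod_triangle|]. rewrite Cmod_rE; lra. }
  assert (Lf : forall t h, Cmod t < 3 * rho / 4 -> Cmod (t + h)%C < 3 * rho / 4 -> Cmod (f (t + h) - f t)%C <= 8 * M / rho * Cmod h).
  { intros t h Ht Hth.
    assert (A := isI_minus _ _ _ _ _ _ (D3 _ Hth) (D3 _ Ht)).
    replace (8 * M / rho * Cmod h) with (2 * (M * Cmod h) / r) by (unfold r; field; lra).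
    apply (isI_circle_bound (fun x => G (t + h + r * E x) - G (t + r * E x))%C); auto.
    - intros x. replace (t + h + r * E x)%C with (t + r * E x + h)%C by ring. apply LG.
      + specialize (In _ _ x Ht). unfold r in *; lra.
      + specialize (In _ _ x Hth). replace (t + r * E x + h)%C with (t + h + r * E x)%C by ring. unfold r in *; lra.
    - eapply isI_eq; [eapply isI_ext; [lra| |apply A]|]; [intros; cbv beta; ring|ring]. }
  assert (QG : quad (3 * rho / 4) G f (8 * M / rho)).
  { eapply lipschitz_quad; eauto. intros; apply HG; lra. }
  assert (D4 : forall p, Cmod p < rho / 2 -> isI (fun x => f (p + r * E x) * Cconj (E x)%C)%C 0 (2 * PI) ((2 * PI * r)%R * f' p)%C).
  { intros p Hp. destruct (cauchy_transform_derivative (3 * rho / 4) G f _ r (rho / 2) f' QG Hr ltac:(unfold r; lra)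
      ltac:(intros; apply D3; lra) p Hp) as [l [L1 [L2 L3]]].
    rewrite <- L3; auto. apply Hf. lra. }
  assert (Lf' : forall t h, Cmod t < rho / 2 -> Cmod (t + h)%C < rho / 2 -> Cmod (f' (t + h) - f' t)%C <= 64 * M / rho ^ 2 * Cmod h).
  { intros t h Ht Hth.
    assert (A := isI_minus _ _ _ _ _ _ (D4 _ Hth) (D4 _ Ht)).
    replace (64 * M / rho ^ 2 * Cmod h) with (2 * (8 * M / rho * Cmod h) / r) by (unfold r; field; lra).
    apply (isI_circle_bound (fun x => f (t + h + r * E x) - f (t + r * E x))%C); auto.
    - intros x. replace (t + h + r * E x)%C with (t + r * E x + h)%C by ring. apply Lf.
      + specialize (In _ _ x Ht). unfold r in *; lra.
      + specialize (In _ _ x Hth). replace (t + r * E x + h)%C with (t + h + r * E x)%C by ring. unfold r in *; lra.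
    - eapply isI_eq; [eapply isI_ext; [lra| |apply A]|]; [intros; cbv beta; ring|ring]. }
  split; [|split].
  - eapply lipschitz_quad; eauto. intros; apply Hf; lra.
  - exact D4.
  - intros p Hp. replace (8 * M / rho) with (2 * M / r) by (unfold r; field; lra).
    eapply isI_circle_bound; [exact Hr| |apply D4; auto]. intros x. apply HM. specialize (In _ _ x Hp). unfold r in *; lra.
Qed.

Lemma derivative_differentiable_bounded rho f f' M : 0 < rho -> (forall t, Cmod t < rho -> cderiv f t (f' t)) ->
  (forall t, Cmod t < rho -> Cmod (f t)%C <= M) -> exists l, cderiv f' 0%C l.
Proof.
  intros Hrho Hf HM. destruct (cauchy_quad rho f f' M Hrho Hf HM) as (Q & D & _).
  assert (Z : Cmod 0 < rho / 4) by (rewrite Cmod_0; lra).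
  destruct (cauchy_transform_derivative (rho / 2) f f' _ (rho / 4) (rho / 4) f' Q ltac:(lra) ltac:(lra)
    ltac:(intros; apply D; lra) 0%C Z) as [l [_ [L _]]].
  exists l. apply (quadratic_cderiv f' 0%C l _ (rho / 4)) with (2 := fun h Hh => L h ltac:(rewrite Cplus_0_l; exact Hh)). lra.
Qed.

Theorem derivative_differentiable rho f f' : (forall t, Cmod t < rho -> cderiv f t (f' t)) -> Hol rho f'.
Proof.
  intros Hf p Hp. destruct (ccont_bounded_near f p (cderiv_ccont _ _ _ (Hf p Hp))) as [d [M [Hd [HM B]]]].
  set (s := Rmin d (rho - Cmod p)). assert (Hs : 0 < s) by (apply Rmin_pos; lra).
  destruct (derivative_differentiable_bounded s (fun t => f (p + t)%C) (fun t => f' (p + t)%C) M Hs) as [l Hl].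
  - intros t Ht. apply cderiv_translate. apply Hf. eapply Rle_lt_trans; [apply Cmod_triangle|].
    pose proof (Rmin_r d (rho - Cmod p)). fold s in H. lra.
  - intros t Ht. apply B. eapply Rlt_le_trans; [exact Ht|apply Rmin_l].
  - exists l. intros eps He. destruct (Hl eps He) as [e [He' K]]. exists e. split; auto.
    intros h Hh. specialize (K h Hh). rewrite Cplus_0_l, Cplus_0_r in K. exact K.
Qed.

(** * Cauchy estimates and the identity theorem on a disc *)

(** Boundedness on every smaller disc stands in for compactness of closed discs, and it survives
    differentiation. *)
Definition lbounded (rho : R) (f : C -> C) : Prop :=
  forall s, s < rho -> exists M, 0 <= M /\ forall t, Cmod t < s -> Cmod (f t)%C <= M.

(** Increments below [s / 2] are covered by [cauchy_quad] centred at [t]. For larger ones the bounds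
    on [f] and [f'] suffice, because [2 + 8 * x <= 64 * x ^ 2] for [x >= 1 / 2]. *)
Lemma bounded_quad rho s f f' M : 0 < s -> (forall t, Cmod t < rho -> cderiv f t (f' t)) ->
  (forall t, Cmod t < rho -> Cmod (f t)%C <= M) -> 0 <= M ->
  quad (rho - s) f f' (64 * M / s ^ 2) /\ (forall t, Cmod t < rho - s -> Cmod (f' t)%C <= 8 * M / s).
Proof.
  intros Hs Hf HM HM0.
  assert (L : forall t, Cmod t < rho - s -> Cmod (f' t)%C <= 8 * M / s /\
     forall h, Cmod h < s / 2 -> Cmod (f (t + h) - f t - h * f' t)%C <= 64 * M / s ^ 2 * Cmod h ^ 2).
  { intros t Ht.
    assert (In : forall h, Cmod h < s -> Cmod (t + h)%C < rho). { intros. eapply Rle_lt_trans; [apply Cmod_triangle|]. lra. }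
    destruct (cauchy_quad s (fun h => f (t + h)%C) (fun h => f' (t + h)%C) M Hs) as (Q & _ & B).
    - intros h Hh. apply cderiv_translate, Hf, In; auto.
    - intros h Hh. apply HM, In; auto.
    - assert (Z : Cmod 0 < s / 2) by (rewrite Cmod_0; lra). split.
      + specialize (B 0%C Z). rewrite Cplus_0_r in B. exact B.
      + intros h Hh. specialize (Q 0%C h Z). rewrite Cplus_0_l in Q. specialize (Q Hh). rewrite Cplus_0_r in Q. exact Q. }
  split; [|intros t Ht; apply L; auto].
  intros t h Ht Hth. destruct (L t Ht) as [B K]. destruct (Rlt_le_dec (Cmod h) (s / 2)) as [C|C]; [auto|].
  pose proof (Cmod_ge_0 h).
  assert (T : Cmod (f (t + h) - f t - h * f' t)%C <= M + M + Cmod h * (8 * M / s)).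
  { eapply Rle_trans; [apply Cmod_triangle_minus|]. rewrite Cmod_mult.
    apply Rplus_le_compat; [|apply Rmult_le_compat_l; auto].
    eapply Rle_trans; [apply Cmod_triangle_minus|]. apply Rplus_le_compat; apply HM; lra. }
  eapply Rle_trans; [exact T|].
  set (x := Cmod h / s). assert (Ex : Cmod h = x * s) by (unfold x; field; lra). rewrite Ex in *.
  assert (Hx : 1 / 2 <= x). { apply Rmult_le_reg_r with s; [lra|]. lra. }
  replace (M + M + x * s * (8 * M / s)) with (M * (2 + 8 * x)) by (field; lra).
  replace (64 * M / s ^ 2 * (x * s) ^ 2) with (M * (64 * x ^ 2)) by (field; lra).
  apply Rmult_le_compat_l; auto. nra.
Qed.

Lemma lbounded_derivative rho f f' : (forall t, Cmod t < rho -> cderiv f t (f' t)) -> lbounded rho f -> lbounded rho f'.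
Proof.
  intros Hf B s Hs. set (e := (rho - s) / 2). assert (He : 0 < e) by (unfold e; lra).
  destruct (B (s + e)) as [M [HM0 HM]]; [unfold e; lra|].
  destruct (bounded_quad (s + e) e f f' M He) as [_ K]; auto.
  { intros; apply Hf. unfold e in *; lra. }
  exists (8 * M / e). split. { apply Rmult_le_pos; [lra|]. left; apply Rinv_0_lt_compat; auto. }
  intros t Ht. apply K. lra.
Qed.

Lemma Cpow_S (z : C) n : (z ^ S n = z * z ^ n)%C.
Proof. reflexivity. Qed.

(** Integration by parts in the angle. *)
Lemma coefficient_derivative rho f f' K (r : R) k J : quad rho f f' K -> 0 < r < rho ->
  isI (fun x => f' (r * E x) * (/ (r * E x)) ^ k)%C 0 (2 * PI) J ->
  isI (fun x => f (r * E x) * (/ (r * E x)) ^ S k)%C 0 (2 * PI) (J / INR (S k))%C.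
Proof.
  intros Q Hr HJ. pose proof two_PI_pos.
  assert (N : forall x, (r * E x)%C <> 0%C). { intros x. apply Cmod_gt_0. rewrite Cmod_rE; lra. }
  assert (Nk : RtoC (INR (S k)) <> 0%C). { apply RtoC_neq. apply not_0_INR. lia. }
  assert (In : forall x, Cmod (r * E x)%C < rho). { intros x. rewrite Cmod_rE; lra. }
  assert (Cz : forall x, rcont (fun x => r * E x)%C x). { intros. eapply rderiv_rcont, rderiv_rE. }
  assert (DI : forall x, rderiv (fun x => / (r * E x))%C x (- Ci * / (r * E x))%C).
  { intros x. eapply rderiv_eq. apply (rderiv_inv (fun x => r * E x)%C). apply rderiv_rE. apply N. field.
    split; [apply E_neq_0|]. apply RtoC_neq; lra. }
  assert (DP : forall j x, rderiv (fun x => (/ (r * E x)) ^ j)%C x (- Ci * INR j * (/ (r * E x)) ^ j)%C).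
  { induction j as [|j IH]; intros x.
    - simpl. eapply rderiv_eq. apply rderiv_const. ring.
    - eapply rderiv_eq. eapply rderiv_ext; [|apply rderiv_mult; [apply DI|apply IH]]. intros; apply Cpow_S.
      cbv beta. rewrite S_INR, Cpow_S, RtoC_plus. ring. }
  assert (Z : isI (fun x => Ci * (f' (r * E x) * (/ (r * E x)) ^ k - INR (S k) * (f (r * E x) * (/ (r * E x)) ^ S k)))%C 0 (2 * PI) 0%C).
  { eapply isI_eq. apply (isI_derive (fun x => f (r * E x) * (/ (r * E x)) ^ S k)%C).
    - intros x _. eapply rderiv_eq. apply rderiv_mult. apply (cderiv_rderiv f (fun x => r * E x)%C).
      eapply quad_cderiv; eauto. apply rderiv_rE. apply DP. cbv beta. rewrite Cpow_S. field. split; [apply E_neq_0|]. apply RtoC_neq; lra.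
    - intros x _. apply rcont_mult. apply rcont_const. apply rcont_minus.
      + apply rcont_mult. apply (ccont_rcont f' (fun x => r * E x)%C); auto. eapply quad_ccont; eauto.
        eapply rderiv_rcont, DP.
      + apply rcont_mult. apply rcont_const. apply rcont_mult.
        apply (ccont_rcont f (fun x => r * E x)%C); auto. eapply cderiv_ccont, quad_cderiv; eauto.
        eapply rderiv_rcont, DP.
    - cbv beta. rewrite E_period. ring. }
  assert (Z2 := isI_scal (Ci / INR (S k)) _ _ _ _ Z). assert (HJ2 := isI_scal (/ INR (S k)) _ _ _ _ HJ).
  eapply isI_eq; [eapply isI_ext; [lra| |apply (isI_plus _ _ _ _ _ _ Z2 HJ2)]|].
  - intros x _. cbv beta.
    set (A := (f' (r * E x) * (/ (r * E x)) ^ k)%C). set (B := (f (r * E x) * (/ (r * E x)) ^ S k)%C).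
    transitivity ((Ci * Ci) * (A - INR (S k) * B) / INR (S k) + / INR (S k) * A)%C; [field; auto|].
    rewrite Ci2. field. auto.
  - field. auto.
Qed.

Lemma geometric_remainder (z w : C) N : z <> 0%C -> (z - w)%C <> 0%C ->
  (z / (z - w) = sum_n (fun k => (w ^ k * (/ z) ^ k)%C) N + (w / z) ^ S N * (z / (z - w)))%C.
Proof.
  intros Hz Hw. induction N as [|N IH].
  - rewrite sum_O. simpl. field. auto.
  - rewrite sum_Sn. rewrite IH at 1. unfold plus; simpl.
    replace (w * w ^ N * (/ z * (/ z) ^ N))%C with ((w / z) * (w / z) ^ N)%C.
    2:{ unfold Cdiv. rewrite Cpow_mult_l. ring. }
    field. auto.
Qed.

(** In the geometric expansion of the kernel only the constant term has a nonzero integral, and the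
    remainder decays like [(Cmod w / r) ^ n]. *)
Lemma cauchy_kernel_integral (u : R -> C) (r : R) w b S M : 0 < r -> Cmod w < r -> 0 <= M ->
  (forall x, Cmod (u x)%C <= M) -> isI u 0 (2 * PI) b ->
  (forall k, isI (fun x => u x * (/ (r * E x)) ^ Datatypes.S k)%C 0 (2 * PI) 0%C) ->
  isI (fun x => u x * ((r * E x) / (r * E x - w)))%C 0 (2 * PI) S -> S = b.
Proof.
  intros Hr Hw HM0 HM Hb Hk HS. pose proof two_PI_pos as HPI.
  assert (N : forall x, (r * E x)%C <> 0%C). { intros x. apply Cmod_gt_0. rewrite Cmod_rE; lra. }
  assert (Nq : forall x, r - Cmod w <= Cmod (r * E x - w)%C).
  { intros x. rewrite <- (Cmod_rE r x) at 1 by auto. apply Cmod_reverse. }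
  assert (Nq' : forall x, (r * E x - w)%C <> 0%C). { intros x. apply Cmod_gt_0. specialize (Nq x). lra. }
  assert (P : forall n, isI (fun x => u x * sum_n (fun k => (w ^ k * (/ (r * E x)) ^ k)%C) n)%C 0 (2 * PI) b).
  { induction n as [|n IH].
    - eapply isI_ext; [lra| |exact Hb]. intros x _. rewrite sum_O. simpl. ring.
    - eapply isI_eq; [eapply isI_ext; [lra| |apply (isI_plus _ _ _ _ _ _ IH (isI_scal (w ^ Datatypes.S n) _ _ _ _ (Hk n)))]|].
      + intros x _. cbv beta. rewrite sum_Sn. unfold plus; cbn -[Cpow]. ring.
      + ring. }
  pose proof (Cmod_ge_0 w) as Pw. set (q := Cmod w / r).
  assert (Hq : 0 <= q < 1). { unfold q. split. apply Rdiv_le_0_compat; lra. apply Rmult_lt_reg_r with r; auto. unfold Rdiv. rewrite Rmult_assoc, Rinv_l; lra. }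
  assert (B : forall n, Cmod (S - b)%C <= 2 * (M * (q ^ Datatypes.S n * (r / (r - Cmod w)))) * (2 * PI - 0)).
  { intros n. apply (isI_bound (fun x => u x * ((w / (r * E x)) ^ Datatypes.S n * ((r * E x) / (r * E x - w))))%C 0 (2 * PI)); [lra| |].
    - intros x _. rewrite !Cmod_mult. apply Rmult_le_compat; auto using Cmod_ge_0.
      { apply Rmult_le_pos; apply Cmod_ge_0. }
      rewrite Cmod_pow, !Cmod_div, Cmod_rE by auto. apply Rmult_le_compat_l; [apply pow_le; lra|].
      specialize (Nq x). apply Rmult_le_compat_l; [lra|]. apply Rinv_le_contravar; lra.
    - eapply isI_ext; [lra| |apply (isI_minus _ _ _ _ _ _ HS (P n))]. intros x _. cbv beta.
      rewrite (geometric_remainder (r * E x) w n) at 1 by auto. ring. }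
  assert (Z : (S - b)%C = 0%C).
  { apply Cmod_eq_0_le. intros e He.
    set (c := 2 * M * (r / (r - Cmod w)) * (2 * PI)).
    assert (Hc : 0 <= c). { unfold c. apply Rmult_le_pos; [|lra]. apply Rmult_le_pos; [lra|]. apply Rdiv_le_0_compat; lra. }
    destruct (pow_lt_1_zero q) with (y := e / (c + 1)) as [m Hm].
    { rewrite Rabs_right; lra. } { apply Rdiv_lt_0_compat; lra. }
    specialize (Hm (Datatypes.S m) ltac:(lia)). rewrite Rabs_right in Hm by (apply Rle_ge, pow_le; lra).
    eapply Rle_trans; [apply (B m)|].
    replace (2 * (M * (q ^ Datatypes.S m * (r / (r - Cmod w)))) * (2 * PI - 0)) with (c * q ^ Datatypes.S m) by (unfold c; ring).
    apply Rle_trans with (c * (e / (c + 1))); [apply Rmult_le_compat_l; lra|].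
    apply Rmult_le_reg_r with (c + 1); [lra|]. replace (c * (e / (c + 1)) * (c + 1)) with (c * e) by (field; lra). nra. }
  replace S with ((S - b) + b)%C by ring. rewrite Z. ring.
Qed.

Lemma quad_const rho c : quad rho (fun _ => c) (fun _ => 0%C) 0.
Proof.
  intros t h _ _. cbv beta. replace (c - c - h * 0)%C with (RtoC 0) by ring. rewrite Cmod_0. lra.
Qed.

(** By [k] integrations by parts, the moment of [D j] against z^(-k) is a multiple of the mean of
    [D (j + k)], that is, of its value at 0. All moments vanish, hence so does the Cauchy integral
    at [w]. The derivatives are given as a tower because that is how they arise in the polarization
    argument. *)
Theorem holomorphic_identity rho (D : nat -> C -> C) :
  (forall k t, Cmod t < rho -> cderiv (D k) t (D (S k) t)) -> lbounded rho (D 0%nat) ->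
  (forall k, D k 0%C = 0%C) -> forall t, Cmod t < rho -> D 0%nat t = 0%C.
Proof.
  intros HD HB H0 w Hw. pose proof two_PI_pos as HPI.
  set (r := (Cmod w + rho) / 2). set (rho1 := (r + rho) / 2). pose proof (Cmod_ge_0 w).
  assert (Hr : 0 < r < rho1) by (unfold rho1, r; lra). assert (H1 : rho1 < rho) by (unfold rho1, r; lra).
  assert (Hwr : Cmod w < r) by (unfold r; lra).
  assert (HBk : forall k, lbounded rho (D k)).
  { induction k; auto. eapply lbounded_derivative; eauto. }
  assert (HQ : forall k, exists K, quad rho1 (D k) (D (S k)) K).
  { intros k. set (e := (rho - rho1) / 2). destruct (HBk k (rho1 + e)) as [M [HM0 HM]]; [unfold e; lra|].
    exists (64 * M / e ^ 2). replace rho1 with (rho1 + e - e) by ring.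
    eapply (bounded_quad (rho1 + e) e); eauto; [unfold e; lra|]. intros; apply HD. unfold e in *; lra. }
  assert (A : forall k j, isI (fun x => D j (r * E x) * (/ (r * E x)) ^ k)%C 0 (2 * PI) 0%C).
  { induction k as [|k IH]; intros j.
    - destruct (HQ j) as [K Q]. destruct (HQ (S j)) as [K' Q'].
      eapply isI_eq; [eapply isI_ext; [lra| |eapply mean_value_circle; [exact Q|exact Hr]]|].
      + intros x _. simpl. ring.
      + rewrite H0. ring.
    - destruct (HQ j) as [K Q]. eapply isI_eq. eapply coefficient_derivative; eauto.
      field. apply RtoC_neq. apply not_0_INR; lia. }
  destruct (HQ 0%nat) as [K Q].
  destruct (isI_cont_all (fun x => (r * E x) / (r * E x - w))%C 0 (2 * PI)) as [I0 HI0].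
  { intros x. unfold Cdiv. apply rcont_mult. eapply rderiv_rcont, rderiv_rE. apply rcont_inv.
    apply rcont_minus. eapply rderiv_rcont, rderiv_rE. apply rcont_const.
    apply Cmod_gt_0. apply Rlt_le_trans with (r - Cmod w); [lra|]. rewrite <- (Cmod_rE r x) at 1 by lra. apply Cmod_reverse. }
  (* The kernel integral is evaluated by the same expansion, applied to the constant function 1. *)
  assert (EI0 : I0 = RtoC (2 * PI)).
  { apply (cauchy_kernel_integral (fun _ => 1%C) r w _ _ 1); try lra.
    - intros. rewrite Cmod_1; lra.
    - eapply isI_eq; [apply isI_const|]. rewrite Rminus_0_r. ring.
    - intros k. eapply isI_eq. apply (coefficient_derivative rho1 (fun _ => 1%C) (fun _ => 0%C) 0 r k 0%C); auto using quad_const.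
      + eapply isI_eq; [eapply isI_ext; [lra| |apply (isI_const 0%C)]|]; [intros; cbv beta; ring|ring].
      + field. apply RtoC_neq. apply not_0_INR; lia.
    - eapply isI_ext; [lra| |exact HI0]. intros; cbv beta. ring. }
  assert (CM := circle_mean rho1 (D 0%nat) (D 1%nat) K r w I0 Q Hr Hwr HI0).
  destruct (HB rho1 H1) as [M [HM0 HM]].
  assert (Z : (D 0%nat w * I0)%C = 0%C).
  { eapply (cauchy_kernel_integral (fun x => D 0%nat (r * E x))%C r w _ _ M); try exact CM; try lra.
    - intros x. apply HM. rewrite Cmod_rE; lra.
    - eapply isI_ext; [lra| |apply (A 0%nat 0%nat)]. intros x _. simpl. ring.
    - intros k. apply A. }
  rewrite EI0 in Z. replace (D 0%nat w) with ((D 0%nat w * (2 * PI)%R) / (2 * PI)%R)%C.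
  - rewrite Z. field. apply RtoC_neq; lra.
  - field. apply RtoC_neq; lra.
Qed.

(** * Polarization *)

Definition HolB (rho : R) (f : C -> C) : Prop := Hol rho f /\ lbounded rho f.

Lemma HolB_bounded rho f M : Hol rho f -> 0 <= M -> (forall t, Cmod t < rho -> Cmod (f t)%C <= M) -> HolB rho f.
Proof. intros H HM0 HM. split; auto. intros s Hs. exists M. split; auto. intros t Ht. apply HM. lra. Qed.

Lemma HolB_derivative rho f : HolB rho f -> exists f', HolB rho f' /\ forall t, Cmod t < rho -> cderiv f t (f' t).
Proof.
  intros [Hf Hb]. set (f' := fun t => epsilon (inhabits (RtoC 0)) (fun l => cderiv f t l)).
  assert (D : forall t, Cmod t < rho -> cderiv f t (f' t)). { intros t Ht. apply epsilon_spec, Hf, Ht. }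
  exists f'. repeat split; auto. eapply derivative_differentiable; eauto. eapply lbounded_derivative; eauto.
Qed.

Lemma HolB_mult rho f g : HolB rho f -> HolB rho g -> HolB rho (fun t => f t * g t)%C.
Proof.
  intros [Hf Bf] [Hg Bg]. split.
  - intros t Ht. destruct (Hf t Ht) as [l Hl]. destruct (Hg t Ht) as [m Hm]. eexists. apply cderiv_mult; eauto.
  - intros s Hs. destruct (Bf s Hs) as [M [HM0 HM]]. destruct (Bg s Hs) as [N [HN0 HN]]. exists (M * N).
    split; [nra|]. intros t Ht. rewrite Cmod_mult. apply Rmult_le_compat; auto using Cmod_ge_0.
Qed.

Lemma HolB_const rho c : HolB rho (fun _ => c).
Proof.
  apply (HolB_bounded _ _ (Cmod c)); auto using Cmod_ge_0; [|intros; lra].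
  intros t _. eexists. apply cderiv_const.
Qed.

(** The algebra generated by holomorphic functions of [t] and antiholomorphic functions of [s], as
    finite sums. Being closed under products and under both derivations, it contains every
    polynomial expression in the kernel and its derivatives. *)
Inductive sesq (rho : R) : (C -> C -> C) -> Prop :=
| sesq_prod f g : HolB rho f -> HolB rho g -> sesq rho (fun t s => f t * Cconj (g s)%C)%C
| sesq_plus S T : sesq rho S -> sesq rho T -> sesq rho (fun t s => S t s + T t s)%C
| sesq_ext S T : (forall t s, S t s = T t s) -> sesq rho S -> sesq rho T.

Lemma sesq_mult rho S T : sesq rho S -> sesq rho T -> sesq rho (fun t s => S t s * T t s)%C.
Proof.
  intros HS HT. induction HS as [f g Hf Hg|S1 S2 H1 IH1 H2 IH2|S1 S2 HE H1 IH1].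
  - induction HT as [f' g' Hf' Hg'|T1 T2 H1 IH1 H2 IH2|T1 T2 HE H1 IH1].
    + eapply sesq_ext; [|apply (sesq_prod rho (fun t => f t * f' t)%C (fun t => g t * g' t)%C); apply HolB_mult; auto].
      intros; cbv beta. rewrite Cmult_conj. ring.
    + eapply sesq_ext; [|apply (sesq_plus _ _ _ IH1 IH2)]. intros; cbv beta; ring.
    + eapply sesq_ext; [|exact IH1]. intros; cbv beta. rewrite HE. auto.
  - eapply sesq_ext; [|apply (sesq_plus _ _ _ IH1 IH2)]. intros; cbv beta; ring.
  - eapply sesq_ext; [|exact IH1]. intros; cbv beta. rewrite HE. auto.
Qed.

Lemma sesq_const rho c : sesq rho (fun _ _ => c).
Proof.
  eapply sesq_ext; [|apply (sesq_prod rho (fun _ => c) (fun _ => 1%C)); apply HolB_const].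
  intros; cbv beta. replace (Cconj 1) with (RtoC 1) by (apply injective_projections; simpl; ring). ring.
Qed.

Lemma sesq_minus rho S T : sesq rho S -> sesq rho T -> sesq rho (fun t s => S t s - T t s)%C.
Proof.
  intros HS HT. eapply sesq_ext; [|apply (sesq_plus _ _ _ HS (sesq_mult _ _ _ (sesq_const rho (-(1))%C) HT))].
  intros; cbv beta; ring.
Qed.

Lemma rderiv_line (t v : C) : rderiv (fun x : R => t + x * v)%C 0 v.
Proof. apply rderiv_segment. Qed.

(** [S1] is the derivative in [t] and [S2] the derivative in the conjugate of [s]; restricted to the
    diagonal, they are the two Wirtinger derivatives of [S t t]. *)
Lemma sesq_derivatives rho S : sesq rho S -> exists S1 S2, sesq rho S1 /\ sesq rho S2 /\
  (forall t s, Cmod t < rho -> Cmod s < rho -> cderiv (fun t => S t s) t (S1 t s)) /\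
  (forall t s, Cmod t < rho -> Cmod s < rho -> cderiv (fun s => Cconj (S t s)%C) s (Cconj (S2 t s)%C)) /\
  (forall t v, Cmod t < rho -> rderiv (fun x : R => S (t + x * v) (t + x * v))%C 0 (S1 t t * v + S2 t t * Cconj v)%C).
Proof.
  induction 1 as [f g Hf Hg|S T HS IHS HT IHT|S T HE HS IHS].
  - destruct (HolB_derivative rho f Hf) as [f' [Hf' Df]]. destruct (HolB_derivative rho g Hg) as [g' [Hg' Dg]].
    exists (fun t s => f' t * Cconj (g s)%C)%C, (fun t s => f t * Cconj (g' s)%C)%C.
    split; [constructor; auto|]. split; [constructor; auto|]. split; [|split].
    + intros t s Ht Hs. eapply cderiv_eq. apply cderiv_mult. apply Df; auto. apply cderiv_const. cbv beta; ring.
    + intros t s Ht Hs. eapply (cderiv_ext (fun s => Cconj (f t)%C * g s)%C).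
      { intros; rewrite Cmult_conj, Cconj_conj; auto. }
      rewrite Cmult_conj, Cconj_conj. apply cderiv_scal. auto.
    + intros t v Ht. eapply rderiv_eq. apply rderiv_mult.
      * apply (cderiv_rderiv f (fun x : R => t + x * v)%C). replace (t + 0%R * v)%C with t by ring. apply Df; auto. apply rderiv_line.
      * apply rderiv_conj. apply (cderiv_rderiv g (fun x : R => t + x * v)%C).
        replace (t + 0%R * v)%C with t by ring. apply Dg; auto. apply rderiv_line.
      * cbv beta. replace (t + 0%R * v)%C with t by ring. rewrite Cmult_conj. ring.
  - destruct IHS as (S1 & S2 & A1 & A2 & A3 & A4 & A5). destruct IHT as (T1 & T2 & B1 & B2 & B3 & B4 & B5).
    exists (fun t s => S1 t s + T1 t s)%C, (fun t s => S2 t s + T2 t s)%C.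
    split; [apply sesq_plus; auto|]. split; [apply sesq_plus; auto|]. split; [|split].
    + intros. apply cderiv_plus; auto.
    + intros t s Ht Hs. rewrite Cplus_conj. eapply (cderiv_ext (fun s => Cconj (S t s)%C + Cconj (T t s)%C)%C).
      { intros; rewrite Cplus_conj; auto. } apply cderiv_plus; auto.
    + intros t v Ht. eapply rderiv_eq. apply rderiv_plus; [apply A5|apply B5]; auto. ring.
  - destruct IHS as (S1 & S2 & A1 & A2 & A3 & A4 & A5). exists S1, S2.
    assert (ET : S = T). { apply functional_extensionality; intros; apply functional_extensionality; intros; auto. }
    subst T. auto 10.
Qed.

Lemma sesq_lbounded_l rho S s : sesq rho S -> lbounded rho (fun t => S t s).
Proof.
  induction 1 as [f g Hf Hg|S T HS IHS HT IHT|S T HE HS IHS].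
  - apply (HolB_mult rho f (fun _ => Cconj (g s)%C)); auto. apply HolB_const.
  - intros r Hr. destruct (IHS r Hr) as [M [HM0 HM]]. destruct (IHT r Hr) as [N [HN0 HN]]. exists (M + N).
    split; [lra|]. intros t Ht. eapply Rle_trans; [apply Cmod_triangle|]. specialize (HM t Ht). specialize (HN t Ht). lra.
  - intros r Hr. destruct (IHS r Hr) as [M [HM0 HM]]. exists M. split; auto. intros. rewrite <- HE. auto.
Qed.

Lemma sesq_swap rho S : sesq rho S -> sesq rho (fun t s => Cconj (S s t)%C).
Proof.
  induction 1 as [f g Hf Hg|S T HS IHS HT IHT|S T HE HS IHS].
  - eapply sesq_ext; [|apply (sesq_prod rho g f); auto]. intros; cbv beta. rewrite Cmult_conj, Cconj_conj. ring.
  - eapply sesq_ext; [|apply (sesq_plus _ _ _ IHS IHT)]. intros; cbv beta. rewrite Cplus_conj; auto.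
  - eapply sesq_ext; [|exact IHS]. intros; cbv beta. rewrite HE; auto.
Qed.

(** The derivative of the diagonal function vanishes in the directions 1 and i, and these two
    equations separate [S1] from [S2]. So the vanishing on the diagonal is inherited by the
    derivative in [t]. *)
Lemma sesq_diagonal_derivatives rho S : sesq rho S -> (forall t, Cmod t < rho -> S t t = 0%C) ->
  exists S1, sesq rho S1 /\ (forall t, Cmod t < rho -> S1 t t = 0%C) /\
  (forall t s, Cmod t < rho -> Cmod s < rho -> cderiv (fun t => S t s) t (S1 t s)).
Proof.
  intros HS HD. destruct (sesq_derivatives rho S HS) as (S1 & S2 & A1 & A2 & A3 & A4 & A5).
  exists S1. split; auto. split; auto. intros t Ht.
  assert (Z : forall v, (S1 t t * v + S2 t t * Cconj v)%C = 0%C).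
  { intros v. eapply rderiv_unique; [apply A5; auto|].
    set (d := (rho - Cmod t) / (Cmod v + 1)). pose proof (Cmod_ge_0 v).
    assert (Hd : 0 < d) by (apply Rdiv_lt_0_compat; lra).
    apply (rderiv_ext_loc (fun _ => 0%C) _ 0 _ d Hd); [|apply rderiv_const].
    intros y Hy. rewrite Rminus_0_r in Hy. symmetry. apply HD. eapply Rle_lt_trans; [apply Cmod_triangle|].
    rewrite Cmod_mult, Cmod_R. pose proof (Rabs_pos y).
    assert (Rabs y * (Cmod v + 1) < rho - Cmod t).
    { replace (rho - Cmod t) with (d * (Cmod v + 1)) by (unfold d; field; lra). apply Rmult_lt_compat_r; lra. }
    lra. }
  assert (Z1 := Z 1%C). assert (Z2 := Z Ci).
  replace (Cconj 1) with (RtoC 1) in Z1 by (apply injective_projections; simpl; ring).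
  replace (Cconj Ci) with (- Ci)%C in Z2 by (apply injective_projections; simpl; ring).
  transitivity (((S1 t t * 1 + S2 t t * 1) - Ci * (S1 t t * Ci + S2 t t * - Ci)) / 2)%C.
  - transitivity (((S1 t t + S2 t t) - (Ci * Ci) * (S1 t t - S2 t t)) / 2)%C; [|field]. rewrite Ci2. field.
  - rewrite Z1, Z2. field.
Qed.

Lemma sesq_derivative_tower rho S : sesq rho S -> (forall t, Cmod t < rho -> S t t = 0%C) ->
  exists D : nat -> C -> C -> C, D 0%nat = S /\
    (forall k, sesq rho (D k) /\ forall t, Cmod t < rho -> D k t t = 0%C) /\
    forall k t s, Cmod t < rho -> Cmod s < rho -> cderiv (fun t => D k t s) t (D (Datatypes.S k) t s).
Proof.
  intros HS HD.
  set (P := fun S => sesq rho S /\ (forall t, Cmod t < rho -> S t t = 0%C)).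
  set (N := fun T T1 : C -> C -> C => P T1 /\
     (forall t s, Cmod t < rho -> Cmod s < rho -> cderiv (fun t => T t s) t (T1 t s))).
  assert (St : forall T, P T -> exists T1, N T T1).
  { intros T [A B]. destruct (sesq_diagonal_derivatives rho T A B) as (T1 & A1 & A2 & A3). exists T1. split; [split|]; auto. }
  set (D := fix D (k : nat) := match k with O => S | Datatypes.S k' => epsilon (inhabits S) (N (D k')) end).
  assert (PD : forall k, P (D k)).
  { induction k; simpl. split; auto. apply (epsilon_spec (inhabits S) _ (St (D k) IHk)). }
  exists D. split; [auto|]. split; [exact PD|].
  intros k. apply (epsilon_spec (inhabits S) _ (St (D k) (PD k))).
Qed.

Lemma sesq_diagonal_zero_l rho S : 0 < rho -> sesq rho S -> (forall t, Cmod t < rho -> S t t = 0%C) ->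
  forall t, Cmod t < rho -> S t 0%C = 0%C.
Proof.
  intros Hrho HS HD t Ht. destruct (sesq_derivative_tower rho S HS HD) as (D & D0 & PD & DD).
  assert (Z0 : Cmod 0 < rho) by (rewrite Cmod_0; auto).
  rewrite <- D0. apply (holomorphic_identity rho (fun k t => D k t 0%C)); auto.
  - rewrite D0. apply sesq_lbounded_l. exact HS.
  - intros k. apply PD. exact Z0.
Qed.

(** All derivatives in [t] vanish on the diagonal, so the identity theorem gives [S t 0 = 0].
    Applied with the variables exchanged to every derivative in [s], this shows that for fixed [t]
    all these derivatives vanish at [s = 0], and the identity theorem is used once more. *)
Theorem polarization rho S : 0 < rho -> sesq rho S -> (forall t, Cmod t < rho -> S t t = 0%C) ->
  forall t s, Cmod t < rho -> Cmod s < rho -> S t s = 0%C.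
Proof.
  intros Hrho HS HD t s Ht Hs.
  assert (C0 : Cconj 0 = 0%C) by (apply injective_projections; simpl; ring).
  destruct (sesq_derivative_tower rho (fun t s => Cconj (S s t)) (sesq_swap rho S HS)) as (D & D0 & PD & DD).
  { intros u Hu. rewrite HD; auto. }
  assert (Q : D 0%nat s t = 0%C).
  { apply (holomorphic_identity rho (fun k s => D k s t)); auto.
    - rewrite D0. apply (sesq_lbounded_l rho (fun s t => Cconj (S t s)) t), sesq_swap, HS.
    - intros k. destruct (PD k) as [A B].
      rewrite <- (Cconj_conj (D k 0%C t)), (sesq_diagonal_zero_l rho _ Hrho (sesq_swap _ _ A)); auto.
      intros u Hu. rewrite B; auto. }
  rewrite D0 in Q. rewrite <- (Cconj_conj (S t s)), Q. exact C0.
Qed.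

(** * Bounded holomorphic functions on the ball *)

Ltac cring :=
  cbv beta; first [ring | lazymatch goal with |- @eq _ ?a ?b => change (@eq Complex.C a b) end; first [ring | symmetry; ring]].

Lemma Cnorm_Cmod (z : C) : Cnorm z = Cmod z.
Proof. unfold Cnorm, Cnorm2, Cmod. f_equal. cring. Qed.

Lemma Cnorm2_Cmod (z : C) : Cnorm2 z = Cmod z ^ 2.
Proof. rewrite Cmod2_alt. unfold Cnorm2, Re, Im. cring. Qed.

Definition cscale (c : C) (v : vec) : vec := fun k => (c * v k)%C.
Definition line (p v : vec) (t : C) : vec := vadd p (cscale t v).
Definition vzero : vec := fun _ => RtoC 0.

Lemma sumC_ext n (f g : nat -> C) : (forall k, (k < n)%nat -> f k = g k) -> sumC n f = sumC n g.
Proof. induction n; simpl; intros H; auto. rewrite IHn, H; auto. Qed.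

Lemma sumR_ext n (f g : nat -> R) : (forall k, (k < n)%nat -> f k = g k) -> sumR n f = sumR n g.
Proof. induction n; simpl; intros H; auto. rewrite IHn, H; auto. Qed.

Lemma sumC_S n (f : nat -> C) : sumC (S n) f = (sumC n f + f n)%C.
Proof. reflexivity. Qed.

Lemma sumC_plus n (f g : nat -> C) : sumC n (fun k => f k + g k)%C = (sumC n f + sumC n g)%C.
Proof. induction n; [change (RtoC 0 = 0 + 0)%C; cring|]. rewrite !sumC_S, IHn. cring. Qed.

Lemma sumC_scal n c (f : nat -> C) : sumC n (fun k => c * f k)%C = (c * sumC n f)%C.
Proof. induction n; [change (RtoC 0 = c * 0)%C; cring|]. rewrite !sumC_S, IHn. cring. Qed.

Lemma sumC_minus n (f g : nat -> C) : sumC n (fun k => f k - g k)%C = (sumC n f - sumC n g)%C.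
Proof. induction n; [change (RtoC 0 = 0 - 0)%C; cring|]. rewrite !sumC_S, IHn. cring. Qed.

Lemma sumC_zero n (f : nat -> C) : (forall k, (k < n)%nat -> f k = RtoC 0) -> sumC n f = RtoC 0.
Proof. induction n; intros H; [reflexivity|]. rewrite sumC_S, IHn, H; auto. cring. Qed.

Lemma sumC_conj n (f : nat -> C) : Cconj (sumC n f)%C = sumC n (fun k => Cconj (f k)%C).
Proof.
  induction n; [apply injective_projections; simpl; cring|]. rewrite !sumC_S, Cplus_conj, IHn. auto.
Qed.

Lemma sumC_swap n m (f : nat -> nat -> C) : sumC n (fun i => sumC m (f i)) = sumC m (fun j => sumC n (fun i => f i j)).
Proof.
  induction n. { simpl. rewrite sumC_zero; auto. }
  rewrite sumC_S, IHn, <- sumC_plus. apply sumC_ext. intros. rewrite sumC_S. auto.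
Qed.

Lemma sumC_single n i (f : nat -> C) : (i < n)%nat -> (forall k, (k < n)%nat -> k <> i -> f k = RtoC 0) -> sumC n f = f i.
Proof.
  induction n; intros Hi H; [lia|]. rewrite sumC_S. destruct (Nat.eq_dec i n) as [->|Hn].
  - rewrite sumC_zero; [cring|]. intros; apply H; lia.
  - rewrite IHn; [rewrite (H n); try lia; cring|lia|intros; apply H; lia].
Qed.

Lemma sqnorm_nonneg n z : 0 <= sqnorm n z.
Proof. unfold sqnorm. induction n; simpl; [lra|]. unfold Cnorm2 at 2. nra. Qed.

Lemma normn_sq n z : normn n z ^ 2 = sqnorm n z.
Proof. unfold normn. apply pow2_sqrt. apply sqnorm_nonneg. Qed.

Lemma normn_nonneg n z : 0 <= normn n z.
Proof. apply sqrt_pos. Qed.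

Lemma normn_S n z : normn (S n) z = Cmod (normn n z, Cmod (z n)%C)%C.
Proof.
  unfold Cmod at 1; simpl fst; simpl snd. rewrite normn_sq. unfold normn. f_equal.
  unfold sqnorm; simpl sumR. rewrite (Cnorm2_Cmod (z n)). auto.
Qed.

Lemma normn_vadd n z w : normn n (vadd z w) <= normn n z + normn n w.
Proof.
  induction n as [|n IH].
  - unfold normn, sqnorm; simpl. rewrite sqrt_0. lra.
  - rewrite !normn_S.
    eapply Rle_trans; [apply (Cmod_pair_mono (normn n z + normn n w) (Cmod (z n)%C + Cmod (w n)%C))|].
    + pose proof (normn_nonneg n (vadd z w)). pose proof (normn_nonneg n z). pose proof (normn_nonneg n w).
      rewrite !Rabs_right; lra.
    + pose proof (Cmod_ge_0 (z n)). pose proof (Cmod_ge_0 (w n)). pose proof (Cmod_ge_0 (vadd z w n)).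
      rewrite !Rabs_right by lra. apply (Cmod_triangle (z n) (w n)).
    + apply (Cmod_triangle (normn n z, Cmod (z n)%C) (normn n w, Cmod (w n)%C)).
Qed.

Lemma normn_cscale n c v : normn n (cscale c v) = Cmod c * normn n v.
Proof.
  assert (Q : sqnorm n (cscale c v) = Cmod c ^ 2 * sqnorm n v).
  { unfold sqnorm. induction n; simpl sumR; [cring|]. rewrite IHn. rewrite !Cnorm2_Cmod. unfold cscale at 1.
    rewrite Cmod_mult. cring. }
  unfold normn. rewrite Q, sqrt_mult; auto using sqnorm_nonneg, pow2_ge_0.
  rewrite sqrt_pow2; auto using Cmod_ge_0.
Qed.

Lemma Cmod_le_normn n z k : (k < n)%nat -> Cmod (z k)%C <= normn n z.
Proof.
  induction n; intros Hk; [lia|]. rewrite normn_S. destruct (Nat.eq_dec k n) as [->|Hn].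
  - eapply Rle_trans; [|apply snd_le_Cmod]. simpl. apply Rle_abs.
  - eapply Rle_trans; [apply IHn; lia|]. eapply Rle_trans; [|apply fst_le_Cmod]. simpl. apply Rle_abs.
Qed.

Lemma supported_cscale n c v : supported n v -> supported n (cscale c v).
Proof. intros H k Hk. unfold cscale. rewrite H by auto. change (c * 0 = 0)%C. cring. Qed.

Lemma supported_vadd n v w : supported n v -> supported n w -> supported n (vadd v w).
Proof. intros H H' k Hk. unfold vadd. rewrite H, H' by auto. change (0 + 0 = 0)%C. cring. Qed.

Lemma supported_line n p v t : supported n p -> supported n v -> supported n (line p v t).
Proof. intros. apply supported_vadd; auto. apply supported_cscale; auto. Qed.

Lemma supported_vzero n : supported n vzero.
Proof. intros k _. reflexivity. Qed.

Lemma normn_line n p v t : normn n (line p v t) <= normn n p + Cmod t * normn n v.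
Proof. eapply Rle_trans; [apply normn_vadd|]. rewrite normn_cscale. lra. Qed.

Lemma normn_lt_1 n z : sqnorm n z < 1 <-> normn n z < 1.
Proof.
  rewrite <- normn_sq. pose proof (normn_nonneg n z). split; intros; nra.
Qed.

Lemma ball_normn n z : Defs.ball n z <-> supported n z /\ normn n z < 1.
Proof. unfold Defs.ball. rewrite normn_lt_1. tauto. Qed.

Lemma ball_line n p v (rho : R) t : supported n p -> supported n v -> normn n p + rho * normn n v < 1 ->
  Cmod t < rho -> Defs.ball n (line p v t).
Proof.
  intros Hp Hv H Ht. apply ball_normn. split; [apply supported_line; auto|].
  eapply Rle_lt_trans; [apply normn_line|]. pose proof (normn_nonneg n v). nra.
Qed.

Lemma line_0 p v : line p v 0%C = p.
Proof.
  apply functional_extensionality; intros k. unfold line, vadd, cscale.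
  change (p k + 0 * v k = p k)%C. cring.
Qed.

Lemma line_line p v t s : line (line p v t) v s = line p v (t + s)%C.
Proof.
  apply functional_extensionality; intros k. unfold line, vadd, cscale.
  change (p k + t * v k + s * v k = p k + (t + s) * v k)%C. cring.
Qed.

Lemma line_swap p u v s t : line (line p u s) v t = line (line p v t) u s.
Proof.
  apply functional_extensionality; intros k. unfold line, vadd, cscale.
  change (p k + s * u k + t * v k = p k + t * v k + s * u k)%C. cring.
Qed.

Definition cdot (n : nat) (a v : vec) : C := sumC n (fun k => (a k * v k)%C).

Definition is_grad (n : nat) (f : vec -> C) (z : vec) (a : vec) : Prop :=
  forall eps, eps > 0 -> exists delta, delta > 0 /\
    forall h, supported n h -> 0 < normn n h < delta ->
      Cmod (f (vadd z h) - f z - cdot n a h)%C <= eps * normn n h.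

Lemma holo_at_is_grad n f z : holo_at n f z <-> exists a, is_grad n f z a.
Proof.
  unfold holo_at, is_grad. split; intros [a H]; exists a; intros eps He; destruct (H eps He) as [d [Hd K]];
    exists d; split; auto; intros h Hs Hh; specialize (K h Hs Hh).
  - rewrite <- Cnorm_Cmod. exact K.
  - rewrite <- Cnorm_Cmod in K. exact K.
Qed.

Lemma cdot_cscale n a c v : cdot n a (cscale c v) = (c * cdot n a v)%C.
Proof. unfold cdot. rewrite <- sumC_scal. apply sumC_ext. intros. unfold cscale. cring. Qed.

Lemma is_grad_cderiv n f z a v : supported n v -> is_grad n f z a -> cderiv (fun t => f (line z v t)) 0%C (cdot n a v).
Proof.
  intros Hv H eps He. pose proof (normn_nonneg n v) as Pv.
  destruct (H (eps / (normn n v + 1))) as [d [Hd K]]. { apply Rdiv_lt_0_compat; lra. }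
  exists (d / (normn n v + 1)). split; [apply Rdiv_lt_0_compat; lra|]. intros h Hh.
  rewrite Cplus_0_l, line_0. pose proof (Cmod_ge_0 h) as Ph.
  assert (B : Cmod h * (normn n v + 1) < d).
  { replace d with (d / (normn n v + 1) * (normn n v + 1)) by (field; lra). apply Rmult_lt_compat_r; lra. }
  (* The estimate in [is_grad] excludes the zero increment, which occurs for [h = 0] and for
     [v = 0]. *)
  destruct (Req_dec (normn n (cscale h v)) 0) as [Z|Z].
  - assert (Z' : line z v h = z).
    { apply functional_extensionality; intros k. unfold line, vadd.
      assert (Zk : cscale h v k = RtoC 0).
      { destruct (Nat.lt_ge_cases k n) as [L|L].
        - apply Cmod_eq_0. apply Rle_antisym; [|apply Cmod_ge_0]. rewrite <- Z. apply Cmod_le_normn; auto.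
        - apply (supported_cscale n h v Hv k L). }
      rewrite Zk. change (z k + 0 = z k)%C. cring. }
    assert (Z2 : (cdot n a v * h)%C = RtoC 0).
    { rewrite Cmult_comm, <- cdot_cscale. unfold cdot. apply sumC_zero. intros k Hk.
      assert (Zk : cscale h v k = RtoC 0).
      { apply Cmod_eq_0. apply Rle_antisym; [|apply Cmod_ge_0]. rewrite <- Z. apply Cmod_le_normn; auto. }
      rewrite Zk. cring. }
    rewrite Z', Z2. replace (f z - f z - 0)%C with (RtoC 0) by cring. rewrite Cmod_0. nra.
  - specialize (K (cscale h v) (supported_cscale n h v Hv)). rewrite cdot_cscale in K.
    rewrite normn_cscale in *. rewrite (Cmult_comm (cdot n a v)). unfold line.
    eapply Rle_trans; [apply K; split; [|nra]|].
    + assert (0 <= Cmod h * normn n v) by nra. lra.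
    + apply Rle_trans with (eps / (normn n v + 1) * (Cmod h * (normn n v + 1))).
      * apply Rmult_le_compat_l; [left; apply Rdiv_lt_0_compat; lra|nra].
      * right. field. lra.
Qed.

(** Boundedness is part of the notion: it is available because the target domain is bounded, and it
    makes Cauchy's estimates uniform on lines. *)
Definition bholo (n : nat) (f : vec -> C) : Prop :=
  (forall z, Defs.ball n z -> exists a, is_grad n f z a) /\
  exists M, 0 <= M /\ forall z, Defs.ball n z -> Cmod (f z)%C <= M.

Definition grad (n : nat) (f : vec -> C) (z : vec) : vec := epsilon (inhabits vzero) (is_grad n f z).
Definition dd (n : nat) (f : vec -> C) (v z : vec) : C := cdot n (grad n f z) v.

Lemma bholo_is_grad n f z : bholo n f -> Defs.ball n z -> is_grad n f z (grad n f z).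
Proof. intros [H _] Hz. unfold grad. apply epsilon_spec. auto. Qed.

Lemma bholo_dd n f v z : bholo n f -> Defs.ball n z -> supported n v -> cderiv (fun t => f (line z v t)) 0%C (dd n f v z).
Proof. intros. apply is_grad_cderiv; auto. apply bholo_is_grad; auto. Qed.

Lemma bholo_dd_line n f v z t : bholo n f -> Defs.ball n (line z v t) -> supported n v ->
  cderiv (fun t => f (line z v t)) t (dd n f v (line z v t)).
Proof.
  intros Hf Hz Hv. pose proof (bholo_dd n f v _ Hf Hz Hv) as D.
  intros eps He. destruct (D eps He) as [d [Hd K]]. exists d. split; auto. intros h Hh. specialize (K h Hh).
  rewrite Cplus_0_l, line_0, line_line in K. exact K.
Qed.

Lemma dd_bound n f v z M : bholo n f -> (forall z, Defs.ball n z -> Cmod (f z)%C <= M) -> 0 <= M ->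
  Defs.ball n z -> supported n v -> Cmod (dd n f v z)%C <= 8 * M * (normn n v + 1) / (1 - normn n z).
Proof.
  intros Hf HM HM0 Hz Hv. pose proof (normn_nonneg n v). apply ball_normn in Hz. destruct Hz as [Hz1 Hz2].
  (* The [+ 1] allows [v = 0]. *)
  set (rho := (1 - normn n z) / (normn n v + 1)).
  assert (Hrho : 0 < rho) by (apply Rdiv_lt_0_compat; lra).
  assert (In : forall t, Cmod t < rho -> Defs.ball n (line z v t)).
  { intros t Ht. apply ball_normn. split; [apply supported_line; auto|].
    eapply Rle_lt_trans; [apply normn_line|].
    assert (Cmod t * (normn n v + 1) < 1 - normn n z).
    { replace (1 - normn n z) with (rho * (normn n v + 1)) by (unfold rho; field; lra). apply Rmult_lt_compat_r; lra. }
    pose proof (Cmod_ge_0 t). nra. }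
  destruct (cauchy_quad rho (fun t => f (line z v t)) (fun t => dd n f v (line z v t)) M Hrho) as (_ & _ & B).
  - intros t Ht. apply bholo_dd_line; auto.
  - intros t Ht. apply HM. auto.
  - specialize (B 0%C). rewrite Cmod_0, line_0 in B. eapply Rle_trans; [apply B; lra|].
    right. unfold rho. field. split; lra.
Qed.

(** Cauchy's formula in the direction [u], differentiated under the integral sign in the direction [v]. *)
Theorem dd_differentiable n f u v p : bholo n f -> Defs.ball n p -> supported n u -> supported n v ->
  exists l, cderiv (fun t => dd n f u (line p v t)) 0%C l.
Proof.
  intros Hf Hp Hu Hv. pose proof two_PI_pos as HPI. pose proof PI_RGT_0 as HPI2.
  destruct (proj2 Hf) as [M [HM0 HM]]. apply ball_normn in Hp. destruct Hp as [Hp1 Hp2].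
  pose proof (normn_nonneg n u). pose proof (normn_nonneg n v).
  set (rho := (1 - normn n p) / (normn n u + normn n v + 1)).
  assert (Hrho : 0 < rho) by (apply Rdiv_lt_0_compat; lra).
  assert (In : forall s t, Cmod s < rho -> Cmod t < rho -> Defs.ball n (line (line p v t) u s)).
  { intros s t Hs Ht. apply ball_normn. split; [apply supported_line; auto; apply supported_line; auto|].
    eapply Rle_lt_trans; [apply normn_line|]. pose proof (normn_line n p v t).
    pose proof (Cmod_ge_0 s). pose proof (Cmod_ge_0 t).
    assert (Cmod s * normn n u <= rho * normn n u) by (apply Rmult_le_compat_r; lra).
    assert (Cmod t * normn n v <= rho * normn n v) by (apply Rmult_le_compat_r; lra).
    assert (rho * (normn n u + normn n v + 1) = 1 - normn n p) by (unfold rho; field; lra). lra. }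
  set (r := rho / 4). assert (Hr : 0 < r) by (unfold r; lra).
  assert (N : RtoC (2 * PI * r) <> 0%C) by (apply RtoC_neq; nra).
  assert (QU : forall t, Cmod t < rho -> _) by
   (intros t Ht; exact (cauchy_quad rho (fun s => f (line (line p v t) u s)) (fun s => dd n f u (line (line p v t) u s)) M Hrho
     (fun s Hs => bholo_dd_line n f u (line p v t) s Hf (In s t Hs Ht) Hu) (fun s Hs => HM _ (In s t Hs Ht)))).
  assert (In' : forall s t, Cmod s < rho -> Cmod t < rho -> Defs.ball n (line (line p u s) v t)).
  { intros s t Hs Ht. rewrite line_swap. auto. }
  assert (QV : forall s, Cmod s < rho -> _) by
   (intros s Hs; exact (cauchy_quad rho (fun t => f (line (line p u s) v t)) (fun t => dd n f v (line (line p u s) v t)) M Hrho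
     (fun t Ht => bholo_dd_line n f v (line p u s) t Hf (In' s t Hs Ht) Hv) (fun t Ht => HM _ (In' s t Hs Ht)))).
  assert (Z2 : Cmod 0 < rho / 2) by (rewrite Cmod_0; lra).
  assert (Z1 : Cmod 0 < rho) by (rewrite Cmod_0; lra).
  assert (Hz : forall x, Cmod (r * E x)%C < rho / 2). { intros; rewrite Cmod_rE; unfold r in *; lra. }
  (* Comparing Cauchy's formula in the direction [v] at two points shows that [dd n f v] is
     Lipschitz along [u]. This makes the integrand of the differentiated formula continuous, hence
     integrable. *)
  assert (LV : forall s h, Cmod s < rho / 2 -> Cmod (s + h)%C < rho / 2 ->
    Cmod (dd n f v (line p u (s + h)%C) - dd n f v (line p u s))%C <= 2 * (8 * M / rho * Cmod h) / r).
  { intros s h Hs Hsh.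
    destruct (QV s ltac:(lra)) as (_ & A & _). destruct (QV (s + h)%C ltac:(lra)) as (_ & B & _).
    specialize (A 0%C Z2). specialize (B 0%C Z2). fold r in A, B. rewrite line_0 in A, B.
    assert (AB := isI_minus _ _ _ _ _ _ B A).
    apply (isI_circle_bound (fun x => f (line (line p u (s + h)%C) v (0 + r * E x)%C) - f (line (line p u s) v (0 + r * E x)%C))%C); auto.
    - intros x. rewrite Cplus_0_l, !(line_swap p u v).
      assert (Hx : Cmod (r * E x)%C < rho) by (specialize (Hz x); lra).
      destruct (QU (r * E x)%C Hx) as (_ & _ & BU).
      apply (bounded_derivative_lipschitz (rho / 2) (fun s => f (line (line p v (r * E x)%C) u s)) (fun s => dd n f u (line (line p v (r * E x)%C) u s))); auto.
      intros t Ht. apply bholo_dd_line; auto. apply In; lra.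
    - eapply isI_eq; [eapply isI_ext; [lra| |apply AB]|]; [intros; cbv beta; cring|cring]. }
  assert (CV : forall x, ccont (fun s => dd n f v (line p u s)) (0 + r * E x)%C).
  { intros x eps He. set (c := 2 * (8 * M / rho) / r + 1).
    assert (Hc : 0 < c). { unfold c. assert (0 <= 2 * (8 * M / rho) / r). { apply Rdiv_le_0_compat; [|lra]. assert (0 <= 8 * M / rho) by (apply Rdiv_le_0_compat; lra). lra. } lra. }
    exists (Rmin (rho / 4) (eps / c)). split; [apply Rmin_pos; [lra|apply Rdiv_lt_0_compat; auto]|].
    intros h Hh. assert (Hh1 := Rlt_le_trans _ _ _ Hh (Rmin_l _ _)). assert (Hh2 := Rlt_le_trans _ _ _ Hh (Rmin_r _ _)).
    rewrite Cplus_0_l. eapply Rle_trans; [apply LV; auto|].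
    - eapply Rle_lt_trans; [apply Cmod_triangle|]. rewrite Cmod_rE by auto. unfold r; lra.
    - apply Rle_trans with (c * Cmod h).
      + unfold c. pose proof (Cmod_ge_0 h). replace (2 * (8 * M / rho * Cmod h) / r) with (2 * (8 * M / rho) / r * Cmod h) by (field; lra). lra.
      + apply Rmult_lt_compat_l with (r := c) in Hh2; auto. replace (c * (eps / c)) with eps in Hh2 by (field; lra). lra. }
  destruct (isI_cont_all (fun x => dd n f v (line p u (0 + r * E x)%C) * Cconj (E x)%C)%C 0 (2 * PI)) as [L HL].
  { intros x. apply rcont_mult. apply (rcont_circle (fun s => dd n f v (line p u s))). exact CV.
    eapply rderiv_rcont, rderiv_conj, rderiv_E. }
  exists (L / (2 * PI * r)%R)%C.
  apply (quadratic_cderiv _ _ _ (2 * (64 * M / rho ^ 2) / r) (rho / 2)); [lra|]. intros h Hh.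
  rewrite Cplus_0_l, line_0.
  assert (DI := diff_under_integral (fun h x => f (line (line p v h) u (0 + r * E x)%C) * Cconj (E x)%C)%C
      (fun x => dd n f v (line p u (0 + r * E x)%C) * Cconj (E x)%C)%C
      (fun h => (2 * PI * r)%R * dd n f u (line p v h))%C L 0 (2 * PI) (64 * M / rho ^ 2) h).
  cbv beta in DI. specialize (DI ltac:(lra)).
  destruct (QU h ltac:(lra)) as (_ & A & _). destruct (QU 0%C Z1) as (_ & B & _).
  specialize (A 0%C Z2). specialize (B 0%C Z2). fold r in A, B.
  rewrite (line_0 (line p v h)) in A. rewrite !(line_0 p v) in B. rewrite !(line_0 p v) in DI. rewrite (line_0 p u) in B.
  specialize (DI A B HL).
  apply Rmult_le_reg_l with (2 * PI * r); [nra|].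
  replace (2 * PI * r * Cmod (dd n f u (line p v h) - dd n f u p - h * (L / (2 * PI * r)%R))%C)%R with
    (Cmod ((2 * PI * r)%R * dd n f u (line p v h) - (2 * PI * r)%R * dd n f u p - h * L)%C)%C.
  2:{ rewrite <- (Rabs_right (2 * PI * r)) at 3 by nra. rewrite <- Cmod_R, <- Cmod_mult. f_equal. field. exact N. }
  eapply Rle_trans; [apply DI|].
  - intros x _. rewrite !Cplus_0_l, <- line_swap.
    assert (Hx : Cmod (r * E x)%C < rho) by (specialize (Hz x); lra).
    destruct (QV (r * E x)%C Hx) as (Q & _ & _). specialize (Q 0%C h Z2). rewrite Cplus_0_l in Q. specialize (Q Hh).
    cbv beta in Q. rewrite line_0 in Q.
    replace (f (line (line p u (r * E x)%C) v h) * Cconj (E x)%C - f (line p u (r * E x)%C) * Cconj (E x)%C -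
      h * (dd n f v (line p u (r * E x)%C) * Cconj (E x)%C))%C with
      ((f (line (line p u (r * E x)%C) v h) - f (line p u (r * E x)%C) - h * dd n f v (line p u (r * E x)%C)) * Cconj (E x)%C)%C by cring.
    rewrite Cmod_mult, Cmod_conj, Cmod_E, Rmult_1_r. exact Q.
  - right. field. lra.
Qed.

Lemma cderiv_inv (t : C) : t <> RtoC 0 -> cderiv (fun z => / z)%C t (- / (t * t))%C.
Proof.
  intros Ht. assert (P : 0 < Cmod t) by (apply Cmod_gt_0; auto).
  apply (quadratic_cderiv _ _ _ (2 / Cmod t ^ 3) (Cmod t / 2)); [lra|]. intros h Hh.
  assert (B : Cmod t / 2 <= Cmod (t + h)%C).
  { pose proof (Cmod_reverse t (- h)%C). rewrite Cmod_opp in H. replace (t - - h)%C with (t + h)%C in H by cring. lra. }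
  assert (N : (t + h)%C <> RtoC 0) by (apply Cmod_gt_0; lra).
  replace (/ (t + h) - / t - h * - / (t * t))%C with (h * h / (t * t * (t + h)))%C by (field; auto).
  rewrite Cmod_div, !Cmod_mult. 2:{ repeat apply Cmult_neq_0; auto. }
  unfold Rdiv. replace (2 * / Cmod t ^ 3 * Cmod h ^ 2) with ((Cmod h * Cmod h) * / (Cmod t * Cmod t * (Cmod t / 2))) by (field; lra).
  apply Rmult_le_compat_l; [apply Rmult_le_pos; apply Cmod_ge_0|].
  apply Rinv_le_contravar; [|apply Rmult_le_compat_l; [|exact B]]; repeat apply Rmult_lt_0_compat; try lra; try nra.
Qed.

Fixpoint csum1 (n : nat) (a : nat -> C) : R := match n with O => 0 | S p => csum1 p a + Cmod (a p)%C end.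

Lemma csum1_nonneg n a : 0 <= csum1 n a.
Proof. unfold csum1. induction n; simpl; [lra|]. pose proof (Cmod_ge_0 (a n)). lra. Qed.

Lemma cdot_bound n a h : Cmod (cdot n a h)%C <= csum1 n a * normn n h.
Proof.
  assert (G : forall m, (m <= n)%nat -> Cmod (cdot m a h)%C <= csum1 m a * normn n h).
  { induction m; intros Hm.
    - change (Cmod 0 <= 0 * normn n h). rewrite Cmod_0. lra.
    - change (cdot (S m) a h) with (cdot m a h + a m * h m)%C. change (csum1 (S m) a) with (csum1 m a + Cmod (a m)).
      eapply Rle_trans; [apply Cmod_triangle|]. rewrite Cmod_mult. specialize (IHm ltac:(lia)).
      pose proof (Cmod_le_normn n h m Hm). pose proof (Cmod_ge_0 (a m)). nra. }
  apply G. lia.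
Qed.

Lemma cdot_plus_l n a b h : cdot n (vadd a b) h = (cdot n a h + cdot n b h)%C.
Proof.
  unfold cdot. rewrite <- sumC_plus. apply sumC_ext. intros. unfold vadd.
  change ((a k + b k) * h k = a k * h k + b k * h k)%C. cring.
Qed.

Lemma cdot_cscale_l n c a h : cdot n (cscale c a) h = (c * cdot n a h)%C.
Proof. unfold cdot. rewrite <- sumC_scal. apply sumC_ext. intros. unfold cscale. cring. Qed.

Lemma is_grad_const n c z : is_grad n (fun _ => c) z vzero.
Proof.
  intros eps He. exists 1. split; [lra|]. intros h _ _.
  assert (Z : cdot n vzero h = RtoC 0). { apply sumC_zero. intros. unfold vzero. cring. }
  rewrite Z. replace (c - c - 0)%C with (RtoC 0) by cring. rewrite Cmod_0. pose proof (normn_nonneg n h). nra.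
Qed.

Lemma is_grad_plus n f g z a b : is_grad n f z a -> is_grad n g z b -> is_grad n (fun w => f w + g w)%C z (vadd a b).
Proof.
  intros Hf Hg eps He. destruct (Hf (eps / 2)) as [d1 [Hd1 K1]]; [lra|]. destruct (Hg (eps / 2)) as [d2 [Hd2 K2]]; [lra|].
  exists (Rmin d1 d2). split; [apply Rmin_pos; auto|]. intros h Hs [Hh0 Hh].
  specialize (K1 h Hs (conj Hh0 (Rlt_le_trans _ _ _ Hh (Rmin_l _ _)))).
  specialize (K2 h Hs (conj Hh0 (Rlt_le_trans _ _ _ Hh (Rmin_r _ _)))).
  rewrite cdot_plus_l.
  replace (f (vadd z h) + g (vadd z h) - (f z + g z) - (cdot n a h + cdot n b h))%C with
    ((f (vadd z h) - f z - cdot n a h) + (g (vadd z h) - g z - cdot n b h))%C by cring.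
  eapply Rle_trans; [apply Cmod_triangle|]. lra.
Qed.

Lemma is_grad_comp n f phi z a l : is_grad n f z a -> cderiv phi (f z) l -> is_grad n (fun w => phi (f w)) z (cscale l a).
Proof.
  intros Hf Hp eps He. set (A := csum1 n a + 1). set (L := Cmod l + 1).
  assert (HA : 0 < A) by (unfold A; pose proof (csum1_nonneg n a); lra).
  assert (HL : 0 < L) by (unfold L; pose proof (Cmod_ge_0 l); lra).
  destruct (Hp (eps / (2 * A))) as [d1 [Hd1 K1]]; [apply Rdiv_lt_0_compat; lra|].
  destruct (Hf (Rmin 1 (eps / (2 * L)))) as [d2 [Hd2 K2]]. { apply Rmin_pos; [lra|apply Rdiv_lt_0_compat; lra]. }
  exists (Rmin d2 (d1 / A)). split; [apply Rmin_pos; auto; apply Rdiv_lt_0_compat; auto|].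
  intros h Hs [Hh0 Hh].
  specialize (K2 h Hs (conj Hh0 (Rlt_le_trans _ _ _ Hh (Rmin_l _ _)))).
  assert (Hh2 := Rlt_le_trans _ _ _ Hh (Rmin_r _ _)).
  set (k := (f (vadd z h) - f z)%C).
  assert (Bk : Cmod k <= A * normn n h).
  { replace k with ((f (vadd z h) - f z - cdot n a h) + cdot n a h)%C by (unfold k; cring).
    eapply Rle_trans; [apply Cmod_triangle|]. pose proof (cdot_bound n a h).
    pose proof (Rmin_l 1 (eps / (2 * L))). unfold A. nra. }
  assert (Bk2 : Cmod k < d1).
  { eapply Rle_lt_trans; [exact Bk|]. replace d1 with (A * (d1 / A)) by (field; lra). apply Rmult_lt_compat_l; auto. }
  specialize (K1 k Bk2). replace (f z + k)%C with (f (vadd z h)) in K1 by (unfold k; cring).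
  rewrite cdot_cscale_l.
  replace (phi (f (vadd z h)) - phi (f z) - l * cdot n a h)%C with
    ((phi (f (vadd z h)) - phi (f z) - l * k) + l * (f (vadd z h) - f z - cdot n a h))%C by (unfold k; cring).
  eapply Rle_trans; [apply Cmod_triangle|]. rewrite Cmod_mult.
  assert (X1 : Cmod (phi (f (vadd z h)) - phi (f z) - l * k)%C <= eps / 2 * normn n h).
  { eapply Rle_trans; [exact K1|]. apply Rle_trans with (eps / (2 * A) * (A * normn n h)).
    - apply Rmult_le_compat_l; [left; apply Rdiv_lt_0_compat; lra|exact Bk].
    - right. field. lra. }
  assert (X2 : Cmod l * Cmod (f (vadd z h) - f z - cdot n a h)%C <= eps / 2 * normn n h).
  { apply Rle_trans with (L * (eps / (2 * L) * normn n h)).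
    - apply Rmult_le_compat; try apply Cmod_ge_0. unfold L; lra. eapply Rle_trans; [exact K2|].
      apply Rmult_le_compat_r; [lra|apply Rmin_r].
    - right. field. lra. }
  lra.
Qed.

Lemma is_grad_scal n c f z a : is_grad n f z a -> is_grad n (fun w => c * f w)%C z (cscale c a).
Proof.
  intros H. apply (is_grad_comp n f (fun t => c * t)%C z a c H).
  eapply cderiv_eq. apply cderiv_scal, cderiv_id. cring.
Qed.

(** From the chain rule for [t^2], by polarization. *)
Lemma is_grad_mult n f g z a b : is_grad n f z a -> is_grad n g z b -> exists c, is_grad n (fun w => f w * g w)%C z c.
Proof.
  intros Hf Hg.
  assert (S : forall F c, is_grad n F z c -> exists c', is_grad n (fun w => F w * F w)%C z c').
  { intros F c HF. eexists. eapply (is_grad_comp n F (fun t => t * t)%C z c); [exact HF|]. apply cderiv_mult; apply cderiv_id. }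
  destruct (S _ _ (is_grad_plus _ _ _ _ _ _ Hf Hg)) as [c1 H1].
  destruct (S _ _ (is_grad_plus _ _ _ _ _ _ Hf (is_grad_scal n (-(1))%C _ _ _ Hg))) as [c2 H2].
  eexists.
  assert (Q := is_grad_scal n (/ 4)%C _ _ _ (is_grad_plus _ _ _ _ _ _ H1 (is_grad_scal n (-(1))%C _ _ _ H2))).
  cbv beta in Q. revert Q.
  match goal with |- is_grad n ?F z _ -> _ => assert (EF : F = (fun w => f w * g w)%C) end.
  { apply functional_extensionality; intros w. field. }
  rewrite EF. intros Q. exact Q.
Qed.

Lemma is_grad_inv n f z a : is_grad n f z a -> f z <> RtoC 0 -> exists c, is_grad n (fun w => / f w)%C z c.
Proof. intros Hf Hn. eexists. eapply (is_grad_comp n f (fun t => / t)%C z a); [exact Hf|]. apply cderiv_inv; auto. Qed.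

Lemma is_grad_coord n k z : exists a, is_grad n (fun w => w k) z a.
Proof.
  destruct (Nat.lt_ge_cases k n) as [L|L].
  - exists (ex k). intros eps He. exists 1. split; [lra|]. intros h Hs _.
    assert (E : cdot n (ex k) h = h k).
    { unfold cdot. rewrite (sumC_single n k); auto.
      - unfold ex. rewrite Nat.eqb_refl. change (1 * h k = h k)%C. cring.
      - intros j _ Hj. unfold ex. apply Nat.eqb_neq in Hj. rewrite Hj. change (0 * h j = 0)%C. cring. }
    rewrite E. replace (vadd z h k - z k - h k)%C with (RtoC 0). rewrite Cmod_0. pose proof (normn_nonneg n h); nra.
    unfold vadd. change (RtoC 0 = z k + h k - z k - h k)%C. cring.
  - exists vzero. intros eps He. exists 1. split; [lra|]. intros h Hs _.
    assert (Z : cdot n vzero h = RtoC 0). { apply sumC_zero. intros. unfold vzero. cring. }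
    rewrite Z. replace (vadd z h k - z k - 0)%C with (RtoC 0). rewrite Cmod_0. pose proof (normn_nonneg n h); nra.
    unfold vadd. rewrite (Hs k L). change (RtoC 0 = z k + 0 - z k - 0)%C. cring.
Qed.

Lemma is_grad_ext n f g z a : (forall w, f w = g w) -> is_grad n f z a -> is_grad n g z a.
Proof. intros H. replace g with f; auto. apply functional_extensionality; auto. Qed.

Lemma bholo_const n c : bholo n (fun _ => c).
Proof.
  split. intros z _. eexists; apply is_grad_const. exists (Cmod c). split; [apply Cmod_ge_0|intros; lra].
Qed.

Lemma bholo_plus n f g : bholo n f -> bholo n g -> bholo n (fun w => f w + g w)%C.
Proof.
  intros [Hf [M [HM0 HM]]] [Hg [N [HN0 HN]]]. split.
  - intros z Hz. destruct (Hf z Hz) as [a Ha]. destruct (Hg z Hz) as [b Hb]. eexists. apply is_grad_plus; eauto.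
  - exists (M + N). split; [lra|]. intros z Hz. eapply Rle_trans; [apply Cmod_triangle|]. specialize (HM z Hz). specialize (HN z Hz). lra.
Qed.

Lemma bholo_mult n f g : bholo n f -> bholo n g -> bholo n (fun w => f w * g w)%C.
Proof.
  intros [Hf [M [HM0 HM]]] [Hg [N [HN0 HN]]]. split.
  - intros z Hz. destruct (Hf z Hz) as [a Ha]. destruct (Hg z Hz) as [b Hb]. eapply is_grad_mult; eauto.
  - exists (M * N). split; [nra|]. intros z Hz. rewrite Cmod_mult. apply Rmult_le_compat; auto using Cmod_ge_0.
Qed.

Lemma bholo_coord n k : bholo n (fun w => w k).
Proof.
  split. intros z _. apply is_grad_coord. exists 1. split; [lra|]. intros z Hz. apply ball_normn in Hz. destruct Hz as [Hs Hz].
  destruct (Nat.lt_ge_cases k n) as [L|L].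
  - pose proof (Cmod_le_normn n z k L). lra.
  - rewrite (Hs k L). change (Cmod 0 <= 1). rewrite Cmod_0. lra.
Qed.

Lemma bholo_sumC n m (f : nat -> vec -> C) : (forall k, (k < m)%nat -> bholo n (f k)) -> bholo n (fun w => sumC m (fun k => f k w)).
Proof.
  induction m; intros H.
  - apply (bholo_const n 0%C).
  - apply (bholo_plus n (fun w => sumC m (fun k => f k w)) (f m)); auto.
Qed.

Lemma bholo_eq_on_ball n f g : bholo n f -> (forall z, f z = g z) -> bholo n g.
Proof. intros H E. replace g with f; auto. apply functional_extensionality; auto. Qed.

(** * Second derivatives and Levi forms *)

Lemma vadd_vscale_line z u (t : R) : vadd z (vscale t u) = line z u t.
Proof.
  apply functional_extensionality; intros k. unfold line, vadd, vscale, cscale. f_equal.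
  unfold Cscale. apply injective_projections; simpl; ring.
Qed.

Lemma dir_deriv_iff f z u l : dir_deriv f z u l <-> is_derive (fun t : R => f (line z u t)) 0 l.
Proof.
  unfold dir_deriv. rewrite <- is_derive_Reals.
  replace (fun t : R => f (vadd z (vscale t u))) with (fun t : R => f (line z u t)); [tauto|].
  apply functional_extensionality; intros t. rewrite vadd_vscale_line. auto.
Qed.

Lemma ball_near n z : Defs.ball n z -> exists d, 0 < d /\ forall h, supported n h -> normn n h < d -> Defs.ball n (vadd z h).
Proof.
  intros Hz. apply ball_normn in Hz. destruct Hz as [Hs Hz]. exists (1 - normn n z). split; [lra|].
  intros h Hh Hn. apply ball_normn. split; [apply supported_vadd; auto|]. pose proof (normn_vadd n z h). lra.
Qed.

Lemma vadd_vsub z w : vadd z (vsub w z) = w.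
Proof.
  apply functional_extensionality; intros k. unfold vadd, vsub. change (z k + (w k - z k) = w k)%C. cring.
Qed.

Lemma vsub_vadd z h : vsub (vadd z h) z = h.
Proof.
  apply functional_extensionality; intros k. unfold vadd, vsub. change (z k + h k - z k = h k)%C. cring.
Qed.

Lemma supported_vsub n v w : supported n v -> supported n w -> supported n (vsub v w).
Proof. intros H H' k Hk. unfold vsub. rewrite H, H' by auto. change (0 - 0 = 0)%C. cring. Qed.

Lemma ball_near_line n z u : Defs.ball n z -> supported n u -> exists d, 0 < d /\ forall t : C, Cmod t < d -> Defs.ball n (line z u t).
Proof.
  intros Hz Hu. apply ball_normn in Hz. destruct Hz as [Hs Hz]. pose proof (normn_nonneg n u).
  exists ((1 - normn n z) / (normn n u + 1)). split; [apply Rdiv_lt_0_compat; lra|]. intros t Ht.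
  apply ball_normn. split; [apply supported_line; auto|]. eapply Rle_lt_trans; [apply normn_line|].
  assert (Cmod t * (normn n u + 1) < 1 - normn n z).
  { replace (1 - normn n z) with ((1 - normn n z) / (normn n u + 1) * (normn n u + 1)) by (field; lra). apply Rmult_lt_compat_r; lra. }
  pose proof (Cmod_ge_0 t). nra.
Qed.

Lemma dir_deriv_ext n f g z u l : Defs.ball n z -> supported n u -> (forall w, Defs.ball n w -> f w = g w) ->
  dir_deriv f z u l -> dir_deriv g z u l.
Proof.
  intros Hz Hu E. rewrite !dir_deriv_iff. intros D. destruct (ball_near_line n z u Hz Hu) as [d [Hd B]].
  eapply is_derive_ext_loc; [|exact D]. exists (mkposreal d Hd). intros t Ht. apply E, B. rewrite Cmod_R.
  unfold Hierarchy.ball in Ht; simpl in Ht; unfold AbsRing_ball, abs, minus, plus, opp in Ht; simpl in Ht.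
  rewrite Ropp_0, Rplus_0_r in Ht. exact Ht.
Qed.

Lemma dir_deriv_unique f z u l m : dir_deriv f z u l -> dir_deriv f z u m -> l = m.
Proof. unfold dir_deriv. intros A B. eapply uniqueness_limite; eauto. Qed.

Lemma D2_lincomb n f g u v z r s (a b : R) : D2 n f u v z r -> D2 n g u v z s ->
  D2 n (fun w => a * f w + b * g w) u v z (a * r + b * s).
Proof.
  intros [f1 [d1 [Hd1 [A1 B1]]]] [g1 [d2 [Hd2 [A2 B2]]]].
  assert (L : forall F G w u x y, dir_deriv F w u x -> dir_deriv G w u y -> dir_deriv (fun w => a * F w + b * G w) w u (a * x + b * y)).
  { intros F G w u' x y. rewrite !dir_deriv_iff. intros HF HG.
    apply is_derive_Rplus; eapply is_derive_eq; try (apply is_derive_Rmult; [apply (is_derive_const (K := R_AbsRing) (V := R_NormedModule))|]; eassumption);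
    unfold zero; simpl; ring. }
  exists (fun w => a * f1 w + b * g1 w), (Rmin d1 d2). split; [apply Rmin_pos; auto|]. split.
  - intros w Hw Hd. apply L; [apply A1|apply A2]; auto; eapply Rlt_le_trans; try exact Hd; [apply Rmin_l|apply Rmin_r].
  - apply L; auto.
Qed.

Lemma D2_ext n f g u v z r : Defs.ball n z -> supported n u -> (forall w, Defs.ball n w -> f w = g w) ->
  D2 n f u v z r -> D2 n g u v z r.
Proof.
  intros Hz Hu E [f1 [d1 [Hd1 [A1 B1]]]]. destruct (ball_near n z Hz) as [d [Hd Hb]].
  exists f1, (Rmin d1 d). split; [apply Rmin_pos; auto|]. split; auto. intros w Hw Hn.
  apply (dir_deriv_ext n f); auto.
  - rewrite <- (vadd_vsub z w). apply Hb. apply supported_vsub; auto. apply Hz. eapply Rlt_le_trans; [exact Hn|apply Rmin_r].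
  - apply A1; auto. eapply Rlt_le_trans; [exact Hn|apply Rmin_l].
Qed.

Lemma D2_unique n f u v z r s : supported n z -> supported n v -> D2 n f u v z r -> D2 n f u v z s -> r = s.
Proof.
  intros Hz Hv [f1 [d1 [Hd1 [A1 B1]]]] [g1 [d2 [Hd2 [A2 B2]]]].
  eapply dir_deriv_unique; [exact B1|]. rewrite dir_deriv_iff in *.
  pose proof (normn_nonneg n v). set (d := Rmin d1 d2 / (normn n v + 1)).
  assert (Hm : 0 < Rmin d1 d2) by (apply Rmin_pos; auto).
  assert (Hd : 0 < d) by (apply Rdiv_lt_0_compat; lra).
  eapply is_derive_ext_loc; [|exact B2]. exists (mkposreal d Hd). intros t Ht.
  unfold Hierarchy.ball in Ht; simpl in Ht; unfold AbsRing_ball, abs, minus, plus, opp in Ht; simpl in Ht.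
  rewrite Ropp_0, Rplus_0_r in Ht.
  assert (N : normn n (vsub (line z v t) z) < Rmin d1 d2).
  { unfold line. rewrite vsub_vadd, normn_cscale, Cmod_R.
    replace (Rmin d1 d2) with (d * (normn n v + 1)) by (unfold d; field; lra). pose proof (Rabs_pos t). nra. }
  assert (Hl : supported n (line z v t)) by (apply supported_line; auto).
  eapply dir_deriv_unique; [apply A2|apply A1]; auto; eapply Rlt_le_trans; try exact N; [apply Rmin_r|apply Rmin_l].
Qed.

Lemma supported_ex n i : (i < n)%nat -> supported n (ex i).
Proof. intros H k Hk. unfold ex. destruct (Nat.eqb_spec k i); [lia|reflexivity]. Qed.

Lemma ey_cscale i : ey i = cscale Ci (ex i).
Proof.
  apply functional_extensionality; intros k. unfold ey, cscale, ex. destruct (Nat.eqb k i).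
  - apply injective_projections; simpl; ring.
  - apply injective_projections; simpl; ring.
Qed.

Lemma ex_cscale i : ex i = cscale 1%C (ex i).
Proof. apply functional_extensionality; intros k. unfold cscale. cring. Qed.

Lemma supported_ey n i : (i < n)%nat -> supported n (ey i).
Proof. intros. rewrite ey_cscale. apply supported_cscale, supported_ex; auto. Qed.

(** The isometry hypothesis only asserts the existence of Levi coefficients; this is what identifies
    them with the computed ones. *)
Lemma levi_unique n f z i j c d : Defs.ball n z -> (i < n)%nat -> (j < n)%nat -> levi n f z i j c -> levi n f z i j d -> c = d.
Proof.
  intros [Hz _] Hi Hj (a & b & p & q & A & B & P & Q & ->) (a' & b' & p' & q' & A' & B' & P' & Q' & ->).
  pose proof (supported_ex n j Hj). pose proof (supported_ey n j Hj).
  rewrite (D2_unique _ _ _ _ _ _ _ Hz H A A'), (D2_unique _ _ _ _ _ _ _ Hz H0 B B'),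
    (D2_unique _ _ _ _ _ _ _ Hz H0 P P'), (D2_unique _ _ _ _ _ _ _ Hz H Q Q'). auto.
Qed.

Lemma levi_lincomb n f g z i j c d (a b : R) : levi n f z i j c -> levi n g z i j d ->
  levi n (fun w => a * f w + b * g w) z i j (a * c + b * d)%C.
Proof.
  intros (a1 & b1 & p & q & A & B & P & Q & ->) (a' & b' & p' & q' & A' & B' & P' & Q' & ->).
  exists (a * a1 + b * a'), (a * b1 + b * b'), (a * p + b * p'), (a * q + b * q').
  split; [apply D2_lincomb; auto|]. split; [apply D2_lincomb; auto|]. split; [apply D2_lincomb; auto|]. split; [apply D2_lincomb; auto|].
  apply injective_projections; simpl; field.
Qed.

Lemma levi_ext n f g z i j c : Defs.ball n z -> (i < n)%nat -> (forall w, Defs.ball n w -> f w = g w) ->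
  levi n f z i j c -> levi n g z i j c.
Proof.
  intros Hz Hi E (a & b & p & q & A & B & P & Q & ->). exists a, b, p, q.
  pose proof (supported_ex n i Hi). pose proof (supported_ey n i Hi).
  split; [eapply D2_ext; eauto|]. split; [eapply D2_ext; eauto|]. split; [eapply D2_ext; eauto|]. split; [eapply D2_ext; eauto|]. auto.
Qed.

(** * Hermitian forms and the Levi form of their logarithm *)

Definition herm (N : nat) (e : nat -> R) (A B : nat -> C) : C := sumC N (fun a => (RtoC (e a) * A a * Cconj (B a)%C)%C).
Definition hermR (N : nat) (e : nat -> R) (A : nat -> C) : R := sumR N (fun a => e a * Cnorm2 (A a)).

Lemma herm_diag N e A : herm N e A A = RtoC (hermR N e A).
Proof.
  unfold herm, hermR. induction N; [reflexivity|]. rewrite sumC_S, IHN. simpl sumR.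
  rewrite RtoC_plus. f_equal. unfold Cnorm2. apply injective_projections; simpl; ring.
Qed.

Lemma herm_conj N e A B : Cconj (herm N e A B)%C = herm N e B A.
Proof.
  unfold herm. rewrite sumC_conj. apply sumC_ext. intros. rewrite !Cmult_conj, Cconj_conj.
  replace (Cconj (e k)%C) with (RtoC (e k)) by (apply injective_projections; simpl; ring). cring.
Qed.

Lemma herm_ext N e A B A' B' : (forall a, (a < N)%nat -> A a = A' a) -> (forall a, (a < N)%nat -> B a = B' a) ->
  herm N e A B = herm N e A' B'.
Proof. intros H H'. apply sumC_ext. intros. rewrite H, H'; auto. Qed.

Lemma herm_plus_l N e A A' B : herm N e (fun a => A a + A' a)%C B = (herm N e A B + herm N e A' B)%C.
Proof. unfold herm. rewrite <- sumC_plus. apply sumC_ext. intros. cring. Qed.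

Lemma herm_minus_l N e A A' B : herm N e (fun a => A a - A' a)%C B = (herm N e A B - herm N e A' B)%C.
Proof. unfold herm. rewrite <- sumC_minus. apply sumC_ext. intros. cring. Qed.

Lemma herm_scal_l N e c A B : herm N e (fun a => c * A a)%C B = (c * herm N e A B)%C.
Proof. unfold herm. rewrite <- sumC_scal. apply sumC_ext. intros. cring. Qed.

Lemma herm_plus_r N e A B B' : herm N e A (fun a => B a + B' a)%C = (herm N e A B + herm N e A B')%C.
Proof. unfold herm. rewrite <- sumC_plus. apply sumC_ext. intros. rewrite Cplus_conj. cring. Qed.

Lemma herm_minus_r N e A B B' : herm N e A (fun a => B a - B' a)%C = (herm N e A B - herm N e A B')%C.
Proof. unfold herm. rewrite <- sumC_minus. apply sumC_ext. intros. rewrite Cminus_conj. cring. Qed.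

Lemma herm_scal_r N e c A B : herm N e A (fun a => c * B a)%C = (Cconj c * herm N e A B)%C.
Proof. unfold herm. rewrite <- sumC_scal. apply sumC_ext. intros. rewrite Cmult_conj. cring. Qed.

Lemma rderiv_sumC N (f : nat -> R -> C) (f' : nat -> C) x : (forall a, (a < N)%nat -> rderiv (f a) x (f' a)) ->
  rderiv (fun y => sumC N (fun a => f a y)) x (sumC N f').
Proof.
  induction N; intros H.
  - change (rderiv (fun _ => RtoC 0) x (RtoC 0)). apply rderiv_const.
  - apply (rderiv_plus (fun y => sumC N (fun a => f a y)) (f N)); auto.
Qed.

Lemma rderiv_herm N e (A B : R -> nat -> C) A' B' x :
  (forall a, (a < N)%nat -> rderiv (fun y => A y a) x (A' a)) ->
  (forall a, (a < N)%nat -> rderiv (fun y => B y a) x (B' a)) ->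
  rderiv (fun y => herm N e (A y) (B y)) x (herm N e A' (B x) + herm N e (A x) B')%C.
Proof.
  intros HA HB. eapply rderiv_eq.
  - apply (rderiv_sumC N (fun a y => (e a * A y a * Cconj (B y a)%C)%C)). intros a Ha.
    apply rderiv_mult. apply rderiv_mult. apply rderiv_const. apply HA; auto. apply rderiv_conj, HB; auto.
  - unfold herm. rewrite <- sumC_plus. apply sumC_ext. intros. cring.
Qed.

Lemma dd_cscale n f e v w : dd n f (cscale e v) w = (e * dd n f v w)%C.
Proof. apply cdot_cscale. Qed.

Lemma rderiv_line_R f w v l : cderiv (fun t => f (line w v t)) 0%C l -> rderiv (fun x : R => f (line w v x)) 0 l.
Proof.
  intros H. eapply rderiv_eq. apply (cderiv_rderiv (fun t => f (line w v t)) (fun x => RtoC x)). exact H.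
  apply rderiv_id. cring.
Qed.

Lemma line_cscale w e v t : line w (cscale e v) t = line w v (e * t)%C.
Proof.
  apply functional_extensionality; intros k. unfold line, vadd, cscale.
  change (w k + t * (e * v k) = w k + e * t * v k)%C. cring.
Qed.

Section LogHerm.

Variables (n N : nat) (e : nat -> R) (Phi : nat -> vec -> C).
Hypothesis HPhi : forall a, (a < N)%nat -> bholo n (Phi a).
Hypothesis Hpos : forall z, Defs.ball n z -> 0 < hermR N e (fun a => Phi a z).

Let P (z : vec) : nat -> C := fun a => Phi a z.
Let dP (u z : vec) : nat -> C := fun a => dd n (Phi a) u z.

Lemma hermR_derive z u : Defs.ball n z -> supported n u ->
  is_derive (fun x : R => hermR N e (P (line z u x))) 0 (2 * fst (herm N e (dP u z) (P z))).
Proof.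
  intros Hz Hu.
  assert (D : rderiv (fun x : R => herm N e (P (line z u x)) (P (line z u x))) 0
    (herm N e (dP u z) (P (line z u 0%R)) + herm N e (P (line z u 0%R)) (dP u z))%C).
  { apply (rderiv_herm N e (fun x : R => P (line z u x)) (fun x : R => P (line z u x)));
    intros a Ha; apply (rderiv_line_R (Phi a)), bholo_dd; auto. }
  rewrite !line_0 in D. rewrite <- (herm_conj N e (dP u z) (P z)) in D. destruct D as [D _].
  eapply is_derive_eq; [eapply is_derive_ext; [|exact D]|].
  - intros t. simpl. rewrite herm_diag. reflexivity.
  - simpl. ring.
Qed.

Lemma is_derive_quotient (f g : R -> R) (x l m : R) : is_derive f x l -> is_derive g x m -> g x <> 0 ->
  is_derive (fun y => f y / g y) x (l / g x - f x * m / (g x) ^ 2).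
Proof.
  intros Hf Hg Hn. eapply is_derive_eq;
    [exact (is_derive_Rmult f (fun y => / g y) x _ _ Hf (is_derive_inv g x m Hg Hn))|].
  cbv beta. field. auto.
Qed.

Lemma log_hermR_derive (c : R) z u : Defs.ball n z -> supported n u ->
  dir_deriv (fun w => c * ln (hermR N e (P w))) z u (c * (2 * fst (herm N e (dP u z) (P z)) / hermR N e (P z))).
Proof.
  intros Hz Hu. apply dir_deriv_iff. pose proof (hermR_derive z u Hz Hu) as D.
  eapply is_derive_eq. apply is_derive_Rmult. apply (is_derive_const (K := R_AbsRing) (V := R_NormedModule)).
  apply (is_derive_comp ln). apply is_derive_ln. rewrite line_0. apply Hpos; auto. exact D.
  unfold scal, zero; simpl. unfold mult; simpl. rewrite line_0. field. apply Rgt_not_eq, Hpos; auto.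
Qed.

(** With complex multiples [d], [d'] of the coordinate directions, one computation serves all four
    derivatives in x and y. [S] collects the holomorphic second derivatives of the lift. *)
Lemma D2_log_hermR (c : R) z i j : Defs.ball n z -> (i < n)%nat -> (j < n)%nat -> exists S : C, forall d d' : C,
  D2 n (fun w => c * ln (hermR N e (P w))) (cscale d (ex i)) (cscale d' (ex j)) z
   (c * (2 * fst (d * (d' * S + Cconj d' * herm N e (dP (ex i) z) (dP (ex j) z)))%C / hermR N e (P z) -
      2 * fst (d * herm N e (dP (ex i) z) (P z))%C * (2 * fst (d' * herm N e (dP (ex j) z) (P z))%C) / hermR N e (P z) ^ 2)).
Proof.
  intros Hz Hi Hj. pose proof (supported_ex n i Hi) as Si. pose proof (supported_ex n j Hj) as Sj.
  (* The second derivatives of the components exist by [dd_differentiable]; their values need not be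
     known. *)
  set (l := fun a => epsilon (inhabits (RtoC 0)) (fun l => cderiv (fun t => dd n (Phi a) (ex i) (line z (ex j) t)) 0%C l)).
  assert (Hl : forall a, (a < N)%nat -> cderiv (fun t => dd n (Phi a) (ex i) (line z (ex j) t)) 0%C (l a)).
  { intros a Ha. unfold l. apply epsilon_spec. apply dd_differentiable; auto. }
  exists (herm N e l (P z)). intros d d'.
  set (u := cscale d (ex i)). set (v := cscale d' (ex j)).
  assert (Su : supported n u) by (apply supported_cscale; auto). assert (Sv : supported n v) by (apply supported_cscale; auto).
  exists (fun w => c * (2 * fst (herm N e (dP u w) (P w)) / hermR N e (P w))).
  destruct (ball_near n z Hz) as [delta [Hd Hb]]. exists delta. split; auto. split.
  - intros w Hw Hn. apply log_hermR_derive; auto. rewrite <- (vadd_vsub z w). apply Hb; auto. apply supported_vsub; auto. apply Hz.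
  - apply dir_deriv_iff.
    assert (D : rderiv (fun x : R => herm N e (dP u (line z v x)) (P (line z v x))) 0
      (herm N e (fun a => d * d' * l a)%C (P (line z v 0%R)) + herm N e (dP u (line z v 0%R)) (dP v z))%C).
    { apply (rderiv_herm N e (fun x : R => dP u (line z v x)) (fun x : R => P (line z v x))); intros a Ha.
      - unfold dP, u, v. apply (rderiv_ext (fun y : R => d * dd n (Phi a) (ex i) (line z (ex j) (d' * y)))%C).
        { intros y. rewrite dd_cscale, line_cscale. auto. }
        eapply rderiv_eq. apply rderiv_mult. apply rderiv_const.
        apply (cderiv_rderiv (fun t => dd n (Phi a) (ex i) (line z (ex j) t)) (fun y : R => d' * y)%C).
        replace (d' * 0%R)%C with (RtoC 0) by cring. apply Hl; auto.
        apply rderiv_mult. apply rderiv_const. apply rderiv_id. cring.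
      - apply (rderiv_line_R (Phi a)), bholo_dd; auto. }
    rewrite !line_0 in D. destruct D as [D _].
    pose proof (hermR_derive z v Hz Sv) as D0.
    assert (Hn : hermR N e (P (line z v 0%R)) <> 0). { rewrite line_0. apply Rgt_not_eq, Hpos; auto. }
    assert (D2' : is_derive (fun x : R => 2 * fst (herm N e (dP u (line z v x)) (P (line z v x)))) 0
       (2 * fst (herm N e (fun a => d * d' * l a)%C (P z) + herm N e (dP u z) (dP v z))%C)).
    { eapply is_derive_eq. apply is_derive_Rmult. apply (is_derive_const (K := R_AbsRing) (V := R_NormedModule)). exact D.
      unfold zero; simpl; ring. }
    pose proof (is_derive_quotient _ _ _ _ _ D2' D0 Hn) as D3. cbv beta in D3. rewrite !line_0 in D3.
    eapply is_derive_eq. apply is_derive_Rmult. apply (is_derive_const (K := R_AbsRing) (V := R_NormedModule)). exact D3.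
    assert (E1 : herm N e (dP u z) (P z) = (d * herm N e (dP (ex i) z) (P z))%C).
    { rewrite <- herm_scal_l. apply herm_ext; auto. intros. unfold dP, u. apply dd_cscale. }
    assert (E2 : herm N e (dP v z) (P z) = (d' * herm N e (dP (ex j) z) (P z))%C).
    { rewrite <- herm_scal_l. apply herm_ext; auto. intros. unfold dP, v. apply dd_cscale. }
    assert (E3 : herm N e (dP u z) (dP v z) = (d * Cconj d' * herm N e (dP (ex i) z) (dP (ex j) z))%C).
    { rewrite <- Cmult_assoc, <- herm_scal_r, <- herm_scal_l. apply herm_ext; intros; apply dd_cscale. }
    rewrite herm_scal_l, E1, E2, E3. unfold zero; simpl AbelianMonoid.zero.
    replace (d * d' * herm N e l (P z) + d * Cconj d' * herm N e (dP (ex i) z) (dP (ex j) z))%C with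
      (d * (d' * herm N e l (P z) + Cconj d' * herm N e (dP (ex i) z) (dP (ex j) z)))%C by cring.
    rewrite Rmult_0_l, Rplus_0_l. reflexivity.
Qed.

(** The usual formula for the mixed derivative of log K. The term [S] cancels in the combinations xx
    + yy and xy - yx. *)
Theorem levi_log_hermR (c : R) z i j : Defs.ball n z -> (i < n)%nat -> (j < n)%nat ->
  levi n (fun w => c * ln (hermR N e (fun a => Phi a w))) z i j
   (c * ((herm N e (dP (ex i) z) (dP (ex j) z) * herm N e (P z) (P z) -
          herm N e (dP (ex i) z) (P z) * herm N e (P z) (dP (ex j) z)) / (herm N e (P z) (P z) * herm N e (P z) (P z))))%C.
Proof.
  intros Hz Hi Hj. destruct (D2_log_hermR c z i j Hz Hi Hj) as [S HS].
  pose proof (Hpos z Hz) as Hk. fold (P z) in Hk.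
  rewrite <- (herm_conj N e (dP (ex j) z) (P z)), (herm_diag N e (P z)).
  set (k := hermR N e (P z)) in *. set (K11 := herm N e (dP (ex i) z) (dP (ex j) z)) in *.
  set (K1 := herm N e (dP (ex i) z) (P z)) in *. set (K2 := herm N e (dP (ex j) z) (P z)) in *.
  do 4 eexists. split; [rewrite (ex_cscale i), (ex_cscale j); apply HS|].
  split; [rewrite (ey_cscale i), (ey_cscale j); apply HS|].
  split; [rewrite (ex_cscale i), (ey_cscale j); apply HS|].
  split; [rewrite (ey_cscale i), (ex_cscale j); apply HS|].
  destruct S as [S1 S2], K11 as [x1 x2], K1 as [y1 y2], K2 as [w1 w2].
  replace (RtoC k * RtoC k)%C with (RtoC (k * k)) by (rewrite RtoC_mult; auto).
  apply injective_projections; simpl; field; nra.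
Qed.

End LogHerm.

(** * The kernel of an isometry *)

(** Homogeneous coordinates in which [typeIV_q] is a Hermitian form of signature [(2, m)]. *)
Definition lift (m : nat) (Z : vec) (a : nat) : C :=
  if Nat.ltb a m then Z a else if Nat.eqb a m then RtoC 1 else (zzt m Z / 2)%C.
Definition sgnIV (m a : nat) : R := if Nat.ltb a m then -1 else 1.

Lemma lift_lt m Z a : (a < m)%nat -> lift m Z a = Z a.
Proof. intros H. unfold lift. apply Nat.ltb_lt in H. rewrite H. auto. Qed.

Lemma lift_one m Z : lift m Z m = RtoC 1.
Proof. unfold lift. rewrite Nat.ltb_irrefl, Nat.eqb_refl. auto. Qed.

Lemma lift_zzt m Z : lift m Z (S m) = (zzt m Z / 2)%C.
Proof.
  unfold lift. destruct (Nat.ltb_spec (S m) m); [lia|]. destruct (Nat.eqb_spec (S m) m); [lia|]. auto.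
Qed.

Lemma sgnIV_lt m a : (a < m)%nat -> sgnIV m a = -1.
Proof. intros H. unfold sgnIV. apply Nat.ltb_lt in H. rewrite H. auto. Qed.

Lemma sgnIV_ge m a : (m <= a)%nat -> sgnIV m a = 1.
Proof. intros H. unfold sgnIV. destruct (Nat.ltb_spec a m); auto; lia. Qed.

Lemma sumR_opp n (f : nat -> R) : sumR n (fun k => - f k) = - sumR n f.
Proof. induction n; simpl; [ring|]. rewrite IHn. ring. Qed.

Lemma typeIV_q_hermR m Z : typeIV_q m Z = hermR (S (S m)) (sgnIV m) (lift m Z).
Proof.
  unfold hermR. simpl sumR.
  rewrite (sumR_ext m _ (fun k => - Cnorm2 (Z k))).
  2:{ intros k Hk. rewrite sgnIV_lt, lift_lt; auto. ring. }
  rewrite sumR_opp, !sgnIV_ge, lift_one, lift_zzt by lia.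
  unfold typeIV_q, sqnorm. unfold Cdiv. rewrite !Cnorm2_Cmod, Cmod_mult, Cmod_inv, !Cmod_R.
  2:{ apply RtoC_neq; lra. } rewrite !Rabs_right by lra. field.
Qed.

Lemma DIV_coord m Z k : DIV m Z -> Cmod (Z k)%C <= 2.
Proof.
  intros (Hs & Hn & _). destruct (Nat.lt_ge_cases k m) as [L|L].
  - eapply Rle_trans; [apply (Cmod_le_normn m Z k L)|]. rewrite <- normn_sq in Hn. pose proof (normn_nonneg m Z). nra.
  - rewrite (Hs k L). change (Cmod 0 <= 2). rewrite Cmod_0. lra.
Qed.

Lemma Cmod_zzt m Z : Cmod (zzt m Z)%C <= sqnorm m Z.
Proof.
  unfold zzt, sqnorm. induction m.
  - change (Cmod 0 <= 0). rewrite Cmod_0. lra.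
  - rewrite sumC_S. simpl sumR. eapply Rle_trans; [apply Cmod_triangle|]. change (Cmul (Z m) (Z m)) with (Z m * Z m)%C.
    rewrite Cmod_mult, Cnorm2_Cmod. simpl. lra.
Qed.

Lemma bholo_lift n m F a : holomorphic n m (Defs.ball n) F -> (forall z, Defs.ball n z -> DIV m (F z)) ->
  bholo n (fun z => lift m (F z) a).
Proof.
  intros HF HD.
  assert (Hk : forall k, (k < m)%nat -> bholo n (fun z => F z k)).
  { intros k Hk. split.
    - intros z Hz. apply holo_at_is_grad. apply HF; auto.
    - exists 2. split; [lra|]. intros z Hz. apply (DIV_coord m). auto. }
  destruct (Nat.lt_ge_cases a m) as [L|L].
  - eapply bholo_eq_on_ball; [apply (Hk a L)|]. intros; simpl. rewrite lift_lt; auto.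
  - destruct (Nat.eq_dec a m) as [->|Hn].
    + eapply bholo_eq_on_ball; [apply (bholo_const n 1%C)|]. intros; simpl. rewrite lift_one; auto.
    + assert (Q : bholo n (fun z => (/ 2) * sumC m (fun k => (F z k * F z k)%C))%C).
      { apply bholo_mult; [apply bholo_const|]. apply (bholo_sumC n m (fun k z => (F z k * F z k)%C)).
        intros k Hk'. apply bholo_mult; apply Hk; auto. }
      eapply bholo_eq_on_ball; [exact Q|]. intros z. unfold lift.
      destruct (Nat.ltb_spec a m); [lia|]. destruct (Nat.eqb_spec a m); [lia|]. unfold Cdiv. rewrite Cmult_comm. reflexivity.
Qed.

Definition kdelta (i j : nat) : C := if Nat.eqb i j then RtoC 1 else RtoC 0.

Lemma dd_coord n i k z : (i < n)%nat -> Defs.ball n z -> dd n (fun w => w k) (ex i) z = kdelta i k.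
Proof.
  intros Hi Hz. eapply cderiv_unique.
  - apply bholo_dd; [apply bholo_coord|auto|apply supported_ex; auto].
  - unfold line, vadd, cscale. eapply cderiv_eq.
    + apply cderiv_plus. apply cderiv_const. apply cderiv_mult. apply cderiv_id. apply cderiv_const.
    + unfold ex, kdelta. cbv beta. rewrite Nat.eqb_sym. destruct (Nat.eqb i k).
      * change (0 + (1 * 1 + 0%C * 0) = 1)%C. cring.
      * change (0 + (1 * 0 + 0%C * 0) = 0)%C. cring.
Qed.

Lemma dd_const n v c z : supported n v -> Defs.ball n z -> dd n (fun _ => c) v z = RtoC 0.
Proof.
  intros Hv Hz. eapply cderiv_unique.
  - apply (bholo_dd n (fun _ => c)); [apply bholo_const|auto|auto].
  - apply cderiv_const.
Qed.

(** Homogeneous coordinates of the ball: with the weights [sgnIV n] on n + 1 coordinates the form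
    has a single positive direction and equals 1 - |z|^2, so that [levi_log_hermR] serves both
    domains. *)
Definition liftB (n : nat) (z : vec) (a : nat) : C := if Nat.ltb a n then z a else RtoC 1.

Lemma liftB_lt n z a : (a < n)%nat -> liftB n z a = z a.
Proof. intros H. unfold liftB. apply Nat.ltb_lt in H. rewrite H. auto. Qed.

Lemma liftB_one n z : liftB n z n = RtoC 1.
Proof. unfold liftB. rewrite Nat.ltb_irrefl. auto. Qed.

Lemma liftB_fun_lt n a : (a < n)%nat -> (fun z => liftB n z a) = (fun z => z a).
Proof. intros H. apply functional_extensionality. intros. apply liftB_lt; auto. Qed.

Lemma liftB_fun_one n : (fun z => liftB n z n) = (fun z => RtoC 1).
Proof. apply functional_extensionality. intros. apply liftB_one; auto. Qed.

Lemma bholo_liftB n a : bholo n (fun z => liftB n z a).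
Proof.
  destruct (Nat.lt_ge_cases a n) as [L|L].
  - rewrite liftB_fun_lt by auto. apply bholo_coord.
  - eapply bholo_eq_on_ball; [apply (bholo_const n 1%C)|]. intros. unfold liftB. destruct (Nat.ltb_spec a n); [lia|auto].
Qed.

Definition cprod (n : nat) (z w : vec) : C := sumC n (fun k => (z k * Cconj (w k)%C)%C).

Lemma cprod_diag n z : cprod n z z = RtoC (sqnorm n z).
Proof.
  unfold cprod, sqnorm. induction n; [reflexivity|]. rewrite sumC_S, IHn. simpl sumR. rewrite RtoC_plus. f_equal.
  unfold Cnorm2. apply injective_projections; simpl; ring.
Qed.

Lemma herm_liftB n (A B : nat -> C) : herm (S n) (sgnIV n) A B = (A n * Cconj (B n)%C - sumC n (fun a => (A a * Cconj (B a)%C)%C))%C.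
Proof.
  unfold herm. rewrite !sumC_S, !sgnIV_ge by lia.
  rewrite (sumC_ext n _ (fun k => (-(1)) * (A k * Cconj (B k)%C))%C).
  - rewrite sumC_scal. cring.
  - intros k Hk. rewrite sgnIV_lt by auto. replace (RtoC (-1)) with (- (1))%C by (apply injective_projections; simpl; ring). cring.
Qed.

Lemma liftB_diag n z : herm (S n) (sgnIV n) (liftB n z) (liftB n z) = (1 - cprod n z z)%C.
Proof.
  rewrite herm_liftB, liftB_one. unfold cprod.
  rewrite (sumC_ext n _ (fun k => (z k * Cconj (z k)%C)%C)).
  - replace (Cconj 1) with (RtoC 1) by (apply injective_projections; simpl; ring). cring.
  - intros. rewrite liftB_lt; auto.
Qed.

Lemma Cconj_RtoC (x : R) : Cconj x = RtoC x.
Proof. apply injective_projections; simpl; ring. Qed.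

Lemma kdelta_sum_l n i (f : nat -> C) : (i < n)%nat -> sumC n (fun a => (kdelta i a * f a)%C) = f i.
Proof.
  intros Hi. rewrite (sumC_single n i); auto.
  - unfold kdelta. rewrite Nat.eqb_refl. cring.
  - intros k _ Hk. unfold kdelta. destruct (Nat.eqb_spec i k); [congruence|]. cring.
Qed.

Lemma levi_ball n z i j : Defs.ball n z -> (i < n)%nat -> (j < n)%nat ->
  levi n (logK_ball n) z i j (RtoC (- INR (n + 1)) * (- (kdelta i j * (1 - cprod n z z) + Cconj (z i)%C * z j) / ((1 - cprod n z z) * (1 - cprod n z z))))%C.
Proof.
  intros Hz Hi Hj.
  assert (Hval : forall w, hermR (S n) (sgnIV n) (fun a => liftB n w a) = 1 - sqnorm n w).
  { intros w. pose proof (liftB_diag n w) as Q. rewrite herm_diag, cprod_diag in Q. injection Q. intros _ E1.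
    change (fun a => liftB n w a) with (liftB n w). rewrite E1. ring. }
  assert (L := levi_log_hermR n (S n) (sgnIV n) (fun a z => liftB n z a) (fun a _ => bholo_liftB n a)).
  cbv beta in L. specialize (L ltac:(intros w Hw; rewrite Hval; destruct Hw; lra) (- INR (n + 1)) z i j Hz Hi Hj).
  assert (Ed : forall i a, (i < n)%nat -> (a < n)%nat -> dd n (fun z => liftB n z a) (ex i) z = kdelta i a).
  { intros i' a Hi' Ha. rewrite liftB_fun_lt by auto. apply dd_coord; auto. }
  assert (Ed1 : forall i, (i < n)%nat -> dd n (fun z => liftB n z n) (ex i) z = RtoC 0).
  { intros i' Hi'. rewrite liftB_fun_one. apply dd_const; auto. apply supported_ex; auto. }
  change (fun a => liftB n z a) with (liftB n z) in L. rewrite !liftB_diag in L.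
  rewrite !(herm_liftB n (fun a => dd n (fun z => liftB n z a) (ex i) z)) in L.
  rewrite !(herm_liftB n (liftB n z)) in L. rewrite !Ed1, !liftB_one in L by auto.
  rewrite (sumC_ext n _ (fun a => (kdelta i a * kdelta j a)%C)) in L.
  2:{ intros a Ha. rewrite !Ed by auto. f_equal. unfold kdelta. destruct (Nat.eqb j a); apply Cconj_RtoC. }
  rewrite (sumC_ext n (fun a => (dd n (fun z => liftB n z a) (ex i) z * Cconj (liftB n z a)%C)%C) (fun a => (kdelta i a * Cconj (z a)%C)%C)) in L.
  2:{ intros a Ha. rewrite !Ed, liftB_lt by auto. auto. }
  rewrite (sumC_ext n (fun a => (liftB n z a * Cconj (dd n (fun z => liftB n z a) (ex j) z)%C)%C) (fun a => (kdelta j a * z a)%C)) in L.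
  2:{ intros a Ha. rewrite !Ed, liftB_lt by auto. rewrite Cmult_comm. f_equal. unfold kdelta. destruct (Nat.eqb j a); apply Cconj_RtoC. }
  rewrite !kdelta_sum_l in L by auto. rewrite (Cconj_RtoC 0) in L.
  replace (kdelta j i) with (kdelta i j) in L by (unfold kdelta; rewrite Nat.eqb_sym; auto).
  eapply levi_ext; [exact Hz|exact Hi| |].
  2:{ match goal with |- levi _ _ _ _ _ ?X => match type of L with levi _ _ _ _ _ ?Y => replace X with Y; [exact L|] end end.
      rewrite cprod_diag, <- RtoC_minus. field. apply RtoC_neq. destruct Hz; lra. }
  intros w Hw. unfold logK_ball. rewrite Hval. auto.
Qed.

(** The equation between the mixed derivatives of log K and of mu times log (1 - z.w), taken off the
    diagonal and multiplied by K^2 (1 - z.w)^2. Clearing the denominators is what puts it in the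
    class [sesq]. *)
Definition Xij (n m : nat) (F : vec -> vec) (mu : R) (i j : nat) (z w : vec) : C :=
  let P := fun z a => lift m (F z) a in
  let dP := fun u z a => dd n (fun z => lift m (F z) a) u z in
  let h := herm (S (S m)) (sgnIV m) in
  ((h (dP (ex i) z) (dP (ex j) w) * h (P z) (P w) - h (dP (ex i) z) (P w) * h (P z) (dP (ex j) w)) *
     ((1 - cprod n z w) * (1 - cprod n z w)) +
   mu * ((kdelta i j * (1 - cprod n z w) + Cconj (w i)%C * z j) * (h (P z) (P w) * h (P z) (P w))))%C.

Lemma typeIV_q_pos m Z : DIV m Z -> 0 < hermR (S (S m)) (sgnIV m) (lift m Z).
Proof. intros (_ & _ & H). rewrite <- typeIV_q_hermR. lra. Qed.

Lemma isometry_diagonal n m F : (0 < m)%nat -> holo_isometry_ball_IV n m F -> exists mu : R, 0 < mu /\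
  forall z i j, Defs.ball n z -> (i < n)%nat -> (j < n)%nat -> Xij n m F mu i j z z = 0%C.
Proof.
  intros Hm (HF & HD & lambda & Hl & HL).
  assert (Pm : 0 < INR m) by (apply lt_0_INR; auto). assert (Pn : 0 < INR (n + 1)) by (apply lt_0_INR; lia).
  (* The Bergman kernels are the powers [- (n + 1)] and [- m] of the two forms, which turns [lambda]
     into this ratio. *)
  exists (lambda * INR (n + 1) / INR m). split. { apply Rdiv_lt_0_compat; auto. apply Rmult_lt_0_compat; auto. }
  intros z i j Hz Hi Hj. destruct (HL z Hz i j Hi Hj) as (c1 & c2 & L1 & L2 & E1).
  assert (L := levi_log_hermR n (S (S m)) (sgnIV m) (fun a z => lift m (F z) a) (fun a _ => bholo_lift n m F a HF HD)
    (fun z Hz => typeIV_q_pos m (F z) (HD z Hz)) (- INR m) z i j Hz Hi Hj).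
  cbv beta in L.
  assert (L' : levi n (fun w => - INR m * ln (hermR (S (S m)) (sgnIV m) (fun a => lift m (F w) a))) z i j c1).
  { eapply levi_ext; [exact Hz|exact Hi| |exact L1]. intros w Hw. unfold logK_IV. rewrite typeIV_q_hermR. auto. }
  pose proof (levi_unique _ _ _ _ _ _ _ Hz Hi Hj L' L) as Ec1.
  pose proof (levi_unique _ _ _ _ _ _ _ Hz Hi Hj L2 (levi_ball n z i j Hz Hi Hj)) as Ec2.
  assert (E2 : c1 = (RtoC lambda * c2)%C). { rewrite E1. apply injective_projections; simpl; ring. }
  rewrite Ec1, Ec2 in E2. unfold Xij.
  assert (NK : herm (S (S m)) (sgnIV m) (fun a => lift m (F z) a) (fun a => lift m (F z) a) <> RtoC 0).
  { rewrite herm_diag. apply RtoC_neq. apply Rgt_not_eq. apply typeIV_q_pos; auto. }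
  assert (ND : (1 - cprod n z z)%C <> RtoC 0).
  { rewrite cprod_diag, <- RtoC_minus. apply RtoC_neq. destruct Hz; lra. }
  set (h := herm (S (S m)) (sgnIV m)) in *.
  set (K := h (fun a => lift m (F z) a) (fun a => lift m (F z) a)) in *.
  set (K11 := h (fun a => dd n (fun z0 => lift m (F z0) a) (ex i) z) (fun a => dd n (fun z0 => lift m (F z0) a) (ex j) z)) in *.
  set (K1 := h (fun a => dd n (fun z0 => lift m (F z0) a) (ex i) z) (fun a => lift m (F z) a)) in *.
  set (K2 := h (fun a => lift m (F z) a) (fun a => dd n (fun z0 => lift m (F z0) a) (ex j) z)) in *.
  set (D := (1 - cprod n z z)%C) in *. set (T := (kdelta i j * D + Cconj (z i)%C * z j)%C) in *.
  assert (NM : RtoC (INR m) <> RtoC 0) by (apply RtoC_neq; lra).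
  assert (E3 : ((K11 * K - K1 * K2) / (K * K) = - (RtoC (lambda * INR (n + 1) / INR m)) * T / (D * D))%C).
  { transitivity (- / INR m * (RtoC (- INR m) * ((K11 * K - K1 * K2) / (K * K))))%C.
    - rewrite RtoC_opp. field. repeat split; auto.
    - rewrite E2. rewrite !RtoC_opp, RtoC_div, RtoC_mult by lra. field. repeat split; auto. }
  transitivity ((K * K * D * D) * ((K11 * K - K1 * K2) / (K * K) + RtoC (lambda * INR (n + 1) / INR m) * T / (D * D)))%C.
  - field. split; auto.
  - rewrite E3. field. auto.
Qed.

Lemma bholo_line_HolB n f p v rho : bholo n f -> supported n p -> supported n v -> normn n p + rho * normn n v < 1 ->
  HolB rho (fun t => f (line p v t)).
Proof.
  intros Hf Hp Hv H. destruct (proj2 Hf) as [M [HM0 HM]]. apply (HolB_bounded rho _ M); auto.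
  - intros t Ht. exists (dd n f v (line p v t)). apply bholo_dd_line; auto. eapply ball_line; eauto.
  - intros t Ht. apply HM. eapply ball_line; eauto.
Qed.

Lemma dd_line_HolB n f u p v rho : bholo n f -> supported n p -> supported n v -> supported n u -> normn n p + rho * normn n v < 1 ->
  HolB rho (fun t => dd n f u (line p v t)).
Proof.
  intros Hf Hp Hv Hu H. destruct (proj2 Hf) as [M [HM0 HM]].
  pose proof (normn_nonneg n u). pose proof (normn_nonneg n v).
  apply (HolB_bounded rho _ (8 * M * (normn n u + 1) / (1 - (normn n p + rho * normn n v)))).
  - intros t Ht. assert (Hb : Defs.ball n (line p v t)) by (eapply ball_line; eauto).
    destruct (dd_differentiable n f u v (line p v t) Hf Hb Hu Hv) as [l Hl]. exists l.
    intros eps He. destruct (Hl eps He) as [d [Hd K]]. exists d. split; auto. intros h Hh. specialize (K h Hh).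
    rewrite Cplus_0_l, line_0, line_line in K. exact K.
  - apply Rmult_le_pos; [|left; apply Rinv_0_lt_compat; lra]. nra.
  - intros t Ht. assert (Hb : Defs.ball n (line p v t)) by (eapply ball_line; eauto).
    eapply Rle_trans; [apply (dd_bound n f u _ M); auto|]. apply Rmult_le_compat_l; [nra|].
    apply Rinv_le_contravar; [lra|]. pose proof (normn_line n p v t). pose proof (Cmod_ge_0 t). nra.
Qed.

Lemma sesq_sumC rho N (S : nat -> C -> C -> C) : (forall a, (a < N)%nat -> sesq rho (S a)) ->
  sesq rho (fun t s => sumC N (fun a => S a t s)).
Proof.
  induction N; intros H.
  - apply (sesq_const rho 0%C).
  - apply (sesq_plus rho (fun t s => sumC N (fun a => S a t s)) (S N)); auto.
Qed.

Lemma sesq_herm rho N e (A B : nat -> C -> C) : (forall a, (a < N)%nat -> HolB rho (A a)) -> (forall a, (a < N)%nat -> HolB rho (B a)) ->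
  sesq rho (fun t s => herm N e (fun a => A a t) (fun a => B a s)).
Proof.
  intros HA HB. apply (sesq_sumC rho N (fun a t s => (e a * A a t * Cconj (B a s)%C)%C)). intros a Ha.
  apply (sesq_prod rho (fun t => e a * A a t)%C (B a)); auto. apply HolB_mult; auto. apply HolB_const.
Qed.

(** On the complex line through [z] and [w] the identity becomes one in a single variable [t] and a
    single [s], and polarization is evaluated at [t = 0], [s = 1]. *)
Theorem isometry_polarized n m F : (0 < m)%nat -> holo_isometry_ball_IV n m F -> exists mu : R, 0 < mu /\
  forall z w i j, supported n z -> supported n w -> normn n z < / 4 -> normn n w < / 4 -> (i < n)%nat -> (j < n)%nat ->
    Xij n m F mu i j z w = 0%C.
Proof.
  intros Hm HI. destruct (isometry_diagonal n m F Hm HI) as [mu [Hmu HX]]. exists mu. split; auto.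
  intros z w i j Hz Hw Nz Nw Hi Hj. destruct HI as (HF & HD & _).
  set (v := vsub w z). assert (Hv : supported n v) by (apply supported_vsub; auto).
  assert (Nv : normn n v <= normn n w + normn n z).
  { replace v with (vadd w (cscale (-(1))%C z)).
    - eapply Rle_trans; [apply normn_vadd|]. rewrite normn_cscale, Cmod_opp, Cmod_R, Rabs_right; lra.
    - apply functional_extensionality; intros k. unfold v, vadd, vsub, cscale.
      change (w k + (-(1)) * z k = w k - z k)%C. cring. }
  pose proof (normn_nonneg n v).
  (* The disc must contain the parameter 1 of the point [w]. Radius 3/2 fits in the ball because 1/4
     + 3/2 * (1/4 + 1/4) = 1. *)
  assert (Hr : normn n z + 3 / 2 * normn n v < 1) by lra.
  assert (B : forall a, bholo n (fun z => lift m (F z) a)) by (intros; apply bholo_lift; auto).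
  assert (HP : forall a, HolB (3 / 2) (fun t => lift m (F (line z v t)) a)).
  { intros a. apply (bholo_line_HolB n (fun z => lift m (F z) a)); auto. }
  assert (HdP : forall k a, (k < n)%nat -> HolB (3 / 2) (fun t => dd n (fun z => lift m (F z) a) (ex k) (line z v t))).
  { intros k a Hk. apply dd_line_HolB; auto. apply supported_ex; auto. }
  assert (Hc : forall k, HolB (3 / 2) (fun t => line z v t k)).
  { intros k. apply (bholo_line_HolB n (fun z => z k)); auto. apply bholo_coord. }
  assert (SD : sesq (3 / 2) (fun t s => 1 - cprod n (line z v t) (line z v s))%C).
  { apply sesq_minus. apply sesq_const. apply (sesq_sumC _ n (fun k t s => (line z v t k * Cconj (line z v s k)%C)%C)).
    intros k _. apply (sesq_prod _ (fun t => line z v t k) (fun t => line z v t k)); auto. }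
  assert (SK : forall N e (A B : nat -> C -> C), (forall a, HolB (3 / 2) (A a)) -> (forall a, HolB (3 / 2) (B a)) ->
     sesq (3 / 2) (fun t s => herm N e (fun a => A a t) (fun a => B a s))).
  { intros. apply sesq_herm; auto. }
  assert (S : sesq (3 / 2) (fun t s => Xij n m F mu i j (line z v t) (line z v s))).
  { unfold Xij. cbv zeta.
    pose proof (SK (S (S m)) (sgnIV m) _ _ (fun a => HdP i a Hi) (fun a => HdP j a Hj)) as S11.
    pose proof (SK (S (S m)) (sgnIV m) _ _ (fun a => HdP i a Hi) HP) as S1.
    pose proof (SK (S (S m)) (sgnIV m) _ _ HP (fun a => HdP j a Hj)) as S2.
    pose proof (SK (S (S m)) (sgnIV m) _ _ HP HP) as S0.
    apply sesq_plus.
    - apply sesq_mult; [apply sesq_minus; apply sesq_mult; auto|apply sesq_mult; auto].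
    - apply sesq_mult; [apply sesq_const|]. apply sesq_mult; [|apply sesq_mult; auto].
      apply sesq_plus; [apply sesq_mult; auto; apply sesq_const|].
      eapply sesq_ext; [|apply (sesq_prod _ (fun t => line z v t j) (fun t => line z v t i)); auto].
      intros; cbv beta. cring. }
  assert (Z := polarization (3 / 2) _ ltac:(lra) S).
  assert (Z' := Z (fun t Ht => HX _ i j (ball_line n z v (3 / 2) t Hz Hv Hr Ht) Hi Hj) 0%C 1%C
     ltac:(rewrite Cmod_0; lra) ltac:(rewrite Cmod_1; lra)).
  cbv beta in Z'. rewrite line_0 in Z'.
  replace (line z v 1%C) with w in Z'; auto.
  unfold line. replace (cscale 1%C v) with v. unfold v. rewrite vadd_vsub. auto.
  apply functional_extensionality; intros k. unfold cscale. cring.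
Qed.

(** * Integration of the polarized identity along segments *)

(** Contraction of an n by n array with [z] and the conjugate of [w]; it turns the identities
    indexed by [i], [j] into a single one for the directions [z] and [w]. *)
Definition dsum (n : nat) (z w : vec) (f : nat -> nat -> C) : C :=
  sumC n (fun i => sumC n (fun j => (z i * Cconj (w j)%C * f i j)%C)).

Lemma dsum_ext n z w f g : (forall i j, (i < n)%nat -> (j < n)%nat -> f i j = g i j) -> dsum n z w f = dsum n z w g.
Proof. intros H. apply sumC_ext. intros. apply sumC_ext. intros. rewrite H; auto. Qed.

Lemma dsum_plus n z w f g : dsum n z w (fun i j => f i j + g i j)%C = (dsum n z w f + dsum n z w g)%C.
Proof.
  unfold dsum. rewrite <- sumC_plus. apply sumC_ext. intros. rewrite <- sumC_plus. apply sumC_ext. intros. cring.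
Qed.

Lemma dsum_scal n z w c f : dsum n z w (fun i j => c * f i j)%C = (c * dsum n z w f)%C.
Proof.
  unfold dsum. rewrite <- sumC_scal. apply sumC_ext. intros. rewrite <- sumC_scal. apply sumC_ext. intros. cring.
Qed.

Lemma dsum_prod n z w a b : dsum n z w (fun i j => a i * b j)%C =
  (sumC n (fun i => (z i * a i)%C) * sumC n (fun j => (Cconj (w j)%C * b j)%C))%C.
Proof.
  unfold dsum. rewrite Cmult_comm, <- sumC_scal. apply sumC_ext. intros. rewrite Cmult_comm, <- sumC_scal.
  apply sumC_ext. intros. cring.
Qed.

Lemma dsum_zero n z w f : (forall i j, (i < n)%nat -> (j < n)%nat -> f i j = RtoC 0) -> dsum n z w f = RtoC 0.
Proof. intros H. apply sumC_zero. intros. apply sumC_zero. intros. rewrite H; auto. cring. Qed.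

Lemma dsum_kdelta n z w : dsum n z w kdelta = cprod n z w.
Proof.
  apply sumC_ext. intros i Hi. rewrite (sumC_single n i); auto.
  - unfold kdelta. rewrite Nat.eqb_refl. cring.
  - intros j _ Hj. unfold kdelta. destruct (Nat.eqb_spec i j); [congruence|]. cring.
Qed.

Lemma dd_expand n f v x : dd n f v x = sumC n (fun i => (v i * dd n f (ex i) x)%C).
Proof.
  unfold dd at 1, cdot. apply sumC_ext. intros i Hi. unfold dd, cdot. rewrite (sumC_single n i); auto.
  - unfold ex. rewrite Nat.eqb_refl. change (grad n f x i * v i = v i * (grad n f x i * 1))%C. cring.
  - intros j _ Hj. unfold ex. destruct (Nat.eqb_spec j i); [congruence|]. change (grad n f x j * 0 = 0)%C. cring.
Qed.

Lemma herm_sum_l N e n (c : nat -> C) (A : nat -> nat -> C) B :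
  herm N e (fun a => sumC n (fun i => (c i * A i a)%C)) B = sumC n (fun i => (c i * herm N e (A i) B)%C).
Proof.
  unfold herm. rewrite (sumC_ext n _ (fun i => sumC N (fun a => (c i * (e a * A i a * Cconj (B a)%C))%C))).
  - rewrite <- sumC_swap. apply sumC_ext. intros a _.
    transitivity ((e a * Cconj (B a)%C) * sumC n (fun i => (c i * A i a)%C))%C; [cring|].
    rewrite <- sumC_scal. apply sumC_ext. intros. cring.
  - intros. rewrite sumC_scal. auto.
Qed.

Lemma herm_sum_r N e n (c : nat -> C) (B : nat -> nat -> C) A :
  herm N e A (fun a => sumC n (fun i => (c i * B i a)%C)) = sumC n (fun i => (Cconj (c i)%C * herm N e A (B i))%C).
Proof.
  rewrite <- herm_conj, herm_sum_l, sumC_conj. apply sumC_ext. intros. rewrite Cmult_conj, herm_conj. auto.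
Qed.

Lemma rderiv_herm_l N e (A : R -> nat -> C) A' B x :
  (forall a, (a < N)%nat -> rderiv (fun y => A y a) x (A' a)) -> rderiv (fun y => herm N e (A y) B) x (herm N e A' B).
Proof.
  intros H. eapply rderiv_eq. apply (rderiv_herm N e A (fun _ => B) A' (fun _ => RtoC 0)); auto.
  - intros. apply rderiv_const.
  - assert (Z : herm N e (A x) (fun _ => RtoC 0) = RtoC 0). { apply sumC_zero. intros. rewrite Cconj_RtoC. cring. }
    rewrite Z. cring.
Qed.

Lemma rderiv_herm_r N e (B : R -> nat -> C) B' A x :
  (forall a, (a < N)%nat -> rderiv (fun y => B y a) x (B' a)) -> rderiv (fun y => herm N e A (B y)) x (herm N e A B').
Proof.
  intros H. eapply rderiv_eq. apply (rderiv_herm N e (fun _ => A) B (fun _ => RtoC 0) B'); auto.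
  - intros. apply rderiv_const.
  - assert (Z : herm N e (fun _ => RtoC 0) (B x) = RtoC 0). { apply sumC_zero. intros. cring. }
    rewrite Z. cring.
Qed.

Lemma cprod_line n z w (s t : R) : cprod n (line vzero z s) (line vzero w t) = (RtoC (s * t) * cprod n z w)%C.
Proof.
  unfold cprod. rewrite <- sumC_scal. apply sumC_ext. intros k _. unfold line, vadd, cscale, vzero.
  change ((0 + s * z k) * Cconj (0 + t * w k)%C = RtoC (s * t) * (z k * Cconj (w k)%C))%C.
  rewrite Cplus_conj, Cmult_conj, !Cconj_RtoC, RtoC_mult. cring.
Qed.

Lemma Cmod_cprod n z w : Cmod (cprod n z w)%C <= (sqnorm n z + sqnorm n w) / 2.
Proof.
  unfold cprod, sqnorm. induction n.
  - change (Cmod 0 <= (0 + 0) / 2). rewrite Cmod_0. lra.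
  - rewrite sumC_S. simpl sumR. eapply Rle_trans; [apply Cmod_triangle|]. rewrite Cmod_mult, Cmod_conj, !Cnorm2_Cmod.
    pose proof (pow2_ge_0 (Cmod (z n)%C - Cmod (w n)%C)). simpl in *. lra.
Qed.

Definition kernIV (m : nat) (F : vec -> vec) (z w : vec) : C :=
  herm (S (S m)) (sgnIV m) (lift m (F z)) (lift m (F w)).

(** Where K does not vanish, this says that log K - mu log (1 - z.w) has no mixed derivatives, hence
    is locally a function of [z] plus a function of the conjugate of [w]. *)
Definition flat (n m : nat) (F : vec -> vec) (mu : R) : Prop :=
  forall z w i j, supported n z -> supported n w -> normn n z < / 4 -> normn n w < / 4 -> (i < n)%nat -> (j < n)%nat ->
    Xij n m F mu i j z w = RtoC 0.

Section Segment.

Variables (n m : nat) (F : vec -> vec) (mu : R).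
Hypothesis HB : forall a, bholo n (fun z => lift m (F z) a).
Hypothesis HX : flat n m F mu.
Variables (z w : vec).
Hypothesis (Hz : supported n z) (Hw : supported n w) (Nz : normn n z < / 4) (Nw : normn n w < / 4).
Hypothesis Hnz : forall s t : R, 0 <= s <= 1 -> 0 <= t <= 1 -> kernIV m F (line vzero z s) (line vzero w t) <> RtoC 0.

Let P (x : vec) : nat -> C := fun a => lift m (F x) a.
Let dP (u x : vec) : nat -> C := fun a => dd n (fun z => lift m (F z) a) u x.
Let h := herm (S (S m)) (sgnIV m).
Let zs (s : R) := line vzero z s.
Let wt (t : R) := line vzero w t.
Let om := cprod n z w.

Lemma segment_norm v (s : R) : supported n v -> normn n v < / 4 -> 0 <= s <= 1 -> supported n (line vzero v s) /\ normn n (line vzero v s) < / 4.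
Proof.
  intros Hv Nv Hs. split; [apply supported_line; auto; apply supported_vzero|].
  eapply Rle_lt_trans; [apply normn_line|]. rewrite Cmod_R, Rabs_right by lra.
  assert (E0 : normn n vzero = 0).
  { replace vzero with (cscale 0%C vzero). rewrite normn_cscale, Cmod_0. ring.
    apply functional_extensionality; intros k. unfold cscale, vzero. cring. }
  rewrite E0. pose proof (normn_nonneg n v). nra.
Qed.

Lemma segment_identity (s t : R) : 0 <= s <= 1 -> 0 <= t <= 1 ->
  ((h (dP z (zs s)) (dP w (wt t)) * h (P (zs s)) (P (wt t)) - h (dP z (zs s)) (P (wt t)) * h (P (zs s)) (dP w (wt t))) *
    ((1 - RtoC (s * t) * om) * (1 - RtoC (s * t) * om)) + mu * om * (h (P (zs s)) (P (wt t)) * h (P (zs s)) (P (wt t))))%C = RtoC 0.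
Proof.
  intros Hs Ht. destruct (segment_norm z s Hz Nz Hs) as [Sz Nzs]. destruct (segment_norm w t Hw Nw Ht) as [Sw Nwt].
  assert (EdP : forall v x, dP v x = fun a => sumC n (fun i => (v i * dP (ex i) x a)%C)).
  { intros. apply functional_extensionality; intros a. unfold dP. rewrite dd_expand. auto. }
  assert (E1 : forall B, h (dP z (zs s)) B = sumC n (fun i => (z i * h (dP (ex i) (zs s)) B)%C)).
  { intros B. rewrite (EdP z). apply herm_sum_l. }
  assert (E2 : forall A, h A (dP w (wt t)) = sumC n (fun j => (Cconj (w j)%C * h A (dP (ex j) (wt t)))%C)).
  { intros A. rewrite (EdP w). apply herm_sum_r. }
  set (K := h (P (zs s)) (P (wt t))). set (D := (1 - RtoC (s * t) * om)%C).
  assert (E11 : h (dP z (zs s)) (dP w (wt t)) = dsum n z w (fun i j => h (dP (ex i) (zs s)) (dP (ex j) (wt t)))).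
  { rewrite E1. unfold dsum. apply sumC_ext. intros i _. rewrite E2, <- sumC_scal. apply sumC_ext. intros; cring. }
  assert (E12 : (h (dP z (zs s)) (P (wt t)) * h (P (zs s)) (dP w (wt t)))%C =
     dsum n z w (fun i j => h (dP (ex i) (zs s)) (P (wt t)) * h (P (zs s)) (dP (ex j) (wt t)))%C).
  { rewrite E1, E2, dsum_prod. auto. }
  assert (ET : dsum n z w (fun i j => kdelta i j * D + Cconj (wt t i)%C * zs s j)%C = om).
  { rewrite (dsum_ext n z w _ (fun i j => D * kdelta i j + RtoC (s * t) * (Cconj (w i)%C * z j))%C).
    - rewrite dsum_plus, !dsum_scal, dsum_kdelta, dsum_prod. fold om.
      assert (Q1 : sumC n (fun i => (z i * Cconj (w i)%C)%C) = om) by reflexivity.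
      assert (Q2 : sumC n (fun i => (Cconj (w i)%C * z i)%C) = om) by (apply sumC_ext; intros; cring).
      rewrite Q1, Q2. unfold D. cring.
    - intros i j _ _. unfold wt, zs, line, vadd, cscale, vzero.
      change (kdelta i j * D + Cconj (0 + t * w i)%C * (0 + s * z j) = D * kdelta i j + RtoC (s * t) * (Cconj (w i)%C * z j))%C.
      rewrite Cplus_conj, Cmult_conj, !Cconj_RtoC, RtoC_mult. cring. }
  assert (Z : dsum n z w (fun i j => Xij n m F mu i j (zs s) (wt t)) = RtoC 0).
  { apply dsum_zero. intros i j Hi Hj. apply HX; auto. }
  rewrite E11, E12. rewrite <- Z.
  rewrite (dsum_ext n z w (fun i j => Xij n m F mu i j (zs s) (wt t))
    (fun i j => (D * D * K) * h (dP (ex i) (zs s)) (dP (ex j) (wt t)) +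
       ((- (D * D)) * (h (dP (ex i) (zs s)) (P (wt t)) * h (P (zs s)) (dP (ex j) (wt t))) +
        (mu * K * K) * (kdelta i j * D + Cconj (wt t i)%C * zs s j)))%C).
  - rewrite !dsum_plus, !dsum_scal. rewrite ET. cring.
  - intros i j _ _. unfold Xij. cbv zeta. unfold zs, wt. rewrite cprod_line. fold om. fold D. fold (zs s) (wt t).
    change (herm (S (S m)) (sgnIV m)) with h. change (fun a => lift m (F (zs s)) a) with (P (zs s)).
    change (fun a => lift m (F (wt t)) a) with (P (wt t)).
    change (fun a => dd n (fun z0 => lift m (F z0) a) (ex i) (zs s)) with (dP (ex i) (zs s)).
    change (fun a => dd n (fun z0 => lift m (F z0) a) (ex j) (wt t)) with (dP (ex j) (wt t)).
    fold K. cring.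
Qed.

Lemma rderiv_P v (s : R) a : supported n v -> normn n v < / 4 -> 0 <= s <= 1 ->
  rderiv (fun s : R => P (line vzero v s) a) s (dP v (line vzero v s) a).
Proof.
  intros Hv Nv Hs. destruct (segment_norm v s Hv Nv Hs) as [S1 S2].
  eapply rderiv_eq. apply (cderiv_rderiv (fun t => lift m (F (line vzero v t)) a) (fun x : R => RtoC x)).
  - apply (bholo_dd_line n (fun z => lift m (F z) a)); auto. apply ball_normn. split; auto. lra.
  - apply rderiv_id.
  - unfold dP. cring.
Qed.

Lemma segment_denominator (s t : R) : 0 <= s <= 1 -> 0 <= t <= 1 -> (1 - RtoC (s * t) * om)%C <> RtoC 0.
Proof.
  intros Hs Ht Z. assert (B := Cmod_cprod n z w). fold om in B. rewrite <- !normn_sq in B.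
  pose proof (normn_nonneg n z). pose proof (normn_nonneg n w).
  assert (E : (RtoC (s * t) * om)%C = RtoC 1). { replace (RtoC (s * t) * om)%C with (1 - (1 - RtoC (s * t) * om))%C by cring. rewrite Z. cring. }
  apply (f_equal Cmod) in E. rewrite Cmod_mult, Cmod_R, Cmod_1, Rabs_right in E by nra.
  pose proof (Cmod_ge_0 om). assert (Cmod om < 1) by nra. assert (s * t <= 1) by nra. nra.
Qed.

(** The equation for the mixed derivative of log K(s z, t w) is integrated in [s] and then in [t].
    The function [p] stands for (1 - t om)^mu and is given by its differential equation and initial
    value, so that no complex power has to be defined. *)
Theorem kernel_factorization (p : R -> C) : p 0 = RtoC 1 ->
  (forall t, 0 <= t <= 1 -> p t <> RtoC 0 /\ rderiv p t (- (mu * om / (1 - t * om)) * p t)%C) ->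
  (kernIV m F z w * kernIV m F vzero vzero = kernIV m F z vzero * kernIV m F vzero w * p 1)%C.
Proof.
  intros Hp0 Hp.
  (* Integration in [s] from 0 to 1: the logarithmic derivative in [t], corrected by
     [mu * s * om / (1 - s * t * om)], is constant in [s], and the correction vanishes at
     [s = 0]. *)
  assert (LD : forall t : R, 0 <= t <= 1 ->
    (h (P (zs 1)) (dP w (wt t)) / h (P (zs 1)) (P (wt t)) + mu * om / (1 - t * om) = h (P (zs 0)) (dP w (wt t)) / h (P (zs 0)) (P (wt t)))%C).
  { intros t Ht.
    assert (C := rderiv_zero_const (fun s : R => h (P (zs s)) (dP w (wt t)) / h (P (zs s)) (P (wt t)) + mu * s * om / (1 - RtoC (s * t) * om))%C 0 1 ltac:(lra)).
    cbv beta in C. transitivity (h (P (zs 1)) (dP w (wt t)) / h (P (zs 1)) (P (wt t)) + mu * 1%R * om / (1 - RtoC (1 * t) * om))%C.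
    { rewrite Rmult_1_l. f_equal. f_equal. cring. }
    rewrite C.
    - unfold Cdiv. replace (mu * 0%R * om * / (1 - RtoC (0 * t) * om))%C with (RtoC 0); cring.
    - clear C. intros s Hs.
      assert (N0 := Hnz s t Hs Ht). unfold kernIV in N0. change (h (P (zs s)) (P (wt t)) <> RtoC 0) in N0.
      assert (N1 := segment_denominator s t Hs Ht).
      assert (D0 : rderiv (fun s : R => h (P (zs s)) (P (wt t))) s (h (dP z (zs s)) (P (wt t)))).
      { apply rderiv_herm_l. intros a _. apply rderiv_P; auto. }
      assert (D1 : rderiv (fun s : R => h (P (zs s)) (dP w (wt t))) s (h (dP z (zs s)) (dP w (wt t)))).
      { apply rderiv_herm_l. intros a _. apply rderiv_P; auto. }
      assert (D2' : rderiv (fun s : R => 1 - RtoC (s * t) * om)%C s (- (t * om))%C).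
      { apply (rderiv_ext (fun s : R => 1 - s * (t * om))%C). intros; rewrite RtoC_mult; cring.
        eapply rderiv_eq. apply rderiv_minus. apply rderiv_const. apply rderiv_mult. apply rderiv_id. apply rderiv_const. cring. }
      eapply rderiv_eq. unfold Cdiv. apply rderiv_plus.
      + apply rderiv_mult. exact D1. apply (rderiv_inv (fun s : R => h (P (zs s)) (P (wt t)))). exact D0. exact N0.
      + apply rderiv_mult. apply rderiv_mult. apply rderiv_mult. apply rderiv_const. apply rderiv_id. apply rderiv_const.
        apply (rderiv_inv (fun s : R => 1 - RtoC (s * t) * om)%C). exact D2'. exact N1.
      + cbv beta. pose proof (segment_identity s t Hs Ht) as ID.
        set (k := h (P (zs s)) (P (wt t))) in *. set (k1 := h (dP z (zs s)) (P (wt t))) in *.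
        set (k2 := h (P (zs s)) (dP w (wt t))) in *. set (k12 := h (dP z (zs s)) (dP w (wt t))) in *.
        rewrite RtoC_mult in *.
        transitivity (((k12 * k - k1 * k2) * ((1 - s * t * om) * (1 - s * t * om)) + mu * om * (k * k)) / (k * k * ((1 - s * t * om) * (1 - s * t * om))))%C.
        * field. split; auto.
        * rewrite ID. field. split; auto. }
  (* Integration in [t]: by [LD] the logarithmic derivatives of numerator and denominator agree. *)
  assert (C := rderiv_zero_const (fun t : R => h (P (zs 1)) (P (wt t)) / (h (P (zs 0)) (P (wt t)) * p t))%C 0 1 ltac:(lra)).
  cbv beta in C.
  assert (N : forall s t : R, 0 <= s <= 1 -> 0 <= t <= 1 -> h (P (zs s)) (P (wt t)) <> RtoC 0).
  { intros s t Hs Ht. exact (Hnz s t Hs Ht). }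
  assert (Hc : (h (P (zs 1)) (P (wt 1)) / (h (P (zs 0)) (P (wt 1)) * p 1) = h (P (zs 1)) (P (wt 0)) / (h (P (zs 0)) (P (wt 0)) * p 0))%C).
  { apply C. intros t Ht. destruct (Hp t Ht) as [Np Dp].
    assert (D : forall s, 0 <= s <= 1 -> rderiv (fun t : R => h (P (zs s)) (P (wt t))) t (h (P (zs s)) (dP w (wt t)))).
    { intros s Hs. apply rderiv_herm_r. intros a _. apply rderiv_P; auto. }
    assert (N1 := N 1 t ltac:(lra) Ht). assert (N0 := N 0 t ltac:(lra) Ht).
    eapply rderiv_eq. unfold Cdiv. apply rderiv_mult. apply D; lra.
    apply (rderiv_inv (fun t : R => h (P (zs 0)) (P (wt t)) * p t)%C). apply rderiv_mult. apply D; lra. exact Dp.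
    apply Cmult_neq_0; auto.
    cbv beta. assert (LDt := LD t Ht).
    assert (N2 := segment_denominator 1 t ltac:(lra) Ht). rewrite Rmult_1_l in N2.
    set (a := h (P (zs 1)) (P (wt t))) in *. set (b := h (P (zs 0)) (P (wt t))) in *.
    set (a' := h (P (zs 1)) (dP w (wt t))) in *. set (b' := h (P (zs 0)) (dP w (wt t))) in *.
    transitivity (a / (b * p t) * ((a' / a + mu * om / (1 - t * om)) - b' / b))%C.
    - field. repeat split; auto.
    - rewrite LDt. cring. }
  assert (L0 : forall v, line vzero v 0%R = vzero) by (intros; apply line_0).
  assert (L1 : forall v, line vzero v 1%R = v).
  { intros v. apply functional_extensionality; intros k. unfold line, vadd, cscale, vzero. change (0 + 1 * v k = v k)%C. cring. }
  unfold zs, wt in Hc, N. assert (M1 := N 0 1 ltac:(lra) ltac:(lra)). assert (M0 := N 0 0 ltac:(lra) ltac:(lra)).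
  rewrite !L0, !L1 in *. rewrite Hp0 in Hc.
  change (h (P z) (P w) * h (P vzero) (P vzero) = h (P z) (P vzero) * h (P vzero) (P w) * p 1)%C.
  assert (Np := proj1 (Hp 1 ltac:(lra))).
  transitivity (h (P z) (P w) / (h (P vzero) (P w) * p 1) * (h (P vzero) (P vzero) * h (P vzero) (P w) * p 1))%C; [field; auto|].
  rewrite Hc. field. auto.
Qed.

End Segment.

(** * Linear algebra *)

Lemma sumR_plus n (f g : nat -> R) : sumR n (fun k => f k + g k) = sumR n f + sumR n g.
Proof. induction n; simpl; [ring|]. rewrite IHn. ring. Qed.

Lemma sumR_scal n c (f : nat -> R) : sumR n (fun k => c * f k) = c * sumR n f.
Proof. induction n; simpl; [ring|]. rewrite IHn. ring. Qed.

Lemma sumR_zero n (f : nat -> R) : (forall k, (k < n)%nat -> f k = 0) -> sumR n f = 0.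
Proof. induction n; simpl; intros H; auto. rewrite IHn, H; auto. ring. Qed.

Lemma sumR_single n i (f : nat -> R) : (i < n)%nat -> (forall k, (k < n)%nat -> k <> i -> f k = 0) -> sumR n f = f i.
Proof.
  induction n; intros Hi H; [lia|]. simpl. destruct (Nat.eq_dec i n) as [->|Hn].
  - rewrite sumR_zero; [ring|]. intros; apply H; lia.
  - rewrite IHn; [rewrite (H n); try lia; ring|lia|intros; apply H; lia].
Qed.

Lemma sumR_nonneg n (f : nat -> R) : (forall k, (k < n)%nat -> 0 <= f k) -> 0 <= sumR n f.
Proof. induction n; simpl; intros H; [lra|]. specialize (IHn ltac:(auto)). specialize (H n ltac:(lia)). lra. Qed.

Lemma sumR_nonneg_zero n (f : nat -> R) : (forall k, (k < n)%nat -> 0 <= f k) -> sumR n f <= 0 -> forall k, (k < n)%nat -> f k = 0.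
Proof.
  induction n; simpl; intros H Hs k Hk; [lia|]. pose proof (sumR_nonneg n f ltac:(auto)). pose proof (H n ltac:(lia)).
  destruct (Nat.eq_dec k n) as [->|]; [lra|]. apply IHn; auto; try lra; lia.
Qed.

Lemma underdetermined_system r : forall q (A : nat -> nat -> R), (r < q)%nat -> exists c : nat -> R,
  (exists k, (k < q)%nat /\ c k <> 0) /\ forall i, (i < r)%nat -> sumR q (fun k => A i k * c k) = 0.
Proof.
  induction r as [|r IH]; intros q A Hq.
  { exists (fun _ => 1). split; [exists 0%nat; split; [lia|lra]|]. intros; lia. }
  destruct q as [|q]; [lia|].
  destruct (classic (exists i0, (i0 < S r)%nat /\ A i0 q <> 0)) as [[i0 [Hi0 HA]]|HA].
  (* Elimination of the last unknown with pivot row [i0]; [sk] enumerates the other rows. *)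
  - set (sk := fun i => if Nat.ltb i i0 then i else S i).
    destruct (IH q (fun i k => A (sk i) k - A (sk i) q / A i0 q * A i0 k) ltac:(lia)) as [c [[k0 [Hk0 Hc0]] Hc]].
    set (s := sumR q (fun k => A i0 k * c k)).
    exists (fun k => if Nat.eqb k q then - s / A i0 q else c k). split.
    { exists k0. split; [lia|]. destruct (Nat.eqb_spec k0 q); [lia|auto]. }
    assert (Es : forall i, sumR (S q) (fun k => A i k * (if Nat.eqb k q then - s / A i0 q else c k)) =
      sumR q (fun k => A i k * c k) + A i q * (- s / A i0 q)).
    { intros i. simpl. rewrite Nat.eqb_refl. f_equal. apply sumR_ext. intros k Hk. destruct (Nat.eqb_spec k q); [lia|auto]. }
    intros i Hi. rewrite Es. destruct (Nat.eq_dec i i0) as [->|Hn].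
    { fold s. field. auto. }
    assert (Hsk : exists i', (i' < r)%nat /\ sk i' = i).
    { unfold sk. destruct (Nat.lt_ge_cases i i0) as [L|L].
      - exists i. split; [lia|]. apply Nat.ltb_lt in L. rewrite L. auto.
      - exists (i - 1)%nat. split; [lia|]. destruct (Nat.ltb_spec (i - 1) i0); lia. }
    destruct Hsk as [i' [Hi' <-]]. specialize (Hc i' Hi').
    rewrite (sumR_ext q _ (fun k => A (sk i') k * c k + (- (A (sk i') q / A i0 q)) * (A i0 k * c k))) in Hc by (intros; ring).
    rewrite sumR_plus, sumR_scal in Hc. fold s in Hc. rewrite <- Hc. field. auto.
  - exists (fun k => if Nat.eqb k q then 1 else 0). split.
    { exists q. split; [lia|]. rewrite Nat.eqb_refl. lra. }
    intros i Hi. rewrite (sumR_single (S q) q); [|lia|].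
    + rewrite Nat.eqb_refl, Rmult_1_r. apply NNPP. intros N. apply HA. exists i. auto.
    + intros k _ Hk. destruct (Nat.eqb_spec k q); [lia|ring].
Qed.

(** Subtracting [t q] times each moment from the next one multiplies the weights by [t i - t q],
    which removes the last node and leaves nonzero factors at the others. *)
Lemma vandermonde_injective q : forall (t c : nat -> R), (forall i j, (i < q)%nat -> (j < q)%nat -> i <> j -> t i <> t j) ->
  (forall k, sumR q (fun i => c i * t i ^ k) = 0) -> forall i, (i < q)%nat -> c i = 0.
Proof.
  induction q as [|q IH]; intros t c Ht H i Hi; [lia|].
  assert (Z : forall i, (i < q)%nat -> c i = 0).
  { intros i' Hi'. assert (Q := IH t (fun i => c i * (t i - t q)) ltac:(intros; apply Ht; lia)).
    cbv beta in Q. specialize (fun K => Q K i' Hi').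
    assert (Q' : c i' * (t i' - t q) = 0).
    { apply Q. intros k. pose proof (H (S k)) as H1. pose proof (H k) as H2. simpl sumR in H1, H2.
      rewrite (sumR_ext q _ (fun i => c i * t i ^ S k + (- t q) * (c i * t i ^ k))) by (intros; simpl; ring).
      rewrite sumR_plus, sumR_scal. simpl in *. nra. }
    apply Rmult_integral in Q'. destruct Q' as [Q'|Q']; auto. exfalso. apply (Ht i' q); [lia|lia|lia|lra]. }
  destruct (Nat.eq_dec i q) as [->|]; [|apply Z; lia].
  specialize (H 0%nat). simpl in H. rewrite sumR_zero in H; [lra|]. intros k Hk. rewrite Z; auto. ring.
Qed.

Lemma kernel_two_by_three (r0 r1 r2 s0 s1 s2 : C) : exists x y z : C,
  ~ (x = RtoC 0 /\ y = RtoC 0 /\ z = RtoC 0) /\ (x * r0 + y * r1 + z * r2)%C = RtoC 0 /\ (x * s0 + y * s1 + z * s2)%C = RtoC 0.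
Proof.
  assert (M : forall a b : C, (a * b)%C = RtoC 0 -> a <> RtoC 0 -> b = RtoC 0).
  { intros a b H Ha. replace b with (/ a * (a * b))%C by (field; auto). rewrite H. ring. }
  destruct (classic ((r1 * s2 - r2 * s1)%C = RtoC 0 /\ (r2 * s0 - r0 * s2)%C = RtoC 0 /\ (r0 * s1 - r1 * s0)%C = RtoC 0)) as [(M1 & M2 & M3)|N].
  (* The cross product of the two rows solves the system unless the rows are proportional, which is
     left to the cases below. *)
  2:{ exists (r1 * s2 - r2 * s1)%C, (r2 * s0 - r0 * s2)%C, (r0 * s1 - r1 * s0)%C. repeat split; auto; ring. }
  destruct (classic (r0 = RtoC 0 /\ r1 = RtoC 0)) as [[-> ->]|N].
  2:{ exists (- r1)%C, r0, (RtoC 0). split; [|split]; [| |].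
      - intros (A & B & _). apply N. split; auto. replace r1 with (- - r1)%C by ring. rewrite A. ring.
      - ring.
      - transitivity (r0 * s1 - r1 * s0)%C; [ring|exact M3]. }
  destruct (classic (r2 = RtoC 0)) as [->|N2].
  - destruct (classic (s0 = RtoC 0 /\ s1 = RtoC 0)) as [[-> ->]|N].
    + exists (RtoC 1), (RtoC 0), (RtoC 0). repeat split; try ring. intros (A & _). injection A. lra.
    + exists (- s1)%C, s0, (RtoC 0). repeat split; try ring.
      intros (A & B & _). apply N. split; auto. replace s1 with (- - s1)%C by ring. rewrite A. ring.
  - assert (s0 = RtoC 0). { apply (M r2); auto. transitivity (r2 * s0 - 0 * s2)%C; [ring|exact M2]. }
    exists (RtoC 1), (RtoC 0), (RtoC 0). subst s0. repeat split; try ring. intros (A & _). injection A. lra.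
Qed.

Lemma herm_negative m (V : nat -> C) : V m = RtoC 0 -> V (S m) = RtoC 0 ->
  hermR (S (S m)) (sgnIV m) V <= 0 /\ (0 <= hermR (S (S m)) (sgnIV m) V -> forall a, (a < S (S m))%nat -> V a = RtoC 0).
Proof.
  intros H1 H2.
  assert (Q : hermR (S (S m)) (sgnIV m) V = - sumR m (fun a => Cmod (V a)%C ^ 2)).
  { unfold hermR. simpl sumR. rewrite !Cnorm2_Cmod, H1, H2, Cmod_0, <- sumR_opp.
    rewrite (sumR_ext m _ (fun a => - Cmod (V a)%C ^ 2)); [simpl; ring|].
    intros k Hk. rewrite sgnIV_lt, Cnorm2_Cmod by auto. ring. }
  assert (P : 0 <= sumR m (fun a => Cmod (V a)%C ^ 2)) by (apply sumR_nonneg; intros; apply pow2_ge_0).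
  split; [lra|]. intros Hp a Ha.
  destruct (Nat.eq_dec a (S m)) as [->|]; auto. destruct (Nat.eq_dec a m) as [->|]; auto.
  apply Cmod_eq_0. assert (Z := sumR_nonneg_zero m (fun a => Cmod (V a)%C ^ 2) ltac:(intros; apply pow2_ge_0) ltac:(lra) a ltac:(lia)).
  simpl in Z. pose proof (Cmod_ge_0 (V a)). nra.
Qed.

Lemma hermR_combination N e (V0 V1 V2 : nat -> C) (x y z : C) g0 g1 g2 :
  herm N e V0 V0 = RtoC g0 -> herm N e V1 V1 = RtoC g1 -> herm N e V2 V2 = RtoC g2 ->
  herm N e V0 V1 = RtoC 0 -> herm N e V0 V2 = RtoC 0 -> herm N e V1 V2 = RtoC 0 ->
  hermR N e (fun a => x * V0 a + y * V1 a + z * V2 a)%C = Cmod x ^ 2 * g0 + Cmod y ^ 2 * g1 + Cmod z ^ 2 * g2.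
Proof.
  intros H00 H11 H22 H01 H02 H12.
  assert (H10 : herm N e V1 V0 = RtoC 0) by (rewrite <- herm_conj, H01; apply Cconj_RtoC).
  assert (H20 : herm N e V2 V0 = RtoC 0) by (rewrite <- herm_conj, H02; apply Cconj_RtoC).
  assert (H21 : herm N e V2 V1 = RtoC 0) by (rewrite <- herm_conj, H12; apply Cconj_RtoC).
  pose proof (herm_diag N e (fun a => x * V0 a + y * V1 a + z * V2 a)%C) as Q.
  rewrite !herm_plus_l, !herm_plus_r, !herm_scal_l, !herm_scal_r in Q.
  rewrite H00, H11, H22, H01, H02, H12, H10, H20, H21 in Q.
  assert (Q' : RtoC (hermR N e (fun a => x * V0 a + y * V1 a + z * V2 a)%C) = RtoC (Cmod x ^ 2 * g0 + Cmod y ^ 2 * g1 + Cmod z ^ 2 * g2)).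
  { assert (Ec : forall v : C, RtoC (Cmod v ^ 2) = (v * Cconj v)%C).
    { intros v. rewrite <- Cmod2_conj, RtoC_pow. auto. }
    rewrite <- Q, !RtoC_plus, !RtoC_mult, !Ec. cring. }
  injection Q'. auto.
Qed.

(** Some nontrivial combination of the three vectors has both positive coordinates zero. *)
Lemma no_three_positive m (V0 V1 V2 : nat -> C) g0 g1 g2 : 0 < g0 -> 0 < g1 -> 0 < g2 ->
  let h := herm (S (S m)) (sgnIV m) in
  h V0 V0 = RtoC g0 -> h V1 V1 = RtoC g1 -> h V2 V2 = RtoC g2 ->
  h V0 V1 = RtoC 0 -> h V0 V2 = RtoC 0 -> h V1 V2 = RtoC 0 -> False.
Proof.
  intros P0 P1 P2 h H00 H11 H22 H01 H02 H12.
  destruct (kernel_two_by_three (V0 m) (V1 m) (V2 m) (V0 (S m)) (V1 (S m)) (V2 (S m))) as (x & y & z & N & E1 & E2).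
  pose proof (hermR_combination _ _ V0 V1 V2 x y z g0 g1 g2 H00 H11 H22 H01 H02 H12) as Q.
  destruct (herm_negative m (fun a => x * V0 a + y * V1 a + z * V2 a)%C E1 E2) as [L _]. rewrite Q in L.
  pose proof (pow2_ge_0 (Cmod x)). pose proof (pow2_ge_0 (Cmod y)). pose proof (pow2_ge_0 (Cmod z)).
  assert (A : forall v : C, Cmod v ^ 2 <= 0 -> v = RtoC 0).
  { intros v Hv. apply Cmod_eq_0. pose proof (Cmod_ge_0 v). simpl in Hv. nra. }
  apply N. repeat split; apply A; nra.
Qed.

(** The complement of a positive vector has signature (1, m), so its isotropic subspaces are at most
    lines. Concretely, a combination whose two positive coordinates vanish has norm [Cmod x ^ 2],
    which forces [x = 0], and is then itself zero. *)
Lemma isotropic_collinear m (V0 V1 V2 : nat -> C) :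
  let h := herm (S (S m)) (sgnIV m) in
  h V0 V0 = RtoC 1 -> h V1 V1 = RtoC 0 -> h V2 V2 = RtoC 0 ->
  h V0 V1 = RtoC 0 -> h V0 V2 = RtoC 0 -> h V1 V2 = RtoC 0 ->
  exists y z : C, ~ (y = RtoC 0 /\ z = RtoC 0) /\ forall a, (a < S (S m))%nat -> (y * V1 a + z * V2 a)%C = RtoC 0.
Proof.
  intros h H00 H11 H22 H01 H02 H12.
  destruct (kernel_two_by_three (V0 m) (V1 m) (V2 m) (V0 (S m)) (V1 (S m)) (V2 (S m))) as (x & y & z & N & E1 & E2).
  pose proof (hermR_combination _ _ V0 V1 V2 x y z 1 0 0 H00 H11 H22 H01 H02 H12) as Q.
  destruct (herm_negative m (fun a => x * V0 a + y * V1 a + z * V2 a)%C E1 E2) as [L Z]. rewrite Q in L, Z.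
  pose proof (pow2_ge_0 (Cmod x)).
  assert (X : x = RtoC 0). { apply Cmod_eq_0. pose proof (Cmod_ge_0 x). simpl in *. nra. }
  exists y, z. split.
  - intros [Hy Hz]. apply N. auto.
  - intros a Ha. rewrite <- (Z ltac:(lra) a Ha). rewrite X. cring.
Qed.

(** * The normalized lift near the origin *)

Lemma normn_vzero n : normn n vzero = 0.
Proof.
  replace vzero with (cscale 0%C vzero). rewrite normn_cscale, Cmod_0. ring.
  apply functional_extensionality; intros k. unfold cscale, vzero. cring.
Qed.

Lemma ball_vzero n : Defs.ball n vzero.
Proof. apply ball_normn. split; [apply supported_vzero|]. rewrite normn_vzero. lra. Qed.

Lemma is_grad_continuous n f z a : is_grad n f z a -> forall eps, 0 < eps -> exists d, 0 < d /\
  forall h, supported n h -> normn n h < d -> Cmod (f (vadd z h) - f z)%C <= eps.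
Proof.
  intros H eps He. destruct (H 1 ltac:(lra)) as [d [Hd K]]. set (A := csum1 n a + 1).
  assert (HA : 0 < A) by (unfold A; pose proof (csum1_nonneg n a); lra).
  exists (Rmin d (eps / A)). split; [apply Rmin_pos; auto; apply Rdiv_lt_0_compat; auto|].
  intros h Hs Hh. assert (H1 := Rlt_le_trans _ _ _ Hh (Rmin_l _ _)). assert (H2 := Rlt_le_trans _ _ _ Hh (Rmin_r _ _)).
  pose proof (normn_nonneg n h).
  destruct (Req_dec (normn n h) 0) as [Z|Z].
  - assert (E : vadd z h = z).
    { apply functional_extensionality; intros k. unfold vadd. assert (Zk : h k = RtoC 0).
      { destruct (Nat.lt_ge_cases k n) as [L|L]; [|apply (Hs k L)].
        apply Cmod_eq_0. apply Rle_antisym; [|apply Cmod_ge_0]. rewrite <- Z. apply Cmod_le_normn; auto. }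
      rewrite Zk. change (z k + 0 = z k)%C. cring. }
    rewrite E. replace (f z - f z)%C with (RtoC 0) by cring. rewrite Cmod_0. lra.
  - specialize (K h Hs ltac:(lra)).
    replace (f (vadd z h) - f z)%C with ((f (vadd z h) - f z - cdot n a h) + cdot n a h)%C by cring.
    eapply Rle_trans; [apply Cmod_triangle|]. pose proof (cdot_bound n a h).
    apply Rle_trans with (A * normn n h); [unfold A; lra|].
    replace eps with (A * (eps / A)) by (field; lra). apply Rmult_le_compat_l; lra.
Qed.

Lemma herm_continuous n N e (Phi : nat -> vec -> C) : (forall a, (a < N)%nat -> bholo n (Phi a)) ->
  forall eps, 0 < eps -> exists d, 0 < d /\ forall z w, supported n z -> supported n w -> normn n z < d -> normn n w < d ->
    Cmod (herm N e (fun a => Phi a z) (fun a => Phi a w) - herm N e (fun a => Phi a vzero) (fun a => Phi a vzero))%C <= eps.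
Proof.
  induction N as [|N IH]; intros H eps He.
  - exists 1. split; [lra|]. intros z w _ _ _ _. change (Cmod (0 - 0)%C <= eps).
    replace (0 - 0)%C with (RtoC 0) by cring. rewrite Cmod_0. lra.
  - destruct (IH ltac:(auto) (eps / 2) ltac:(lra)) as [d1 [Hd1 K1]].
    destruct (proj2 (H N ltac:(lia))) as [M [HM0 HM]].
    set (c := (M + 1) * (Rabs (e N) + 1)). pose proof (Rabs_pos (e N)). assert (Hc : 0 < c) by (unfold c; nra).
    destruct (is_grad_continuous n (Phi N) vzero _ (bholo_is_grad n _ _ (H N ltac:(lia)) (ball_vzero n)) (eps / (4 * c))) as [d2 [Hd2 K2]].
    { apply Rdiv_lt_0_compat; lra. }
    exists (Rmin 1 (Rmin d1 d2)). split; [repeat apply Rmin_pos; lra|].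
    intros z w Hz Hw Nz Nw.
    assert (B : forall v, normn n v < Rmin 1 (Rmin d1 d2) -> normn n v < 1 /\ normn n v < d1 /\ normn n v < d2).
    { intros v Hv. pose proof (Rmin_l 1 (Rmin d1 d2)). pose proof (Rmin_r 1 (Rmin d1 d2)). pose proof (Rmin_l d1 d2). pose proof (Rmin_r d1 d2). repeat split; lra. }
    destruct (B z Nz) as (z1 & z2 & z3). destruct (B w Nw) as (w1 & w2 & w3). clear B.
    specialize (K1 z w Hz Hw z2 w2).
    assert (V : forall v, vadd vzero v = v). { intros v. apply functional_extensionality; intros k. unfold vadd, vzero. change (0 + v k = v k)%C. cring. }
    assert (Kz := K2 z Hz z3). assert (Kw := K2 w Hw w3). rewrite V in Kz, Kw.
    unfold herm in *. rewrite !sumC_S.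
    set (S1 := sumC N (fun a => (e a * Phi a z * Cconj (Phi a w)%C)%C)) in *.
    set (S0 := sumC N (fun a => (e a * Phi a vzero * Cconj (Phi a vzero)%C)%C)) in *.
    replace (S1 + e N * Phi N z * Cconj (Phi N w)%C - (S0 + e N * Phi N vzero * Cconj (Phi N vzero)%C))%C with
      ((S1 - S0) + e N * (Phi N z * Cconj (Phi N w - Phi N vzero)%C + (Phi N z - Phi N vzero) * Cconj (Phi N vzero)%C))%C
      by (rewrite Cminus_conj; cring).
    eapply Rle_trans; [apply Cmod_triangle|].
    assert (T : Cmod (e N * (Phi N z * Cconj (Phi N w - Phi N vzero)%C + (Phi N z - Phi N vzero) * Cconj (Phi N vzero)%C))%C <= eps / 2); [|lra].
    rewrite Cmod_mult, Cmod_R.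
    assert (T2 : Cmod (Phi N z * Cconj (Phi N w - Phi N vzero)%C + (Phi N z - Phi N vzero) * Cconj (Phi N vzero)%C)%C <= 2 * ((M + 1) * (eps / (4 * c)))).
    { eapply Rle_trans; [apply Cmod_triangle|]. rewrite !Cmod_mult, !Cmod_conj.
      assert (HMz : Cmod (Phi N z)%C <= M) by (apply HM, ball_normn; auto).
      assert (HM0' : Cmod (Phi N vzero)%C <= M) by (apply HM, ball_vzero).
      pose proof (Cmod_ge_0 (Phi N z)). pose proof (Cmod_ge_0 (Phi N vzero)).
      pose proof (Cmod_ge_0 (Phi N w - Phi N vzero)%C). pose proof (Cmod_ge_0 (Phi N z - Phi N vzero)%C).
      assert (Cmod (Phi N z)%C * Cmod (Phi N w - Phi N vzero)%C <= (M + 1) * (eps / (4 * c))) by (apply Rmult_le_compat; lra).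
      assert (Cmod (Phi N z - Phi N vzero)%C * Cmod (Phi N vzero)%C <= (eps / (4 * c)) * (M + 1)) by (apply Rmult_le_compat; lra). lra. }
    apply Rle_trans with ((Rabs (e N) + 1) * (2 * ((M + 1) * (eps / (4 * c))))).
    + apply Rmult_le_compat; try lra. apply Cmod_ge_0.
    + unfold c. right. field. split; lra.
Qed.

Definition kernel_nonzero (n m : nat) (F : vec -> vec) (d : R) : Prop :=
  forall z w, supported n z -> supported n w -> normn n z < d -> normn n w < d -> kernIV m F z w <> RtoC 0.

Lemma kernel_nonzero_near n m F : (forall a, bholo n (fun z => lift m (F z) a)) -> DIV m (F vzero) ->
  exists d, 0 < d /\ d <= / 4 /\ kernel_nonzero n m F d.
Proof.
  intros HB HD. set (k := hermR (S (S m)) (sgnIV m) (lift m (F vzero))).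
  assert (Hk : 0 < k) by (apply typeIV_q_pos; auto).
  destruct (herm_continuous n (S (S m)) (sgnIV m) (fun a z => lift m (F z) a) (fun a _ => HB a) (k / 2) ltac:(lra)) as [d [Hd K]].
  exists (Rmin d (/ 4)). split; [apply Rmin_pos; lra|]. split; [apply Rmin_r|].
  intros z w Hz Hw Nz Nw E. pose proof (Rmin_l d (/ 4)).
  specialize (K z w Hz Hw ltac:(lra) ltac:(lra)). cbv beta in K.
  change (Cmod (kernIV m F z w - herm (S (S m)) (sgnIV m) (lift m (F vzero)) (lift m (F vzero)))%C <= k / 2) in K.
  rewrite E, herm_diag in K. fold k in K. replace (0 - k)%C with (- k)%C in K by cring.
  rewrite Cmod_opp, Cmod_R, Rabs_right in K; lra.
Qed.

Lemma kernIV_conj m F z w : Cconj (kernIV m F z w)%C = kernIV m F w z.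
Proof. apply herm_conj. Qed.

(** The lift rescaled so that its kernel is normalized along the origin. *)
Definition psi (m : nat) (F : vec -> vec) (z : vec) (a : nat) : C :=
  (RtoC (sqrt (hermR (S (S m)) (sgnIV m) (lift m (F vzero)))) / kernIV m F z vzero * lift m (F z) a)%C.

Lemma psi_kernel n m F d z w : DIV m (F vzero) -> kernel_nonzero n m F d -> 0 < d ->
  supported n z -> supported n w -> normn n z < d -> normn n w < d ->
  herm (S (S m)) (sgnIV m) (psi m F z) (psi m F w) = (kernIV m F z w * kernIV m F vzero vzero / (kernIV m F z vzero * kernIV m F vzero w))%C.
Proof.
  intros HD HK Hd Hz Hw Nz Nw. unfold psi.
  assert (Hk := typeIV_q_pos m (F vzero) HD). set (k := hermR (S (S m)) (sgnIV m) (lift m (F vzero))) in *.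
  rewrite herm_scal_l, herm_scal_r. change (herm (S (S m)) (sgnIV m) (lift m (F z)) (lift m (F w))) with (kernIV m F z w).
  assert (N1 : kernIV m F z vzero <> RtoC 0). { apply HK; auto. apply supported_vzero. rewrite normn_vzero; auto. }
  assert (N2 : kernIV m F w vzero <> RtoC 0). { apply HK; auto. apply supported_vzero. rewrite normn_vzero; auto. }
  assert (N3 : kernIV m F vzero w <> RtoC 0). { apply HK; auto. apply supported_vzero. rewrite normn_vzero; auto. }
  rewrite Cdiv_conj, Cconj_RtoC, kernIV_conj by auto.
  assert (E : (RtoC (sqrt k) * RtoC (sqrt k))%C = kernIV m F vzero vzero).
  { rewrite <- RtoC_mult, sqrt_sqrt by lra. unfold kernIV. rewrite herm_diag. auto. }
  rewrite <- E. field. split; auto.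
Qed.

Lemma line_vzero_norm n v (s d : R) : supported n v -> normn n v < d -> 0 <= s <= 1 ->
  supported n (line vzero v s) /\ normn n (line vzero v s) < d.
Proof.
  intros Hv Nv Hs. split; [apply supported_line; auto; apply supported_vzero|].
  eapply Rle_lt_trans; [apply normn_line|]. rewrite Cmod_R, Rabs_right, normn_vzero by lra. pose proof (normn_nonneg n v). nra.
Qed.

(** Dividing the lift by K(z,0) cancels the two factors of the kernel that depend on one variable
    only. *)
Lemma psi_factorization n m F mu d z w (p : R -> C) : (forall a, bholo n (fun z => lift m (F z) a)) -> flat n m F mu ->
  DIV m (F vzero) -> 0 < d -> d <= / 4 -> kernel_nonzero n m F d ->
  supported n z -> supported n w -> normn n z < d -> normn n w < d ->
  p 0 = RtoC 1 ->
  (forall t, 0 <= t <= 1 -> p t <> RtoC 0 /\ rderiv p t (- (mu * cprod n z w / (1 - t * cprod n z w)) * p t)%C) ->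
  herm (S (S m)) (sgnIV m) (psi m F z) (psi m F w) = p 1.
Proof.
  intros HB HX HD Hd Hd4 HK Hz Hw Nz Nw Hp0 Hp.
  assert (V := kernel_factorization n m F mu HB HX z w Hz Hw ltac:(lra) ltac:(lra)).
  rewrite (psi_kernel n m F d) by auto.
  rewrite (V ltac:(intros s t Hs Ht; destruct (line_vzero_norm n z s d Hz Nz Hs); destruct (line_vzero_norm n w t d Hw Nw Ht); apply HK; auto) p Hp0 Hp).
  assert (N1 : kernIV m F z vzero <> RtoC 0). { apply HK; auto. apply supported_vzero. rewrite normn_vzero; auto. }
  assert (N3 : kernIV m F vzero w <> RtoC 0). { apply HK; auto. apply supported_vzero. rewrite normn_vzero; auto. }
  field. auto.
Qed.

Lemma cprod_small n d z w : d <= / 4 -> normn n z < d -> normn n w < d -> Cmod (cprod n z w)%C < 1.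
Proof.
  intros Hd Hz Hw. eapply Rle_lt_trans; [apply Cmod_cprod|]. rewrite <- !normn_sq.
  pose proof (normn_nonneg n z). pose proof (normn_nonneg n w). nra.
Qed.

(** For a real product the base [1 - t * x] stays positive on the segment and [Rpower] solves the
    equation of [p]. Such points are enough to determine [mu]. *)
Lemma psi_power n m F mu d z w (x : R) : (forall a, bholo n (fun z => lift m (F z) a)) -> flat n m F mu ->
  DIV m (F vzero) -> 0 < d -> d <= / 4 -> kernel_nonzero n m F d ->
  supported n z -> supported n w -> normn n z < d -> normn n w < d -> cprod n z w = RtoC x ->
  herm (S (S m)) (sgnIV m) (psi m F z) (psi m F w) = RtoC (Rpower (1 - x) mu).
Proof.
  intros HB HX HD Hd Hd4 HK Hz Hw Nz Nw Hx.
  assert (Bx := cprod_small n d z w Hd4 Nz Nw). rewrite Hx, Cmod_R in Bx. apply Rabs_def2 in Bx.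
  assert (Pt : forall t, 0 <= t <= 1 -> 0 < 1 - t * x) by (intros; nra).
  replace (1 - x) with (1 - 1 * x) by ring.
  apply (psi_factorization n m F mu d z w (fun t => RtoC (Rpower (1 - t * x) mu))); auto.
  - rewrite Rmult_0_l, Rminus_0_r. unfold Rpower. rewrite ln_1, Rmult_0_r, exp_0. auto.
  - intros t Ht. specialize (Pt t Ht). split.
    + apply RtoC_neq. apply Rgt_not_eq. apply exp_pos.
    + rewrite Hx.
      assert (D : is_derive (fun t => Rpower (1 - t * x) mu) t (- (mu * x / (1 - t * x)) * Rpower (1 - t * x) mu)).
      { unfold Rpower. auto_derive; [exact Pt|]. replace (1 + - (t * x)) with (1 - t * x) by ring. field. lra. }
      replace (- (mu * x / (1 - t * x)) * Rpower (1 - t * x) mu)%C with (RtoC (- (mu * x / (1 - t * x)) * Rpower (1 - t * x) mu)).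
      * split; simpl. exact D. apply (is_derive_const (K := R_AbsRing) (V := R_NormedModule)).
      * rewrite RtoC_mult, RtoC_opp, RtoC_div, RtoC_minus, !RtoC_mult by lra. auto.
Qed.

(** For [mu = 1] the equation of [p] has an affine solution, available for every complex product. *)
Lemma psi_affine n m F d z w : (forall a, bholo n (fun z => lift m (F z) a)) -> flat n m F 1 ->
  DIV m (F vzero) -> 0 < d -> d <= / 4 -> kernel_nonzero n m F d ->
  supported n z -> supported n w -> normn n z < d -> normn n w < d ->
  herm (S (S m)) (sgnIV m) (psi m F z) (psi m F w) = (1 - cprod n z w)%C.
Proof.
  intros HB HX HD Hd Hd4 HK Hz Hw Nz Nw.
  assert (Bx := cprod_small n d z w Hd4 Nz Nw). set (om := cprod n z w) in *.
  transitivity (1 - 1%R * om)%C; [|cring].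
  apply (psi_factorization n m F 1 d z w (fun t => 1 - t * om)%C); auto.
  - cring.
  - intros t Ht. fold om.
    assert (N : (1 - t * om)%C <> RtoC 0).
    { intros Z. assert (E : (t * om)%C = RtoC 1). { replace (t * om)%C with (1 - (1 - t * om))%C by cring. rewrite Z. cring. }
      apply (f_equal Cmod) in E. rewrite Cmod_mult, Cmod_R, Cmod_1, Rabs_right in E by lra. pose proof (Cmod_ge_0 om). nra. }
    split; auto. eapply rderiv_eq. apply rderiv_minus. apply rderiv_const. apply rderiv_mult. apply rderiv_id. apply rderiv_const.
    cbv beta. field. auto.
Qed.

(** * The isometric constant *)

(** Points of a real plane, where all products are real; this is where two dimensions of the ball
    are used. *)
Definition real_point (a b : R) : vec := vadd (cscale a (ex 0)) (cscale b (ex 1)).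

Lemma normn_ex n i : (i < n)%nat -> normn n (ex i) = 1.
Proof.
  intros Hi. unfold normn. replace (sqnorm n (ex i)) with 1; [apply sqrt_1|].
  unfold sqnorm. rewrite (sumR_single n i); auto.
  - unfold ex. rewrite Nat.eqb_refl. unfold Cnorm2, C1; simpl. ring.
  - intros k _ Hk. unfold ex. destruct (Nat.eqb_spec k i); [congruence|]. unfold Cnorm2, C0; simpl. ring.
Qed.

Lemma real_point_norm n a b : (2 <= n)%nat -> supported n (real_point a b) /\ normn n (real_point a b) <= Rabs a + Rabs b.
Proof.
  intros Hn. split.
  - apply supported_vadd; apply supported_cscale, supported_ex; lia.
  - eapply Rle_trans; [apply normn_vadd|]. rewrite !normn_cscale, !normn_ex, !Cmod_R by lia. lra.
Qed.

Lemma cprod_real_point n a b a' b' : (2 <= n)%nat -> cprod n (real_point a b) (real_point a' b') = RtoC (a * a' + b * b').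
Proof.
  intros Hn. unfold cprod, real_point. rewrite (sumC_ext n _ (fun k => (kdelta 0 k * RtoC (a * a')) + (kdelta 1 k * RtoC (b * b')))%C).
  - rewrite sumC_plus, !kdelta_sum_l by lia. rewrite RtoC_plus. auto.
  - intros k _. unfold vadd, cscale, ex, kdelta. rewrite (Nat.eqb_sym 0 k), (Nat.eqb_sym 1 k).
    destruct (Nat.eqb_spec k 0) as [->|]; [|destruct (Nat.eqb_spec k 1)];
      apply injective_projections; simpl; ring.
Qed.

Lemma Rpower_derive x mu : 0 < x -> is_derive (fun x => Rpower x mu) x (mu * Rpower x (mu - 1)).
Proof. intros Hx. apply is_derive_Reals. apply derivable_pt_lim_power; auto. Qed.

(** By the mean value theorem the slope of x^mu is above [mu] to the right of 1 and below [mu] to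
    the left. *)
Lemma Rpower_strictly_convex mu r : 1 < mu -> 0 < r < 1 -> 2 < Rpower (1 - r) mu + Rpower (1 + r) mu.
Proof.
  intros Hmu Hr.
  assert (M : forall a b, 0 < a -> a < b -> exists c, a < c < b /\ Rpower b mu - Rpower a mu = mu * Rpower c (mu - 1) * (b - a)).
  { intros a b Ha Hab. destruct (MVT_cor2 (fun x => Rpower x mu) (fun x => mu * Rpower x (mu - 1)) a b Hab) as [c [Ec Hc]].
    - intros c Hc. apply derivable_pt_lim_power. lra.
    - exists c. split; auto. }
  assert (One : Rpower 1 mu = 1). { unfold Rpower. rewrite ln_1, Rmult_0_r, exp_0. auto. }
  assert (Gt : forall c, 1 < c -> 1 < Rpower c (mu - 1)).
  { intros c Hc. apply Rle_lt_trans with (Rpower c 0); [rewrite Rpower_O; lra|apply Rpower_lt; lra]. }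
  assert (Lt : forall c, 0 < c < 1 -> Rpower c (mu - 1) < 1).
  { intros c Hc. unfold Rpower. apply Rlt_le_trans with (exp 0); [|rewrite exp_0; lra].
    apply exp_increasing. assert (ln c < 0). { rewrite <- ln_1. apply ln_increasing; lra. } nra. }
  destruct (M 1 (1 + r)) as [c [Hc Ec]]; try lra. destruct (M (1 - r) 1) as [c' [Hc' Ec']]; try lra.
  rewrite One in Ec, Ec'. specialize (Gt c ltac:(lra)). specialize (Lt c' ltac:(lra)).
  replace (1 + r - 1) with r in Ec by ring. replace (1 - (1 - r)) with r in Ec' by ring.
  assert (Hp : 0 < mu * r) by nra.
  replace (mu * Rpower c (mu - 1) * r) with (mu * r * Rpower c (mu - 1)) in Ec by ring.
  replace (mu * Rpower c' (mu - 1) * r) with (mu * r * Rpower c' (mu - 1)) in Ec' by ring.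
  pose proof (Rmult_lt_compat_l _ _ _ Hp Gt). pose proof (Rmult_lt_compat_l _ _ _ Hp Lt). lra.
Qed.

(** For [mu > 1], second differences of [psi] at the origin yield, together with [psi 0],
    three orthogonal positive vectors. *)
Lemma isometric_constant_le_1 n m F mu d : (2 <= n)%nat -> (forall a, bholo n (fun z => lift m (F z) a)) -> flat n m F mu ->
  DIV m (F vzero) -> 0 < d -> d <= / 4 -> kernel_nonzero n m F d -> mu <= 1.
Proof.
  intros Hn HB HX HD Hd Hd4 HK. apply Rnot_lt_le. intros Hmu.
  (* All the points below have norm at most [2 * e < d]. *)
  set (e := d / 3). set (k := fun x => Rpower (1 - x) mu).
  set (V := fun a b => psi m F (real_point (a * e) (b * e))).
  set (h := herm (S (S m)) (sgnIV m)).
  assert (HV : forall a b a' b', Rabs a + Rabs b <= 2 -> Rabs a' + Rabs b' <= 2 -> h (V a b) (V a' b') = RtoC (k ((a * a' + b * b') * e ^ 2))).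
  { intros a b a' b' H1 H2.
    assert (N : forall a b, Rabs a + Rabs b <= 2 -> supported n (real_point (a * e) (b * e)) /\ normn n (real_point (a * e) (b * e)) < d).
    { intros x y Hxy. destruct (real_point_norm n (x * e) (y * e) Hn) as [A B]. split; auto.
      rewrite !Rabs_mult, (Rabs_right e) in B by (unfold e; lra). unfold e in *. nra. }
    destruct (N a b H1). destruct (N a' b' H2).
    apply (psi_power n m F mu d); auto. rewrite cprod_real_point by auto. f_equal. ring. }
  assert (K0 : k (0 * e ^ 2) = 1). { unfold k. rewrite Rmult_0_l, Rminus_0_r. unfold Rpower. rewrite ln_1, Rmult_0_r, exp_0. auto. }
  assert (A0 : Rabs 0 = 0) by apply Rabs_R0. assert (A1 : Rabs 1 = 1) by apply Rabs_R1.
  assert (Am : Rabs (-1) = 1) by (rewrite Rabs_left; lra).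
  assert (He : 0 < e ^ 2 < / 8). { unfold e. nra. }
  assert (Kc : forall r, 0 < r < 1 -> 0 < k r + k (- r) - 2).
  { intros r Hr. unfold k. replace (1 - - r) with (1 + r) by ring. pose proof (Rpower_strictly_convex mu r Hmu Hr). lra. }
  assert (HV' : forall a b a' b' c, Rabs a + Rabs b <= 2 -> Rabs a' + Rabs b' <= 2 -> (a * a' + b * b') = c -> h (V a b) (V a' b') = RtoC (k (c * e ^ 2))).
  { intros a b a' b' c H1 H2 <-. auto. }
  assert (P1 := Kc (1 * e ^ 2) ltac:(lra)). assert (P2 := Kc (2 * e ^ 2) ltac:(lra)).
  replace (- (1 * e ^ 2)) with (-1 * e ^ 2) in P1 by ring. replace (- (2 * e ^ 2)) with (-2 * e ^ 2) in P2 by ring.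
  (* [V1] is a pure second difference and [V2] a mixed one. Both are orthogonal to [V 0 0], whose
     product with every [V a b] is 1, and to each other, being even and odd under b -> -b. Their
     norms are positive by strict convexity. *)
  set (V1 := fun a => (V 1 0 a + V (-1) 0 a - 2 * V 0 0 a)%C).
  set (V2 := fun a => ((V 1 1 a - V 1 (-1) a) - (V (-1) 1 a - V (-1) (-1) a))%C).
  apply (no_three_positive m (V 0 0) V1 V2 1 (2 * (k (1 * e ^ 2) + k (-1 * e ^ 2) - 2)) (4 * (k (2 * e ^ 2) + k (-2 * e ^ 2) - 2))); try lra; fold h.
  - rewrite (HV' 0 0 0 0 0), K0; auto; rewrite ?A0; lra.
  - unfold V1, h. rewrite herm_minus_l, herm_plus_l, herm_scal_l, !herm_minus_r, !herm_plus_r, !herm_scal_r. fold h.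
    rewrite (HV' 1 0 1 0 1), (HV' 1 0 (-1) 0 (-1)), (HV' 1 0 0 0 0), (HV' (-1) 0 1 0 (-1)), (HV' (-1) 0 (-1) 0 1), (HV' (-1) 0 0 0 0),
      (HV' 0 0 1 0 0), (HV' 0 0 (-1) 0 0), (HV' 0 0 0 0 0), K0; try (rewrite ?A0, ?A1, ?Am; lra).
    rewrite Cconj_RtoC. apply injective_projections; simpl; ring.
  - unfold V2, h. rewrite !herm_minus_l, !herm_minus_r. fold h.
    rewrite (HV' 1 1 1 1 2), (HV' 1 1 1 (-1) 0), (HV' 1 1 (-1) 1 0), (HV' 1 1 (-1) (-1) (-2)),
     (HV' 1 (-1) 1 1 0), (HV' 1 (-1) 1 (-1) 2), (HV' 1 (-1) (-1) 1 (-2)), (HV' 1 (-1) (-1) (-1) 0),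
     (HV' (-1) 1 1 1 0), (HV' (-1) 1 1 (-1) (-2)), (HV' (-1) 1 (-1) 1 2), (HV' (-1) 1 (-1) (-1) 0),
     (HV' (-1) (-1) 1 1 (-2)), (HV' (-1) (-1) 1 (-1) 0), (HV' (-1) (-1) (-1) 1 0), (HV' (-1) (-1) (-1) (-1) 2), K0; try (rewrite ?A0, ?A1, ?Am; lra).
    apply injective_projections; simpl; ring.
  - unfold V1, h. rewrite !herm_minus_r, !herm_plus_r, !herm_scal_r. fold h.
    rewrite (HV' 0 0 1 0 0), (HV' 0 0 (-1) 0 0), (HV' 0 0 0 0 0), K0; try (rewrite ?A0, ?A1, ?Am; lra).
    rewrite Cconj_RtoC. apply injective_projections; simpl; ring.
  - unfold V2, h. rewrite !herm_minus_r. fold h.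
    rewrite (HV' 0 0 1 1 0), (HV' 0 0 1 (-1) 0), (HV' 0 0 (-1) 1 0), (HV' 0 0 (-1) (-1) 0), K0; try (rewrite ?A0, ?A1, ?Am; lra).
    apply injective_projections; simpl; ring.
  - unfold V1, V2, h. rewrite !herm_minus_l, !herm_plus_l, !herm_scal_l, !herm_minus_r. fold h.
    rewrite (HV' 1 0 1 1 1), (HV' 1 0 1 (-1) 1), (HV' 1 0 (-1) 1 (-1)), (HV' 1 0 (-1) (-1) (-1)),
      (HV' (-1) 0 1 1 (-1)), (HV' (-1) 0 1 (-1) (-1)), (HV' (-1) 0 (-1) 1 1), (HV' (-1) 0 (-1) (-1) 1),
      (HV' 0 0 1 1 0), (HV' 0 0 1 (-1) 0), (HV' 0 0 (-1) 1 0), (HV' 0 0 (-1) (-1) 0); try (rewrite ?A0, ?A1, ?Am; lra).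
    apply injective_projections; simpl; ring.
Qed.

Lemma sumR_derive q (f : nat -> R -> R) (f' : nat -> R) x : (forall i, (i < q)%nat -> is_derive (f i) x (f' i)) ->
  is_derive (fun y => sumR q (fun i => f i y)) x (sumR q f').
Proof.
  induction q; intros H.
  - change (is_derive (fun _ : R => 0) x 0). apply (is_derive_const (K := R_AbsRing) (V := R_NormedModule)).
  - apply (is_derive_Rplus (fun y => sumR q (fun i => f i y)) (f q)); auto.
Qed.

(** The [k]-th derivative at [s = 0] is, up to a nonzero factor, the power sum of [t_i ^ k] with weights [c_i]. *)
Lemma binomial_independent q mu d (t c : nat -> R) : 0 < mu < 1 -> 0 < d -> (forall i, (i < q)%nat -> 0 < t i /\ t i * d < 1) ->
  (forall i j, (i < q)%nat -> (j < q)%nat -> i <> j -> t i <> t j) ->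
  (forall s, Rabs s < d -> sumR q (fun i => c i * Rpower (1 - t i * s) mu) = 0) -> forall i, (i < q)%nat -> c i = 0.
Proof.
  intros Hmu Hd Ht Hd' H. apply (vandermonde_injective q t c Hd').
  assert (Pos : forall i s, (i < q)%nat -> Rabs s < d -> 0 < 1 - t i * s).
  { intros i s Hi Hs. destruct (Ht i Hi). apply Rabs_def2 in Hs. nra. }
  (* Each differentiation brings out the common factor [- (mu - k)], which is nonzero because
     [0 < mu < 1]. *)
  assert (G : forall k s, Rabs s < d -> sumR q (fun i => c i * t i ^ k * Rpower (1 - t i * s) (mu - INR k)) = 0).
  { induction k as [|k IH]; intros s Hs.
    - rewrite <- (H s Hs) at 1. apply sumR_ext. intros. simpl. rewrite Rminus_0_r. ring.
    - assert (D : is_derive (fun s => sumR q (fun i => c i * t i ^ k * Rpower (1 - t i * s) (mu - INR k))) s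
        (sumR q (fun i => (- (mu - INR k)) * (c i * t i ^ S k * Rpower (1 - t i * s) (mu - INR (S k)))))).
      { apply (sumR_derive q (fun i s => c i * t i ^ k * Rpower (1 - t i * s) (mu - INR k))). intros i Hi.
        pose proof (Pos i s Hi Hs) as Pi.
        assert (D1 : is_derive (fun s => 1 - t i * s) s (- t i)). { apply is_derive_Reals. replace (- t i) with (0 - t i * 1) by ring.
          apply derivable_pt_lim_minus; [apply derivable_pt_lim_const|]. apply derivable_pt_lim_scal, derivable_pt_lim_id. }
        pose proof (is_derive_comp (fun x => Rpower x (mu - INR k)) (fun s => 1 - t i * s) s _ _ (Rpower_derive _ _ Pi) D1) as D2.
        assert (D3 : is_derive (fun s => Rpower (1 - t i * s) (mu - INR k)) s (- t i * ((mu - INR k) * Rpower (1 - t i * s) (mu - INR k - 1)))) by exact D2.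
        eapply is_derive_eq. apply is_derive_Rmult. apply (is_derive_const (K := R_AbsRing) (V := R_NormedModule)). exact D3.
        replace (mu - INR (S k)) with (mu - INR k - 1) by (rewrite S_INR; ring).
        change (@zero R_NormedModule) with 0. simpl (t i ^ S k). ring. }
      assert (D0 : is_derive (fun s => sumR q (fun i => c i * t i ^ k * Rpower (1 - t i * s) (mu - INR k))) s 0).
      { eapply is_derive_ext_loc; [|apply (is_derive_const (K := R_AbsRing) (V := R_NormedModule) 0)].
        assert (Hp : 0 < d - Rabs s) by lra. exists (mkposreal _ Hp). intros y Hy. symmetry. apply IH.
        unfold Hierarchy.ball in Hy; simpl in Hy; unfold AbsRing_ball, abs, minus, plus, opp in Hy; simpl in Hy.
        assert (TT : forall y : R, Rabs y <= Rabs (y + - s) + Rabs s).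
        { intros y'. pose proof (Rabs_triang (y' + - s) s) as T. replace (y' + - s + s) with y' in T by ring. exact T. }
        specialize (TT y). lra. }
      pose proof (is_derive_unique _ _ _ D) as E1. rewrite (is_derive_unique _ _ _ D0) in E1. rewrite sumR_scal in E1.
      symmetry in E1. apply Rmult_integral in E1. destruct E1 as [E1|E1]; auto. exfalso.
      destruct k as [|k]; [simpl in E1; lra|]. assert (1 <= INR (S k)). { rewrite S_INR. pose proof (pos_INR k). lra. } lra. }
  intros k. rewrite <- (G k 0) at 1 by (rewrite Rabs_R0; auto). apply sumR_ext. intros i Hi.
  rewrite Rmult_0_r, Rminus_0_r. unfold Rpower. rewrite ln_1, Rmult_0_r, exp_0. ring.
Qed.

Lemma sumC_RtoC q (f : nat -> R) : sumC q (fun i => RtoC (f i)) = RtoC (sumR q f).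
Proof. induction q; [reflexivity|]. rewrite sumC_S, IHq. simpl sumR. rewrite RtoC_plus. auto. Qed.

Lemma fst_sumC q (f : nat -> C) : fst (sumC q f) = sumR q (fun i => fst (f i)).
Proof. induction q; simpl; auto. rewrite IHq. auto. Qed.

Lemma snd_sumC q (f : nat -> C) : snd (sumC q f) = sumR q (fun i => snd (f i)).
Proof. induction q; simpl; auto. rewrite IHq. auto. Qed.

(** For [mu < 1] the functions (1 - t_i s)^mu of [s] are linearly independent, whatever their
    number. But they are products with values of [psi], which lie in a space of dimension m + 2, so
    sufficiently many of them satisfy a relation. *)
Lemma isometric_constant_ge_1 n m F mu d : (2 <= n)%nat -> 0 < mu -> (forall a, bholo n (fun z => lift m (F z) a)) -> flat n m F mu ->
  DIV m (F vzero) -> 0 < d -> d <= / 4 -> kernel_nonzero n m F d -> 1 <= mu.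
Proof.
  intros Hn Hmu0 HB HX HD Hd Hd4 HK. apply Rnot_lt_le. intros Hmu.
  (* One more point than the [2 * M] real equations. The shift in [INR (i + 2)] keeps the points
     distinct and strictly below [d]. *)
  set (M := S (S m)). set (q := S (M + M)). set (t := fun i => d / INR (i + 2)).
  assert (Ht : forall i, 0 < t i < d).
  { intros i. unfold t. assert (1 < INR (i + 2)). { rewrite plus_INR. simpl. pose proof (pos_INR i). lra. }
    split; [apply Rdiv_lt_0_compat; lra|]. apply Rmult_lt_reg_r with (INR (i + 2)); [lra|]. unfold Rdiv. rewrite Rmult_assoc, Rinv_l; nra. }
  assert (Hpt : forall s, Rabs s < d -> supported n (real_point s 0) /\ normn n (real_point s 0) < d).
  { intros s Hs. destruct (real_point_norm n s 0 Hn) as [A B]. rewrite Rabs_R0 in B. split; auto. lra. }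
  destruct (underdetermined_system (M + M) q
    (fun i k => if Nat.ltb i M then fst (psi m F (real_point (t k) 0) i) else snd (psi m F (real_point (t k) 0) (i - M)%nat)) ltac:(unfold q; lia))
    as [c [[k0 [Hk0 Hc0]] Hc]].
  apply Hc0.
  assert (Z : forall a, (a < M)%nat -> sumC q (fun k => (RtoC (c k) * psi m F (real_point (t k) 0) a)%C) = RtoC 0).
  { intros a Ha. apply injective_projections.
    - rewrite fst_sumC. change (fst (RtoC 0)) with 0. specialize (Hc a ltac:(lia)). apply Nat.ltb_lt in Ha. rewrite Ha in Hc.
      etransitivity; [|exact Hc]. apply sumR_ext. intros k _. unfold Cmult, RtoC; cbn [fst snd]. ring.
    - rewrite snd_sumC. change (snd (RtoC 0)) with 0. specialize (Hc (M + a)%nat ltac:(lia)).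
      assert (E : Nat.ltb (M + a) M = false) by (apply Nat.ltb_ge; lia). rewrite E in Hc.
      replace (M + a - M)%nat with a in Hc by lia.
      etransitivity; [|exact Hc]. apply sumR_ext. intros k _. unfold Cmult, RtoC; cbn [fst snd]. ring. }
  apply (binomial_independent q mu d t c); auto.
  - intros i _. destruct (Ht i). split; auto. nra.
  - intros i j _ _ Hij E. apply Hij. unfold t in E.
    assert (E2 : INR (i + 2) = INR (j + 2)).
    { assert (INR (i + 2) <> 0) by (apply not_0_INR; lia). assert (INR (j + 2) <> 0) by (apply not_0_INR; lia).
      apply (f_equal (fun x => x * INR (i + 2) * INR (j + 2) / d)) in E. field_simplify in E; try (repeat split; auto; lra). }
    apply INR_eq in E2. lia.
  - intros s Hs. destruct (Hpt s Hs) as [S1 S2].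
    assert (Q : herm M (sgnIV m) (fun a => sumC q (fun k => (RtoC (c k) * psi m F (real_point (t k) 0) a)%C)) (psi m F (real_point s 0)) = RtoC 0).
    { apply sumC_zero. intros a Ha. rewrite Z by auto. cring. }
    rewrite herm_sum_l in Q.
    rewrite (sumC_ext q _ (fun k => RtoC (c k * Rpower (1 - t k * s) mu))) in Q.
    + rewrite sumC_RtoC in Q. injection Q. auto.
    + intros k _. rewrite RtoC_mult. f_equal. destruct (Ht k). destruct (Hpt (t k)) as [S3 S4]. { rewrite Rabs_right; lra. }
      apply (psi_power n m F mu d); auto. rewrite cprod_real_point by auto. f_equal. ring.
Qed.

Theorem isometric_constant_eq_1 n m F mu : (2 <= n)%nat -> 0 < mu -> (forall a, bholo n (fun z => lift m (F z) a)) -> flat n m F mu ->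
  DIV m (F vzero) -> mu = 1.
Proof.
  intros Hn Hmu HB HX HD. destruct (kernel_nonzero_near n m F HB HD) as [d [Hd [Hd4 HK]]].
  apply Rle_antisym; [eapply isometric_constant_le_1|eapply isometric_constant_ge_1]; eauto.
Qed.

(** * Identity theorem on the ball and the span of the lift *)

Lemma HolB_zero_near rho d f : 0 < rho -> 0 < d -> HolB rho f -> (forall t, Cmod t < d -> f t = RtoC 0) ->
  forall t, Cmod t < rho -> f t = RtoC 0.
Proof.
  intros Hrho Hd Hf Hz.
  set (P := fun g => HolB rho g /\ (forall t, Cmod t < Rmin d rho -> g t = RtoC 0)).
  assert (St : forall g, P g -> exists g', P g' /\ forall t, Cmod t < rho -> cderiv g t (g' t)).
  { intros g [Hg Zg]. destruct (HolB_derivative rho g Hg) as [g' [Hg' Dg]]. exists g'. split; auto. split; auto.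
    intros t Ht. eapply cderiv_unique; [apply Dg; eapply Rlt_le_trans; [exact Ht|apply Rmin_r]|].
    apply (cderiv_ext_loc (fun _ => RtoC 0) g t _ (Rmin d rho - Cmod t)); [lra| |apply cderiv_const].
    intros h Hh. symmetry. apply Zg. eapply Rle_lt_trans; [apply Cmod_triangle|]. lra. }
  set (next := fun g : C -> C => epsilon (inhabits g) (fun g' => P g' /\ forall t, Cmod t < rho -> cderiv g t (g' t))).
  set (D := fix D (k : nat) := match k with O => f | S k' => next (D k') end).
  assert (PD : forall k, P (D k)).
  { induction k; simpl.
    - split; auto. intros t Ht. apply Hz. eapply Rlt_le_trans; [exact Ht|apply Rmin_l].
    - apply (epsilon_spec (inhabits (D k)) _ (St (D k) IHk)). }
  apply (holomorphic_identity rho D).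
  - intros k t Ht. simpl. apply (epsilon_spec (inhabits (D k)) _ (St (D k) (PD k))). exact Ht.
  - apply Hf.
  - intros k. apply PD. rewrite Cmod_0. apply Rmin_pos; auto.
Qed.

Lemma bholo_zero_near n f d : bholo n f -> 0 < d -> (forall z, supported n z -> normn n z < d -> f z = RtoC 0) ->
  forall z, Defs.ball n z -> f z = RtoC 0.
Proof.
  intros Hf Hd H z Hz. apply ball_normn in Hz. destruct Hz as [Sz Nz]. pose proof (normn_nonneg n z).
  (* A radius larger than 1 for which the line from the origin through [z] is still in the ball. *)
  set (rho := 2 / (1 + normn n z)).
  assert (Hrho : 1 < rho). { unfold rho. apply Rmult_lt_reg_r with (1 + normn n z); [lra|]. unfold Rdiv. rewrite Rmult_assoc, Rinv_l; lra. }
  assert (Hr : rho * normn n z < 1).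
  { unfold rho. apply Rmult_lt_reg_r with (1 + normn n z); [lra|].
    replace (2 / (1 + normn n z) * normn n z * (1 + normn n z)) with (2 * normn n z) by (field; lra). lra. }
  assert (HL : HolB rho (fun t => f (line vzero z t))).
  { apply bholo_line_HolB with (n := n); auto. apply supported_vzero. rewrite normn_vzero. lra. }
  assert (Q := HolB_zero_near rho (d / (normn n z + 1)) _ ltac:(lra) ltac:(apply Rdiv_lt_0_compat; lra) HL).
  assert (E : line vzero z 1%C = z).
  { apply functional_extensionality; intros k. unfold line, vadd, cscale, vzero. change (0 + 1 * z k = z k)%C. cring. }
  rewrite <- E. apply Q; [|rewrite Cmod_1; lra]. intros t Ht. apply H.
  - apply supported_line; auto. apply supported_vzero.
  - eapply Rle_lt_trans; [apply normn_line|]. rewrite normn_vzero.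
    assert (Cmod t * (normn n z + 1) < d).
    { replace d with (d / (normn n z + 1) * (normn n z + 1)) by (field; lra). apply Rmult_lt_compat_r; lra. }
    pose proof (Cmod_ge_0 t). nra.
Qed.

(** The complement of the span of [psi 0] and the [n] first differences is isotropic,
    hence at most one-dimensional. *)
Lemma psi_span n m F d : (forall a, bholo n (fun z => lift m (F z) a)) -> flat n m F 1 ->
  DIV m (F vzero) -> 0 < d -> d <= / 4 -> kernel_nonzero n m F d ->
  exists (B : nat -> nat -> C) (E0 : nat -> C), forall z, supported n z -> normn n z < d ->
    exists l : C, forall a, (a < S (S m))%nat ->
      psi m F z a = (psi m F vzero a + sumC n (fun k => (z k * B k a)%C) + l * E0 a)%C.
Proof.
  intros HB HX HD Hd Hd4 HK. set (h := herm (S (S m)) (sgnIV m)). set (A := psi m F vzero). set (r := d / 2).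
  assert (Hr : 0 < r < d) by (unfold r; lra).
  assert (HA : forall z w, supported n z -> supported n w -> normn n z < d -> normn n w < d -> h (psi m F z) (psi m F w) = (1 - cprod n z w)%C).
  { intros. apply (psi_affine n m F d); auto. }
  set (re := fun k => cscale r (ex k)).
  assert (Hre : forall k, (k < n)%nat -> supported n (re k) /\ normn n (re k) < d).
  { intros k Hk. unfold re. split; [apply supported_cscale, supported_ex; auto|].
    rewrite normn_cscale, normn_ex, Cmod_R, Rabs_right by (auto; lra). lra. }
  assert (H0 : supported n vzero /\ normn n vzero < d). { split; [apply supported_vzero|rewrite normn_vzero; auto]. }
  (* [B k] is a first difference quotient and [En z] the remainder of [psi] after its affine
     part. *)
  set (B := fun k a => ((psi m F (re k) a - A a) / r)%C).
  set (En := fun z a => (psi m F z a - A a - sumC n (fun k => (z k * B k a)%C))%C).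
  assert (Cp0 : forall w, cprod n vzero w = RtoC 0). { intros. apply sumC_zero. intros. unfold vzero. cring. }
  assert (Cp0' : forall w, cprod n w vzero = RtoC 0). { intros. apply sumC_zero. intros. unfold vzero. rewrite Cconj_RtoC. cring. }
  assert (Nr : RtoC r <> RtoC 0) by (apply RtoC_neq; lra).
  assert (BW : forall k w, (k < n)%nat -> supported n w -> normn n w < d -> h (B k) (psi m F w) = (- Cconj (w k)%C)%C).
  { intros k w Hk Sw Nw. destruct (Hre k Hk) as [S1 N1].
    assert (Ec : cprod n (re k) w = (r * Cconj (w k)%C)%C).
    { unfold cprod. rewrite (sumC_ext n _ (fun a => (kdelta k a * (r * Cconj (w a)%C))%C)).
      - rewrite kdelta_sum_l; auto.
      - intros a _. unfold re, cscale, ex, kdelta. rewrite (Nat.eqb_sym k a). destruct (Nat.eqb a k).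
        + change (r * 1 * Cconj (w a)%C = 1 * (r * Cconj (w a)%C))%C. cring.
        + change (r * 0 * Cconj (w a)%C = 0 * (r * Cconj (w a)%C))%C. cring. }
    assert (EB : h (B k) (psi m F w) = ((/ r) * (h (psi m F (re k)) (psi m F w) - h A (psi m F w)))%C).
    { unfold h. rewrite <- herm_minus_l, <- herm_scal_l. apply herm_ext; auto. intros. unfold B, Cdiv. cring. }
    rewrite EB, HA by auto. unfold A. rewrite HA by (auto; apply H0). rewrite Ec, Cp0. field. auto. }
  (* Since the kernel [1 - cprod n z w] is affine in [z], the remainder is orthogonal to all values
     of [psi]; being a combination of such values, the remainders are also orthogonal to one
     another. *)
  assert (EW : forall z w, supported n z -> normn n z < d -> supported n w -> normn n w < d -> h (En z) (psi m F w) = RtoC 0).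
  { intros z w Sz Nz Sw Nw. unfold En, h. rewrite !herm_minus_l. rewrite (herm_sum_l _ _ n z B). fold h.
    rewrite HA by auto. unfold A. rewrite HA by (auto; apply H0). rewrite Cp0.
    rewrite (sumC_ext n _ (fun k => (-(1)) * (z k * Cconj (w k)%C))%C).
    - rewrite sumC_scal. fold (cprod n z w). cring.
    - intros k Hk. rewrite BW by auto. cring. }
  assert (WE : forall z w, supported n z -> normn n z < d -> supported n w -> normn n w < d -> h (psi m F w) (En z) = RtoC 0).
  { intros. unfold h. rewrite <- herm_conj. fold h. rewrite EW by auto. apply Cconj_RtoC. }
  assert (EE : forall z w, supported n z -> normn n z < d -> supported n w -> normn n w < d -> h (En z) (En w) = RtoC 0).
  { intros z w Sz Nz Sw Nw. unfold En at 2, h. rewrite !herm_minus_r. fold h. unfold A at 1.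
    rewrite !EW by (auto; apply H0).
    assert (Z : herm (S (S m)) (sgnIV m) (En z) (fun a => sumC n (fun k => (w k * B k a)%C)) = RtoC 0).
    { rewrite (herm_sum_r _ _ n w B). apply sumC_zero. intros k Hk. fold h. destruct (Hre k Hk) as [S1 N1].
      assert (EB : h (En z) (B k) = (Cconj (/ r)%C * (h (En z) (psi m F (re k)) - h (En z) A))%C).
      { unfold h. rewrite <- herm_minus_r, <- herm_scal_r. apply herm_ext; auto. intros. unfold B, Cdiv. cring. }
      rewrite EB. unfold A. rewrite !EW by (auto; apply H0). cring. }
    fold h in Z. rewrite Z. cring. }
  assert (AA : h A A = RtoC 1). { unfold A. rewrite HA by apply H0. rewrite Cp0. cring. }
  assert (Dec : forall z a, psi m F z a = (A a + sumC n (fun k => (z k * B k a)%C) + En z a)%C).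
  { intros. unfold En. cring. }
  (* Any nonzero remainder serves as [E0], all others being multiples of it; if there is none,
     [E0 = 0]. *)
  destruct (classic (exists z0 a0, supported n z0 /\ normn n z0 < d /\ (a0 < S (S m))%nat /\ En z0 a0 <> RtoC 0)) as [(z0 & a0 & S0 & N0 & Ha0 & NE)|NE].
  - exists B, (En z0). intros z Sz Nz.
    destruct (isotropic_collinear m A (En z) (En z0)) as (y & x & Nyx & Hyx); auto; try (fold h; unfold A; apply WE; auto; apply H0); try (fold h; apply EE; auto).
    assert (Ny : y <> RtoC 0).
    { intros Hy. apply NE. assert (Q := Hyx a0 Ha0). rewrite Hy in Q.
      assert (Nx : x <> RtoC 0). { intros Hx. apply Nyx. auto. }
      replace (En z0 a0) with (/ x * (0 * En z a0 + x * En z0 a0))%C by (field; auto). rewrite Q. cring. }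
    exists (- x / y)%C. intros a Ha. rewrite Dec. f_equal.
    specialize (Hyx a Ha). transitivity (/ y * (y * En z a + x * En z0 a) + - x / y * En z0 a)%C; [field; auto|].
    rewrite Hyx. cring.
  - exists B, (fun _ => RtoC 0). intros z Sz Nz. exists (RtoC 0). intros a Ha. rewrite Dec.
    assert (Z : En z a = RtoC 0). { apply NNPP. intros Q. apply NE. exists z, a. auto. }
    rewrite Z. cring.
Qed.

(** * Real functionals vanishing on the image *)

(** The functionals that are real for the conjugation exchanging the coordinates [m] and [S m],
    whence the pair [p], [Cconj p] and the real [c]. Reflections in these preserve both the
    Hermitian form and the quadric containing the lift. *)
Definition lin (m : nat) (p : C) (c : nat -> R) (V : nat -> C) : C :=
  (p * V m + Cconj p * V (S m) - sumC m (fun k => (c k * V k)%C))%C.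

Lemma lin_scal m p c x V : lin m p c (fun a => x * V a)%C = (x * lin m p c V)%C.
Proof.
  unfold lin. rewrite (sumC_ext m _ (fun k => (x * (c k * V k))%C)) by (intros; cring). rewrite sumC_scal. cring.
Qed.

Lemma lin_plus m p c V W : lin m p c (fun a => V a + W a)%C = (lin m p c V + lin m p c W)%C.
Proof.
  unfold lin. rewrite (sumC_ext m _ (fun k => (c k * V k + c k * W k)%C)) by (intros; cring). rewrite sumC_plus. cring.
Qed.

Lemma lin_sum m p c n (z : nat -> C) (B : nat -> nat -> C) :
  lin m p c (fun a => sumC n (fun k => (z k * B k a)%C)) = sumC n (fun k => (z k * lin m p c (B k))%C).
Proof.
  induction n.
  - unfold lin. change (p * 0 + Cconj p * 0 - sumC m (fun k => (c k * 0)%C) = 0)%C.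
    rewrite sumC_zero; [cring|]. intros; cring.
  - rewrite sumC_S, <- IHn, <- lin_scal, <- lin_plus. auto.
Qed.

Lemma lin_ext m p c V W : (forall a, (a < S (S m))%nat -> V a = W a) -> lin m p c V = lin m p c W.
Proof. intros H. unfold lin. rewrite !H by lia. f_equal. apply sumC_ext. intros. rewrite H; auto. Qed.

(** The [j + 2] real unknowns are [Re p], [Im p] and [c_0, ..., c_(j-1)]. *)
Lemma real_functional m j q (V : nat -> nat -> C) : (j <= m)%nat -> (2 * q < j + 2)%nat ->
  exists (p : C) (c : nat -> R), (forall k, (j <= k)%nat -> c k = 0) /\ (p <> RtoC 0 \/ exists k, (k < j)%nat /\ c k <> 0) /\
    forall r, (r < q)%nat -> lin m p c (V r) = RtoC 0.
Proof.
  intros Hj Hq.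
  (* Coefficient of the real unknown [u] in the complex equation [r]: the unknowns [c_u] come first,
     then Re p and Im p. *)
  set (coef := fun r u => if Nat.ltb u j then (- V r u)%C else if Nat.eqb u j then (V r m + V r (S m))%C else (Ci * (V r m - V r (S m)))%C).
  destruct (underdetermined_system (q + q) (S (S j)) (fun i u => if Nat.ltb i q then fst (coef i u) else snd (coef (i - q)%nat u)) ltac:(lia))
    as [x [[u0 [Hu0 Hx0]] Hx]].
  assert (Hc : forall r, (r < q)%nat -> sumC (S (S j)) (fun u => (RtoC (x u) * coef r u)%C) = RtoC 0).
  { intros r Hr. apply injective_projections.
    - rewrite fst_sumC. change (fst (RtoC 0)) with 0. specialize (Hx r ltac:(lia)). apply Nat.ltb_lt in Hr. rewrite Hr in Hx.
      etransitivity; [|exact Hx]. apply sumR_ext. intros k _. unfold Cmult, RtoC; cbn [fst snd]. ring.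
    - rewrite snd_sumC. change (snd (RtoC 0)) with 0. specialize (Hx (q + r)%nat ltac:(lia)).
      assert (E : Nat.ltb (q + r) q = false) by (apply Nat.ltb_ge; lia). rewrite E in Hx.
      replace (q + r - q)%nat with r in Hx by lia.
      etransitivity; [|exact Hx]. apply sumR_ext. intros k _. unfold Cmult, RtoC; cbn [fst snd]. ring. }
  exists ((x j, x (S j)) : C), (fun k => if Nat.ltb k j then x k else 0). split; [|split].
  - intros k Hk. destruct (Nat.ltb_spec k j); [lia|auto].
  - destruct (Nat.lt_ge_cases u0 j) as [L|L].
    + right. exists u0. split; auto. apply Nat.ltb_lt in L. rewrite L. auto.
    + left. intros Z. injection Z. intros Z2 Z1. assert (u0 = j \/ u0 = S j) as [-> | ->] by lia; auto.
  - intros r Hr. rewrite <- (Hc r Hr). rewrite !sumC_S. unfold coef at 2 3.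
    rewrite Nat.ltb_irrefl, Nat.eqb_refl. destruct (Nat.ltb_spec (S j) j); [lia|]. destruct (Nat.eqb_spec (S j) j); [lia|].
    unfold lin.
    assert (E : sumC m (fun k => (RtoC (if Nat.ltb k j then x k else 0) * V r k)%C) = (- sumC j (fun u => (RtoC (x u) * coef r u)%C))%C).
    { replace m with (j + (m - j))%nat by lia.
      assert (G : forall t, sumC (j + t) (fun k => (RtoC (if Nat.ltb k j then x k else 0) * V r k)%C) = (- sumC j (fun u => (RtoC (x u) * coef r u)%C))%C).
      { induction t.
        - rewrite Nat.add_0_r. transitivity ((-(1)) * sumC j (fun u => (RtoC (x u) * coef r u)%C))%C; [|cring].
          rewrite <- sumC_scal. apply sumC_ext. intros k Hk. unfold coef. apply Nat.ltb_lt in Hk. rewrite Hk. cring.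
        - rewrite Nat.add_succ_r, sumC_S, IHt. destruct (Nat.ltb_spec (j + t) j); [lia|]. cring. }
      apply G. }
    rewrite E.
    set (s := sumC j (fun u => (RtoC (x u) * coef r u)%C)).
    replace ((x j, x (S j)) : C) with (x j + Ci * x (S j))%C by (apply injective_projections; simpl; ring).
    replace (Cconj (x j + Ci * x (S j))%C) with (x j - Ci * x (S j))%C by (apply injective_projections; simpl; ring).
    cring.
Qed.

(** The n + 2 spanning vectors impose 2n + 4 real equations on j + 2 unknowns, so a solution exists
    as soon as j > 2n + 2. The coefficients vanish from index [j] on, so that the reflection built
    from them does not disturb the coordinates already removed. *)
Theorem isometry_real_functional n m F j : (2 <= n)%nat -> (2 * n + 2 < j)%nat -> (j <= m)%nat -> holo_isometry_ball_IV n m F ->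
  exists (p : C) (c : nat -> R), (forall k, (j <= k)%nat -> c k = 0) /\ (p <> RtoC 0 \/ exists k, (k < j)%nat /\ c k <> 0) /\
    forall z, Defs.ball n z -> lin m p c (lift m (F z)) = RtoC 0.
Proof.
  intros Hn Hj Hjm HI.
  destruct (isometry_polarized n m F ltac:(lia) HI) as [mu [Hmu HX]].
  destruct HI as (HF & HD & _).
  assert (HB : forall a, bholo n (fun z => lift m (F z) a)) by (intros; apply bholo_lift; auto).
  assert (HD0 : DIV m (F vzero)) by (apply HD, ball_vzero).
  assert (E1 := isometric_constant_eq_1 n m F mu Hn Hmu HB HX HD0). subst mu.
  destruct (kernel_nonzero_near n m F HB HD0) as [d [Hd [Hd4 HK]]].
  destruct (psi_span n m F d HB HX HD0 Hd Hd4 HK) as (B & E0 & Hspan).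
  (* The n first differences, the value at the origin and the isotropic vector. *)
  set (V := fun r => if Nat.ltb r n then B r else if Nat.eqb r n then psi m F vzero else E0).
  destruct (real_functional m j (S (S n)) V Hjm ltac:(lia)) as (p & c & Hc & Hne & Hpc).
  exists p, c. split; auto. split; auto.
  apply (bholo_zero_near n (fun z => lin m p c (lift m (F z))) d); auto.
  - unfold lin. eapply bholo_eq_on_ball.
    + apply bholo_plus. apply bholo_plus. apply (bholo_mult n (fun _ => p)); [apply bholo_const|apply (HB m)].
      apply (bholo_mult n (fun _ => Cconj p)); [apply bholo_const|apply (HB (S m))].
      apply (bholo_mult n (fun _ => (-(1))%C)); [apply bholo_const|].
      apply (bholo_sumC n m (fun k z => (c k * lift m (F z) k)%C)). intros k _. apply bholo_mult; [apply bholo_const|apply HB].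
    + intros z. cbv beta. cring.
  - intros z Sz Nz. destruct (Hspan z Sz Nz) as [l Hl].
    assert (Q : lin m p c (psi m F z) = RtoC 0).
    { rewrite (lin_ext m p c _ _ Hl). rewrite !lin_plus, lin_sum, lin_scal.
      assert (Z1 := Hpc n ltac:(lia)). assert (Z2 := Hpc (S n) ltac:(lia)). unfold V in Z1, Z2.
      rewrite Nat.ltb_irrefl, Nat.eqb_refl in Z1. destruct (Nat.ltb_spec (S n) n); [lia|]. destruct (Nat.eqb_spec (S n) n); [lia|].
      change (fun a => psi m F vzero a) with (psi m F vzero). change (fun a => E0 a) with E0. rewrite Z1, Z2, sumC_zero; [cring|].
      intros k Hk. assert (Zk := Hpc k ltac:(lia)). unfold V in Zk. apply Nat.ltb_lt in Hk. rewrite Hk in Zk. rewrite Zk. cring. }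
    unfold psi in Q. rewrite lin_scal in Q.
    assert (Nk : kernIV m F z vzero <> RtoC 0). { apply HK; auto. apply supported_vzero. rewrite normn_vzero; auto. }
    assert (Ns : RtoC (sqrt (hermR (S (S m)) (sgnIV m) (lift m (F vzero)))) <> RtoC 0).
    { apply RtoC_neq. apply Rgt_not_eq. apply sqrt_lt_R0. apply typeIV_q_pos; auto. }
    set (s := RtoC (sqrt (hermR (S (S m)) (sgnIV m) (lift m (F vzero))))) in *. set (kk := kernIV m F z vzero) in *.
    replace (lin m p c (lift m (F z))) with (kk / s * (s / kk * lin m p c (lift m (F z))))%C by (field; auto).
    rewrite Q. cring.
Qed.

(** * Reflections of the type IV domain *)

Ltac cfield := cbv beta; lazymatch goal with |- @eq _ ?a ?b => change (@eq Complex.C a b) end; field.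

Definition cdotR (m : nat) (c : nat -> R) (Z : vec) : C := sumC m (fun k => (c k * Z k)%C).
Definition sqR (m : nat) (c : nat -> R) : R := sumR m (fun k => c k ^ 2).

Lemma sqnorm_parts m Z : sqnorm m Z = sqR m (fun k => fst (Z k)) + sqR m (fun k => snd (Z k)).
Proof. unfold sqnorm, sqR. rewrite <- sumR_plus. apply sumR_ext. intros. unfold Cnorm2. ring. Qed.

Lemma zzt_parts m Z : zzt m Z = (sqR m (fun k => fst (Z k)) - sqR m (fun k => snd (Z k)), 2 * sumR m (fun k => fst (Z k) * snd (Z k))) :> C.
Proof.
  apply injective_projections; unfold zzt; cbn [fst snd].
  - rewrite fst_sumC. unfold sqR, Rminus. rewrite <- sumR_opp, <- sumR_plus. apply sumR_ext. intros. unfold Cmul; simpl. ring.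
  - rewrite snd_sumC, <- sumR_scal. apply sumR_ext. intros. unfold Cmul; simpl. ring.
Qed.

Lemma cdotR_parts m c Z : cdotR m c Z = (sumR m (fun k => c k * fst (Z k)), sumR m (fun k => c k * snd (Z k))) :> C.
Proof.
  apply injective_projections; unfold cdotR; cbn [fst snd].
  - rewrite fst_sumC. apply sumR_ext. intros. unfold Cmult; simpl. ring.
  - rewrite snd_sumC. apply sumR_ext. intros. unfold Cmult; simpl. ring.
Qed.

Lemma sum_of_squares m (c x y : nat -> R) a b g :
  0 <= a ^ 2 * sqR m c + b ^ 2 * sqR m x + g ^ 2 * sqR m y + 2 * a * b * sumR m (fun k => c k * x k) +
    2 * a * g * sumR m (fun k => c k * y k) + 2 * b * g * sumR m (fun k => x k * y k).
Proof.
  unfold sqR. rewrite <- !sumR_scal, <- !sumR_plus. apply sumR_nonneg. intros k _.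
  match goal with |- 0 <= ?X => replace X with ((a * c k + b * x k + g * y k) ^ 2) by ring end. apply pow2_ge_0.
Qed.

(** The vector [w c - 2 Re (eta Z)] has nonnegative square norm, where [eta] is chosen so that
    its component along the positive plane vanishes. *)
Lemma reflection_inequality m (p : C) (c : nat -> R) Z :
  let s := zzt m Z in let w := 1 - Cmod s ^ 2 / 4 in let eta := (Cconj p - p * Cconj s / 2)%C in
  2 * Cmod eta ^ 2 * typeIV_q m Z <=
    w * (w * (sqR m c + 2 * Cmod p ^ 2) - 4 * fst (eta * cdotR m c Z)%C).
Proof.
  intros s w eta.
  set (w0 := w). set (e1 := fst eta). set (e2 := snd eta).
  (* For Z = x + i y the real part of eta Z is e1 x - e2 y, which explains the coefficients
     [- 2 * e1] and [2 * e2]. *)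
  pose proof (sum_of_squares m c (fun k => fst (Z k)) (fun k => snd (Z k)) w0 (- 2 * e1) (2 * e2)) as Q.
  unfold typeIV_q. rewrite sqnorm_parts, cdotR_parts.
  unfold w0, w, eta, s in *. clear w0 w.
  unfold e1, e2 in Q. clear e1 e2. revert Q. unfold eta, s. clear eta s. rewrite Cnorm2_Cmod, !Cmod2_alt, !zzt_parts.
  set (X := sqR m (fun k => fst (Z k))). set (Y := sqR m (fun k => snd (Z k))).
  set (XY := sumR m (fun k => fst (Z k) * snd (Z k))).
  set (cx := sumR m (fun k => c k * fst (Z k))). set (cy := sumR m (fun k => c k * snd (Z k))).
  set (cc := sqR m c). destruct p as [p1 p2].
  unfold Re, Im, Cconj, Cminus, Cdiv, Cmult, Cplus, Copp, Cinv, RtoC; cbn [fst snd].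
  replace (2 / (2 ^ 2 + 0 ^ 2)) with (/ 2) by field. replace (- 0 / (2 ^ 2 + 0 ^ 2)) with 0 by field.
  intros Q. apply Rminus_le. apply Ropp_le_cancel. rewrite Ropp_0. eapply Rle_trans; [exact Q|]. right. field.
Qed.

Lemma zzt_small m Z : DIV m Z -> Cmod (zzt m Z)%C < 2.
Proof. intros (_ & H & _). eapply Rle_lt_trans; [apply Cmod_zzt|exact H]. Qed.

Lemma eta_zero (p s : C) : Cmod s < 2 -> (Cconj p - p * Cconj s / 2)%C = RtoC 0 -> p = RtoC 0.
Proof.
  intros Hs H. apply Cmod_eq_0. pose proof (Cmod_ge_0 p).
  assert (E : Cconj p = (p * Cconj s / 2)%C). { transitivity ((Cconj p - p * Cconj s / 2) + p * Cconj s / 2)%C; [cring|]. rewrite H. cring. }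
  apply (f_equal Cmod) in E. unfold Cdiv in E. rewrite !Cmod_mult, !Cmod_conj, Cmod_inv, Cmod_R, Rabs_right in E; try lra.
  2:{ apply RtoC_neq; lra. } nra.
Qed.

Definition refl_form (m : nat) (p : C) (c : nat -> R) (Z : vec) : C :=
  (p + Cconj p * (zzt m Z / 2) - cdotR m c Z)%C.

Lemma lin_lift m p c Z : lin m p c (lift m Z) = refl_form m p c Z.
Proof.
  unfold lin, refl_form, cdotR. rewrite lift_one, lift_zzt.
  rewrite (sumC_ext m _ (fun k => (c k * Z k)%C)); [cring|]. intros; rewrite lift_lt; auto.
Qed.

Lemma Cmod_sq_pos (z : C) : z <> RtoC 0 -> 0 < Cmod z ^ 2.
Proof. intros H. apply Cmod_gt_0 in H. nra. Qed.

Lemma sqR_nonneg m c : 0 <= sqR m c.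
Proof. apply sumR_nonneg. intros; apply pow2_ge_0. Qed.

(** A point of the domain and its conjugate span the complexification of a positive plane. A real
    functional vanishing at the point corresponds to a vector orthogonal to that plane, where the
    form is negative definite. *)
Lemma vanishing_form_negative m p c Z j : DIV m Z -> (j <= m)%nat -> (p <> RtoC 0 \/ exists k, (k < j)%nat /\ c k <> 0) ->
  refl_form m p c Z = RtoC 0 -> 2 * Cmod p ^ 2 < sqR m c.
Proof.
  intros HD Hj Hne HL. pose proof (reflection_inequality m p c Z) as Q. cbv zeta in Q.
  pose proof (zzt_small m Z HD) as Hs. destruct HD as (_ & _ & Hq).
  set (s := zzt m Z) in *. set (w := 1 - Cmod s ^ 2 / 4) in *. set (eta := (Cconj p - p * Cconj s / 2)%C) in *.
  assert (Hw : 0 < w). { unfold w. pose proof (Cmod_ge_0 s). nra. }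
  assert (Ec : cdotR m c Z = (p + Cconj p * (s / 2))%C).
  { transitivity ((p + Cconj p * (s / 2)) - refl_form m p c Z)%C; [unfold refl_form; fold s; cring|]. rewrite HL. cring. }
  rewrite Ec in Q.
  assert (E1 : fst (eta * (p + Cconj p * (s / 2)))%C = Cmod p ^ 2 * w).
  { unfold eta, w. rewrite !Cmod2_alt. destruct p as [p1 p2], s as [s1 s2].
    unfold Re, Im, Cconj, Cminus, Cdiv, Cmult, Cplus, Copp, Cinv, RtoC; cbn [fst snd]. field. }
  rewrite E1 in Q. destruct (classic (eta = RtoC 0)) as [Z0|N].
  - assert (Hp : p = RtoC 0) by (apply (eta_zero p s); auto). subst p. rewrite Cmod_0.
    destruct Hne as [F|(k & Hk & Hck)]; [congruence|].
    pose proof (sqR_nonneg m c). destruct (Req_dec (sqR m c) 0) as [E0|]; [|lra]. exfalso. apply Hck.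
    assert (G := sumR_nonneg_zero m (fun k => c k ^ 2) ltac:(intros; apply pow2_ge_0) ltac:(unfold sqR in E0; lra) k ltac:(lia)).
    simpl in G. nra.
  - apply Cmod_sq_pos in N. assert (0 < w * w * (sqR m c - 2 * Cmod p ^ 2)) by nra.
    assert (0 < w * w) by nra. apply Rnot_le_lt. intros Hle. nra.
Qed.

Section Reflection.

Variables (m : nat) (p : C) (c : nat -> R) (ka : R).
Hypothesis Hka : 0 < ka.
Hypothesis Hnorm : ka * (sqR m c - 2 * Cmod p ^ 2) = 2.

Let L := refl_form m p c.

(** In homogeneous coordinates the reflection adds [ka * L Z] times [(c, Cconj p, p)] to
    [(Z, 1, zzt / 2)]; [refl_den] is the new coordinate of index [m], which [refl] divides out.
    [Hnorm] is the usual normalization, under which the functional changes sign. *)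
Definition refl_den (Z : vec) : C := (1 + ka * L Z * Cconj p)%C.
Definition refl (Z : vec) : vec := fun k => if Nat.ltb k m then ((Z k + ka * L Z * c k) / refl_den Z)%C else RtoC 0.

(** Positivity of [typeIV_q] describes two components, where the modulus of [zzt] is below or above
    2. This inequality keeps the image in the first one, and it shows that the denominator does not
    vanish. *)
Lemma refl_den_ineq Z : DIV m Z -> Cmod (zzt m Z / 2 + ka * L Z * p)%C ^ 2 < Cmod (refl_den Z)%C ^ 2.
Proof.
  intros HD. pose proof (reflection_inequality m p c Z) as Q. cbv zeta in Q.
  pose proof (zzt_small m Z HD) as Hs. destruct HD as (_ & _ & Hq). unfold refl_den, L, refl_form.
  set (s := zzt m Z) in *. set (w := 1 - Cmod s ^ 2 / 4) in *. set (eta := (Cconj p - p * Cconj s / 2)%C) in *.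
  set (cz := cdotR m c Z) in *. set (cc := sqR m c) in *.
  assert (Hw : 0 < w). { unfold w. pose proof (Cmod_ge_0 s). nra. }
  assert (T : 0 < w * (cc + 2 * Cmod p ^ 2) - 4 * fst (eta * cz)%C).
  { destruct (classic (eta = RtoC 0)) as [Z0|N].
    - assert (Hp : p = RtoC 0) by (apply (eta_zero p s); auto). rewrite Z0. rewrite Hp, Cmod_0 in *.
      replace (fst (0 * cz)%C) with 0 by (unfold Cmult, RtoC; cbn [fst snd]; ring).
      assert (0 < cc) by nra. nra.
    - apply Cmod_sq_pos in N. assert (0 < Cmod eta ^ 2 * typeIV_q m Z) by (apply Rmult_lt_0_compat; lra).
      apply Rnot_le_lt. intros Hle. nra. }
  assert (E1 : Cmod (1 + ka * (p + Cconj p * (s / 2) - cz) * Cconj p)%C ^ 2 - Cmod (s / 2 + ka * (p + Cconj p * (s / 2) - cz) * p)%C ^ 2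
     = w * (1 + 2 * ka * Cmod p ^ 2) - 2 * ka * fst (eta * cz)%C).
  { unfold eta, w. rewrite !Cmod2_alt. destruct p as [p1 p2], s as [s1 s2], cz as [z1 z2].
    unfold Re, Im, Cconj, Cminus, Cdiv, Cmult, Cplus, Copp, Cinv, RtoC; cbn [fst snd]. field. }
  assert (E2 : w * (1 + 2 * ka * Cmod p ^ 2) - 2 * ka * fst (eta * cz)%C = ka / 2 * (w * (cc + 2 * Cmod p ^ 2) - 4 * fst (eta * cz)%C)).
  { replace 1 with (ka * (cc - 2 * Cmod p ^ 2) / 2) by lra. field. }
  assert (0 < ka / 2 * (w * (cc + 2 * Cmod p ^ 2) - 4 * fst (eta * cz)%C)) by (apply Rmult_lt_0_compat; lra). lra.
Qed.

Lemma refl_den_neq Z : DIV m Z -> refl_den Z <> RtoC 0.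
Proof.
  intros HD E. pose proof (refl_den_ineq Z HD) as Q. rewrite E, Cmod_0 in Q.
  pose proof (pow2_ge_0 (Cmod (zzt m Z / 2 + ka * L Z * p)%C)). lra.
Qed.

Lemma refl_lt Z k : (k < m)%nat -> refl Z k = ((Z k + ka * L Z * c k) / refl_den Z)%C.
Proof. intros H. unfold refl. apply Nat.ltb_lt in H. rewrite H. auto. Qed.

Lemma Hnorm_C : (ka * RtoC (sqR m c))%C = (2 + 2 * ka * (p * Cconj p))%C.
Proof.
  rewrite <- RtoC_mult. replace (ka * sqR m c) with (2 + 2 * ka * Cmod p ^ 2) by lra.
  rewrite RtoC_plus, !RtoC_mult, Cmod2_conj. auto.
Qed.

Lemma sqR_sumC : sumC m (fun k => (c k * c k)%C) = RtoC (sqR m c).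
Proof. unfold sqR. rewrite <- sumC_RtoC. apply sumC_ext. intros. rewrite RtoC_pow. cring. Qed.

Lemma refl_zzt Z : DIV m Z -> zzt m (refl Z) = (2 * ((zzt m Z / 2 + ka * L Z * p) / refl_den Z))%C.
Proof.
  intros HD. pose proof (refl_den_neq Z HD) as N. unfold zzt at 1.
  rewrite (sumC_ext m _ (fun k => (/ (refl_den Z * refl_den Z)) * (Z k * Z k + (2 * ka * L Z * (c k * Z k) + ka * ka * L Z * L Z * (c k * c k))))%C).
  2:{ intros k Hk. rewrite refl_lt by auto. change Cmul with Cmult. cfield. auto. }
  rewrite sumC_scal, !sumC_plus, !sumC_scal, sqR_sumC.
  change (sumC m (fun k => (Z k * Z k)%C)) with (zzt m Z). fold (cdotR m c Z).
  assert (El : cdotR m c Z = (p + Cconj p * (zzt m Z / 2) - L Z)%C) by (unfold L, refl_form; cring).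
  rewrite El. pose proof Hnorm_C as Hc.
  replace (ka * ka * L Z * L Z * RtoC (sqR m c))%C with (ka * L Z * L Z * (ka * RtoC (sqR m c)))%C by cring.
  rewrite Hc. revert N. unfold refl_den. intros N. cfield. auto.
Qed.

Lemma sqnorm_C M (Z : vec) : RtoC (sqnorm M Z) = sumC M (fun k => (Z k * Cconj (Z k)%C)%C).
Proof. rewrite <- cprod_diag. reflexivity. Qed.

(** The reflection preserves the Hermitian form of the lift; the denominator only comes from
    restoring the coordinate 1. *)
Lemma refl_q Z : DIV m Z -> typeIV_q m (refl Z) = typeIV_q m Z / Cmod (refl_den Z)%C ^ 2.
Proof.
  intros HD. pose proof (refl_den_neq Z HD) as N. pose proof (refl_zzt Z HD) as Ez.
  assert (Nc : Cconj (refl_den Z)%C <> RtoC 0). { apply Cmod_gt_0. rewrite Cmod_conj. apply Cmod_gt_0. auto. }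
  assert (Es : RtoC (sqnorm m (refl Z)) = ((RtoC (sqnorm m Z) + (ka * Cconj (L Z)%C * cdotR m c Z + (ka * L Z * Cconj (cdotR m c Z)%C + ka * ka * L Z * Cconj (L Z)%C * RtoC (sqR m c)))) / (refl_den Z * Cconj (refl_den Z)%C))%C).
  { rewrite !sqnorm_C.
    rewrite (sumC_ext m _ (fun k => (/ (refl_den Z * Cconj (refl_den Z)%C)) * (Z k * Cconj (Z k)%C + (ka * Cconj (L Z)%C * (c k * Z k) + (ka * L Z * Cconj (c k * Z k)%C + ka * ka * L Z * Cconj (L Z)%C * (c k * c k)))))%C).
    2:{ intros k Hk. rewrite refl_lt by auto. rewrite Cdiv_conj, Cplus_conj, !Cmult_conj, !Cconj_RtoC by auto. cfield. auto. }
    rewrite sumC_scal, !sumC_plus, !sumC_scal, sqR_sumC, <- sumC_conj. fold (cdotR m c Z). unfold Cdiv. cring. }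
  assert (El : cdotR m c Z = (p + Cconj p * (zzt m Z / 2) - L Z)%C) by (unfold L, refl_form; cring).
  assert (HQ : forall W, RtoC (typeIV_q m W) = (1 - RtoC (sqnorm m W) + (zzt m W / 2) * Cconj (zzt m W / 2)%C)%C).
  { intros W. unfold typeIV_q. rewrite Cnorm2_Cmod, RtoC_plus, RtoC_minus, RtoC_mult, Cmod2_conj.
    rewrite Cdiv_conj, Cconj_RtoC by (apply RtoC_neq; lra). rewrite RtoC_inv by lra. field. }
  assert (G : RtoC (typeIV_q m (refl Z)) = RtoC (typeIV_q m Z / Cmod (refl_den Z)%C ^ 2)).
  { rewrite RtoC_div, Cmod2_conj.
    2:{ apply Rgt_not_eq. apply Cmod_sq_pos; auto. }
    rewrite !HQ, Es, Ez, El.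
    replace (2 * ((zzt m Z / 2 + ka * L Z * p) / refl_den Z) / 2)%C with ((zzt m Z / 2 + ka * L Z * p) / refl_den Z)%C by (field; auto).
    replace (ka * ka * L Z * Cconj (L Z)%C * RtoC (sqR m c))%C with (ka * L Z * Cconj (L Z)%C * (ka * RtoC (sqR m c)))%C by cring.
    rewrite Hnorm_C, Cdiv_conj by auto.
    assert (Edc : Cconj (refl_den Z)%C = (1 + ka * Cconj (L Z)%C * p)%C).
    { unfold refl_den. rewrite Cplus_conj, !Cmult_conj, !Cconj_RtoC, Cconj_conj. auto. }
    assert (Ed : refl_den Z = (1 + ka * L Z * Cconj p)%C) by reflexivity.
    set (D := refl_den Z) in *. set (D' := Cconj D) in *.
    rewrite !Cplus_conj, !Cminus_conj, !Cplus_conj, !Cmult_conj, !Cconj_RtoC, !Cconj_conj.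
    set (t := (zzt m Z / 2)%C) in *. set (l := L Z) in *. set (l' := Cconj l) in *. set (t' := Cconj t) in *. set (p' := Cconj p) in *.
    set (sq := RtoC (sqnorm m Z)) in *.
    transitivity ((D * D' - (sq + (ka * l' * (p + p' * t - l) + (ka * l * (p' + p * t' - l') + ka * l * l' * (2 + 2 * ka * (p * p'))))) +
       (t + ka * l * p) * (t' + ka * l' * p')) / (D * D'))%C.
    - field. auto.
    - f_equal. rewrite Ed, Edc. cring. }
  injection G. auto.
Qed.

Lemma refl_DIV Z : DIV m Z -> DIV m (refl Z).
Proof.
  intros HD. pose proof (refl_den_neq Z HD) as N. pose proof (refl_den_ineq Z HD) as Q.
  pose proof (refl_q Z HD) as Eq. pose proof (refl_zzt Z HD) as Ez.
  assert (HDp : 0 < Cmod (refl_den Z)%C ^ 2) by (apply Cmod_sq_pos; auto).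
  assert (Hqp : 0 < typeIV_q m (refl Z)). { rewrite Eq. apply Rdiv_lt_0_compat; auto. apply HD. }
  split; [|split].
  - intros k Hk. unfold refl. destruct (Nat.ltb_spec k m); [lia|]. reflexivity.
  - assert (B : Cmod (zzt m (refl Z))%C ^ 2 < 4).
    { rewrite Ez, Cmod_mult, Cmod_div, Cmod_R, Rabs_right by (auto; lra).
      set (a := Cmod (zzt m Z / 2 + ka * L Z * p)%C) in *. set (b := Cmod (refl_den Z)%C) in *.
      assert (0 < b) by (apply Cmod_gt_0; auto).
      replace ((2 * (a / b)) ^ 2) with (4 * (a ^ 2 / b ^ 2)) by (field; lra).
      assert (a ^ 2 / b ^ 2 < 1). { apply Rmult_lt_reg_r with (b ^ 2); [lra|]. unfold Rdiv. rewrite Rmult_assoc, Rinv_l; lra. } lra. }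
    unfold typeIV_q in Hqp. rewrite Cnorm2_Cmod in Hqp. lra.
  - lra.
Qed.

Lemma refl_refl_form Z : DIV m Z -> L (refl Z) = (- L Z / refl_den Z)%C.
Proof.
  intros HD. pose proof (refl_den_neq Z HD) as N. unfold L at 1, refl_form. rewrite refl_zzt by auto.
  assert (El : cdotR m c Z = (p + Cconj p * (zzt m Z / 2) - L Z)%C) by (unfold L, refl_form; cring).
  assert (E : cdotR m c (refl Z) = ((cdotR m c Z + ka * L Z * RtoC (sqR m c)) / refl_den Z)%C).
  { unfold cdotR. rewrite (sumC_ext m _ (fun k => (/ refl_den Z) * (c k * Z k + ka * L Z * (c k * c k)))%C).
    - rewrite sumC_scal, sumC_plus, sumC_scal, sqR_sumC. unfold Cdiv. cring.
    - intros k Hk. rewrite refl_lt by auto. cfield. auto. }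
  rewrite E, El. replace (ka * L Z * RtoC (sqR m c))%C with (L Z * (ka * RtoC (sqR m c)))%C by cring.
  rewrite Hnorm_C. revert N. unfold refl_den. intros N. cfield. auto.
Qed.

Lemma refl_involutive Z : DIV m Z -> refl (refl Z) = Z.
Proof.
  intros HD. pose proof (refl_den_neq Z HD) as N. pose proof (refl_refl_form Z HD) as EL.
  assert (Ed : refl_den (refl Z) = (/ refl_den Z)%C).
  { unfold refl_den at 1. rewrite EL. revert N. unfold refl_den. intros N. cfield. auto. }
  apply functional_extensionality. intros k. destruct (Nat.lt_ge_cases k m) as [Hk|Hk].
  - rewrite (refl_lt (refl Z)), (refl_lt Z) by auto. rewrite Ed, EL.
    transitivity (Z k * 1)%C; [|cring]. cfield. auto.
  - unfold refl at 1. destruct (Nat.ltb_spec k m); [lia|]. symmetry. apply HD. auto.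
Qed.

End Reflection.

(** * Automorphisms of the domain and their effect on isometries *)

(** Stated through composition with arbitrary maps, so that stability under composition needs no
    chain rule in several variables. *)
Definition holo_self_map (m : nat) (phi : vec -> vec) : Prop :=
  (forall Z, DIV m Z -> DIV m (phi Z)) /\
  forall N z (f : vec -> vec), DIV m (f z) -> (forall k, (k < m)%nat -> exists a, is_grad N (fun w => f w k) z a) ->
    forall k, (k < m)%nat -> exists a, is_grad N (fun w => phi (f w) k) z a.

Definition holo_aut (m : nat) (phi : vec -> vec) : Prop :=
  holo_self_map m phi /\ exists chi, holo_self_map m chi /\
    (forall Z, DIV m Z -> chi (phi Z) = Z) /\ (forall Z, DIV m Z -> phi (chi Z) = Z).

Lemma holo_self_map_id m : holo_self_map m (fun Z => Z).
Proof. split; auto. Qed.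

Lemma holo_self_map_comp m f g : holo_self_map m f -> holo_self_map m g -> holo_self_map m (fun Z => f (g Z)).
Proof.
  intros [Hf1 Hf2] [Hg1 Hg2]. split; auto.
Qed.

Lemma holo_aut_id m : holo_aut m (fun Z => Z).
Proof. split; [apply holo_self_map_id|]. exists (fun Z => Z). split; [apply holo_self_map_id|auto]. Qed.

Lemma holo_aut_comp m f g : holo_aut m f -> holo_aut m g -> holo_aut m (fun Z => f (g Z)).
Proof.
  intros [Hf (f' & Hf' & A1 & A2)] [Hg (g' & Hg' & B1 & B2)]. split; [apply holo_self_map_comp; auto|].
  exists (fun Z => g' (f' Z)). split; [apply holo_self_map_comp; auto|]. split; intros Z HZ.
  - rewrite A1; auto. apply Hg; auto.
  - rewrite B2; auto. apply Hf'; auto.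
Qed.

Lemma holo_self_map_holomorphic m phi : holo_self_map m phi -> holomorphic m m (DIV m) phi.
Proof.
  intros [_ H] z Hz k Hk. apply holo_at_is_grad. apply (H m z (fun w => w)); auto. intros. apply is_grad_coord.
Qed.

Lemma holo_aut_biholo m phi : holo_aut m phi -> biholo_aut m (DIV m) phi.
Proof.
  intros [H (chi & H' & A & B)]. split; [apply holo_self_map_holomorphic; auto|]. split; [apply H|].
  exists chi. split; [apply holo_self_map_holomorphic; auto|]. split; [apply H'|auto].
Qed.

Lemma is_grad_sumC_ex N z M (f : nat -> vec -> C) : (forall k, (k < M)%nat -> exists a, is_grad N (f k) z a) ->
  exists a, is_grad N (fun w => sumC M (fun k => f k w)) z a.
Proof.
  induction M; intros H.
  - exists vzero. apply (is_grad_const N 0%C).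
  - destruct IHM as [a Ha]; auto. destruct (H M) as [b Hb]; auto. exists (vadd a b).
    apply (is_grad_plus N (fun w => sumC M (fun k => f k w)) (f M)); auto.
Qed.

Lemma is_grad_mult_ex N z f g : (exists a, is_grad N f z a) -> (exists a, is_grad N g z a) -> exists a, is_grad N (fun w => f w * g w)%C z a.
Proof. intros [a Ha] [b Hb]. eapply is_grad_mult; eauto. Qed.

Lemma is_grad_plus_ex N z f g : (exists a, is_grad N f z a) -> (exists a, is_grad N g z a) -> exists a, is_grad N (fun w => f w + g w)%C z a.
Proof. intros [a Ha] [b Hb]. eexists. apply is_grad_plus; eauto. Qed.

Lemma is_grad_const_ex N z c : exists a, is_grad N (fun _ => c) z a.
Proof. eexists. apply is_grad_const. Qed.

Lemma is_grad_refl_form N z m p c (f : vec -> vec) : (forall k, (k < m)%nat -> exists a, is_grad N (fun w => f w k) z a) ->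
  exists a, is_grad N (fun w => refl_form m p c (f w)) z a.
Proof.
  intros H.
  assert (Q : exists a, is_grad N (fun w => p + ((Cconj p / 2) * sumC m (fun k => (f w k * f w k)%C) + (-(1)) * sumC m (fun k => (c k * f w k)%C)))%C z a).
  { apply is_grad_plus_ex; [apply is_grad_const_ex|]. apply is_grad_plus_ex; apply is_grad_mult_ex; try apply is_grad_const_ex.
    - apply (is_grad_sumC_ex N z m (fun k w => (f w k * f w k)%C)). intros. apply is_grad_mult_ex; auto.
    - apply (is_grad_sumC_ex N z m (fun k w => (c k * f w k)%C)). intros. apply is_grad_mult_ex; auto. apply is_grad_const_ex. }
  destruct Q as [a Ha]. exists a. revert Ha. apply is_grad_ext. intros w. unfold refl_form, cdotR.
  change (sumC m (fun k => (f w k * f w k)%C)) with (zzt m (f w)). unfold Cdiv. cring.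
Qed.

Lemma refl_holo_aut m p c ka : 0 < ka -> ka * (sqR m c - 2 * Cmod p ^ 2) = 2 -> holo_aut m (refl m p c ka).
Proof.
  intros Hka Hn.
  assert (S : holo_self_map m (refl m p c ka)).
  { split; [intros; apply refl_DIV; auto|]. intros N z f HD Hf k Hk.
    destruct (is_grad_refl_form N z m p c f Hf) as [a Ha].
    assert (Hden : exists b, is_grad N (fun w => refl_den m p c ka (f w)) z b).
    { unfold refl_den. apply is_grad_plus_ex; [apply is_grad_const_ex|]. apply is_grad_mult_ex; [|apply is_grad_const_ex].
      apply is_grad_mult_ex; [apply is_grad_const_ex|]. exists a. exact Ha. }
    destruct Hden as [b Hb].
    assert (Q : exists a, is_grad N (fun w => (f w k + ka * refl_form m p c (f w) * c k) * / refl_den m p c ka (f w))%C z a).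
    { apply is_grad_mult_ex.
      - apply is_grad_plus_ex; auto. apply is_grad_mult_ex; [|apply is_grad_const_ex]. apply is_grad_mult_ex; [apply is_grad_const_ex|]. exists a. exact Ha.
      - eapply is_grad_inv; [exact Hb|]. apply refl_den_neq; auto. }
    destruct Q as [e He]. exists e. revert He. apply is_grad_ext. intros w. rewrite refl_lt by auto. reflexivity. }
  split; auto. exists (refl m p c ka). split; auto. split; intros; apply refl_involutive; auto.
Qed.

Lemma bholo_refl_den n m F p c ka : holomorphic n m (Defs.ball n) F -> (forall z, Defs.ball n z -> DIV m (F z)) ->
  bholo n (fun z => refl_den m p c ka (F z)).
Proof.
  intros HF HD. assert (HB : forall a, bholo n (fun z => lift m (F z) a)) by (intros; apply bholo_lift; auto).
  unfold refl_den. apply bholo_plus; [apply bholo_const|]. apply bholo_mult; [|apply bholo_const].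
  apply bholo_mult; [apply bholo_const|].
  assert (Q : bholo n (fun z => p * lift m (F z) m + Cconj p * lift m (F z) (S m) + (-(1)) * sumC m (fun k => (c k * lift m (F z) k)%C))%C).
  { apply bholo_plus. apply bholo_plus. apply (bholo_mult n (fun _ => p)); [apply bholo_const|apply (HB m)].
    apply (bholo_mult n (fun _ => Cconj p)); [apply bholo_const|apply (HB (S m))].
    apply (bholo_mult n (fun _ => (-(1))%C)); [apply bholo_const|].
    apply (bholo_sumC n m (fun k z => (c k * lift m (F z) k)%C)). intros k _. apply bholo_mult; [apply bholo_const|apply HB]. }
  eapply bholo_eq_on_ball; [exact Q|]. intros z. cbv beta. rewrite <- lin_lift. unfold lin. cring.
Qed.

(** The logarithm of |d|^2 is pluriharmonic; this is the rank one case of [levi_log_hermR], where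
    the numerator vanishes. *)
Lemma levi_log_norm_sq n (d : vec -> C) (x : R) z i j : bholo n d -> (forall z, Defs.ball n z -> d z <> RtoC 0) ->
  Defs.ball n z -> (i < n)%nat -> (j < n)%nat -> levi n (fun w => x * ln (Cmod (d w)%C ^ 2)) z i j (RtoC 0).
Proof.
  intros Hd Hn Hz Hi Hj.
  assert (E : forall w, hermR 1 (fun _ => 1) (fun _ => d w) = Cmod (d w)%C ^ 2).
  { intros w. unfold hermR. simpl sumR. rewrite Cnorm2_Cmod. ring. }
  assert (L := levi_log_hermR n 1 (fun _ => 1) (fun _ => d) (fun _ _ => Hd)). cbv beta in L.
  specialize (L ltac:(intros w Hw; rewrite E; apply Cmod_sq_pos; auto) x z i j Hz Hi Hj).
  assert (Hh : forall A B : C, herm 1 (fun _ => 1) (fun _ => A) (fun _ => B) = (A * Cconj B)%C).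
  { intros. unfold herm. rewrite sumC_S. change (0 + 1 * A * Cconj B = A * Cconj B)%C. cring. }
  rewrite !Hh in L. eapply levi_ext; [exact Hz|exact Hi| |].
  2:{ match type of L with levi _ _ _ _ _ ?Y => replace (RtoC 0) with Y; [exact L|] end.
      assert (Nc : Cconj (d z)%C <> RtoC 0). { apply Cmod_gt_0. rewrite Cmod_conj. apply Cmod_gt_0. auto. }
      field. split; auto. }
  intros w Hw. cbv beta. rewrite E. auto.
Qed.

(** Composition with the reflection changes log K by a multiple of log |[refl_den]|^2, whose Levi
    form is 0; [lambda] stays the same. *)
Lemma refl_isometry n m F p c ka : 0 < ka -> ka * (sqR m c - 2 * Cmod p ^ 2) = 2 ->
  holo_isometry_ball_IV n m F -> holo_isometry_ball_IV n m (fun z => refl m p c ka (F z)).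
Proof.
  intros Hka Hn (HF & HD & lambda & Hl & HL).
  destruct (refl_holo_aut m p c ka Hka Hn) as [[S1 S2] _].
  split; [|split].
  - intros z Hz k Hk. apply holo_at_is_grad. apply (S2 n z F); auto. intros. apply holo_at_is_grad. apply HF; auto.
  - intros z Hz. apply S1; auto.
  - exists lambda. split; auto. intros z Hz i j Hi Hj. destruct (HL z Hz i j Hi Hj) as (c1 & c2 & L1 & L2 & E).
    exists c1, c2. split; [|auto].
    assert (L3 := levi_log_norm_sq n (fun w => refl_den m p c ka (F w)) (INR m) z i j (bholo_refl_den n m F p c ka HF HD)
      (fun w Hw => refl_den_neq m p c ka Hka Hn (F w) (HD w Hw)) Hz Hi Hj).
    assert (L4 := levi_lincomb _ _ _ _ _ _ _ _ 1 1 L1 L3).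
    replace (1 * c1 + 1 * 0)%C with c1 in L4 by cring.
    eapply levi_ext; [exact Hz|exact Hi| |exact L4]. intros w Hw. cbv beta. unfold logK_IV. rewrite refl_q by auto.
    assert (0 < typeIV_q m (F w)) by (apply HD; auto).
    assert (0 < Cmod (refl_den m p c ka (F w))%C ^ 2) by (apply Cmod_sq_pos, refl_den_neq; auto).
    unfold Rdiv. rewrite ln_mult, ln_Rinv; auto; [ring|]. apply Rinv_0_lt_compat; auto.
Qed.

(** * Removal of coordinates and conclusion *)

(** The reflection exchanges the functional [(p, c)], which vanishes on the image, with a multiple of
    the coordinate function of index [j]. *)
Lemma kill_coordinate n m F j : (2 <= n)%nat -> (2 * n + 2 <= j)%nat -> (S j <= m)%nat -> holo_isometry_ball_IV n m F ->
  (forall z, Defs.ball n z -> supported (S j) (F z)) ->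
  exists phi, holo_aut m phi /\ (forall Z, DIV m Z -> phi (phi Z) = Z) /\
    holo_isometry_ball_IV n m (fun z => phi (F z)) /\ forall z, Defs.ball n z -> supported j (phi (F z)).
Proof.
  intros Hn Hj Hjm HI Hs.
  destruct (isometry_real_functional n m F (S j) Hn ltac:(lia) Hjm HI) as (p & c & Hc & Hne & HL).
  assert (HD : forall z, Defs.ball n z -> DIV m (F z)) by apply HI.
  assert (Hneg : 2 * Cmod p ^ 2 < sqR m c).
  { apply (vanishing_form_negative m p c (F vzero) (S j)); auto. apply HD, ball_vzero. rewrite <- lin_lift. apply HL, ball_vzero. }
  (* As for a Householder reflection, [t] is the length of the vector [(p, c)], and the sign of [u]
     is chosen so that subtracting [u] from the coordinate [j] causes no cancellation. *)
  set (t := sqrt (sqR m c - 2 * Cmod p ^ 2)).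
  assert (Ht : 0 < t) by (apply sqrt_lt_R0; lra). assert (Ht2 : t ^ 2 = sqR m c - 2 * Cmod p ^ 2) by (apply pow2_sqrt; lra).
  set (u := if Rle_dec 0 (c j) then - t else t).
  assert (Hu : u ^ 2 = t ^ 2 /\ u * c j <= 0).
  { unfold u. destruct (Rle_dec 0 (c j)); split; try ring; nra. }
  destruct Hu as [Hu2 Huc].
  set (c' := fun k => if Nat.eqb k j then c j - u else c k).
  assert (Ecc : sqR m c' = sqR m c - 2 * u * c j + u ^ 2).
  { assert (G : sqR m c' - sqR m c = u ^ 2 - 2 * u * c j); [|lra].
    unfold sqR, Rminus at 1. rewrite <- sumR_opp, <- sumR_plus. rewrite (sumR_single m j); [|lia|].
    - unfold c'. rewrite Nat.eqb_refl. ring.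
    - intros k _ Hk. unfold c'. destruct (Nat.eqb_spec k j); [congruence|]. ring. }
  assert (Hv : 0 < t ^ 2 - u * c j) by nra.
  (* The modified vector has square norm [2 * (t ^ 2 - u * c j)], and [ka] is 2 divided by it. *)
  set (ka := / (t ^ 2 - u * c j)). assert (Hka : 0 < ka) by (apply Rinv_0_lt_compat; auto).
  assert (Hnorm : ka * (sqR m c' - 2 * Cmod p ^ 2) = 2).
  { rewrite Ecc, Hu2. replace (sqR m c) with (t ^ 2 + 2 * Cmod p ^ 2) by lra. unfold ka. field. lra. }
  exists (refl m p c' ka). split; [apply refl_holo_aut; auto|]. split; [intros; apply refl_involutive; auto|].
  split; [apply refl_isometry; auto|]. intros z Hz k Hk.
  destruct (Nat.lt_ge_cases k m) as [Lk|Lk].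
  2:{ unfold refl. destruct (Nat.ltb_spec k m); [lia|]. reflexivity. }
  rewrite refl_lt by auto. pose proof (refl_den_neq m p c' ka Hka Hnorm (F z) (HD z Hz)) as N.
  destruct (Nat.eq_dec k j) as [->|Nk].
  (* On the image the original functional vanishes, so the modified one reduces to [u * F z j], and
     the reflection multiplies this coordinate by the factor shown to be 0 in [Ek]. *)
  - assert (EL : refl_form m p c' (F z) = (u * F z j)%C).
    { specialize (HL z Hz). rewrite lin_lift in HL.
      transitivity (refl_form m p c (F z) + u * F z j)%C; [|rewrite HL; cring].
      unfold refl_form. assert (Ed : cdotR m c' (F z) = (cdotR m c (F z) - u * F z j)%C).
      { assert (G : (cdotR m c' (F z) - cdotR m c (F z))%C = (- (u * F z j))%C).
        - unfold cdotR. rewrite <- sumC_minus. rewrite (sumC_single m j); auto.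
          + unfold c'. rewrite Nat.eqb_refl, RtoC_minus. cring.
          + intros i _ Hi. unfold c'. destruct (Nat.eqb_spec i j); [congruence|]. cring.
        - transitivity ((cdotR m c' (F z) - cdotR m c (F z)) + cdotR m c (F z))%C; [cring|]. rewrite G. cring. }
      rewrite Ed. cring. }
    assert (Ecj : c' j = c j - u) by (unfold c'; rewrite Nat.eqb_refl; auto).
    rewrite EL, Ecj.
    assert (Ek : 1 + ka * u * (c j - u) = 0).
    { unfold ka. rewrite <- Hu2 in *. field. lra. }
    transitivity (RtoC (1 + ka * u * (c j - u)) * F z j / refl_den m p c' ka (F z))%C.
    + rewrite RtoC_plus, !RtoC_mult, RtoC_minus. cfield. auto.
    + rewrite Ek. change ((0 * F z j / refl_den m p c' ka (F z))%C = RtoC 0). cfield. auto.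
  - assert (Z : F z k = RtoC 0) by (apply Hs; auto; lia).
    assert (Zc : c' k = 0). { unfold c'. destruct (Nat.eqb_spec k j); [congruence|]. apply Hc; lia. }
    rewrite Z, Zc. change ((0 + ka * refl_form m p c' (F z) * 0) / refl_den m p c' ka (F z) = 0)%C. cfield. auto.
Qed.

(** Every reflection is an involution, so [F] is recovered by applying them again in the reverse
    order. *)
Lemma kill_coordinates n m F t : (2 <= n)%nat -> (2 * n + 2 + t <= m)%nat -> holo_isometry_ball_IV n m F ->
  (forall z, Defs.ball n z -> supported (2 * n + 2 + t) (F z)) ->
  exists G phi, holo_aut m phi /\ holo_isometry_ball_IV n m G /\ (forall z, Defs.ball n z -> supported (2 * n + 2) (G z)) /\
    forall z, Defs.ball n z -> F z = phi (G z).
Proof.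
  intros Hn. revert F. induction t as [|t IH]; intros F Hm HI Hs.
  - exists F, (fun Z => Z). split; [apply holo_aut_id|]. split; auto. split; auto. rewrite Nat.add_0_r in Hs. auto.
  - destruct (kill_coordinate n m F (2 * n + 2 + t) Hn ltac:(lia) ltac:(lia) HI) as (phi & Ha & Hinv & HI' & Hs').
    { rewrite Nat.add_succ_r in Hs. exact Hs. }
    destruct (IH (fun z => phi (F z)) ltac:(lia) HI' Hs') as (G & phi' & Ha' & HG & HsG & E).
    exists G, (fun Z => phi (phi' Z)). split; [apply holo_aut_comp; auto|]. split; auto. split; auto.
    intros z Hz. rewrite <- E by auto. rewrite Hinv; auto. apply HI; auto.
Qed.

Lemma sumR_truncate j m (f : nat -> R) : (j <= m)%nat -> (forall k, (j <= k)%nat -> f k = 0) -> sumR m f = sumR j f.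
Proof.
  intros Hj H. replace m with (j + (m - j))%nat by lia. generalize (m - j)%nat. induction n.
  - rewrite Nat.add_0_r. auto.
  - rewrite Nat.add_succ_r. simpl. rewrite IHn, H by lia. ring.
Qed.

Lemma sumC_truncate j m (f : nat -> C) : (j <= m)%nat -> (forall k, (j <= k)%nat -> f k = RtoC 0) -> sumC m f = sumC j f.
Proof.
  intros Hj H. replace m with (j + (m - j))%nat by lia. generalize (m - j)%nat. induction n.
  - rewrite Nat.add_0_r. auto.
  - rewrite Nat.add_succ_r, sumC_S, IHn, H by lia. cring.
Qed.

Lemma isometry_truncate n j m G : (0 < j)%nat -> (j <= m)%nat -> holo_isometry_ball_IV n m G ->
  (forall z, Defs.ball n z -> supported j (G z)) -> holo_isometry_ball_IV n j G.
Proof.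
  intros Hj0 Hj (HF & HD & lambda & Hl & HL) Hs.
  assert (En : forall z, Defs.ball n z -> sqnorm m (G z) = sqnorm j (G z)).
  { intros z Hz. apply sumR_truncate; auto. intros k Hk. rewrite (Hs z Hz k Hk). unfold Cnorm2, C0; simpl. ring. }
  assert (Ez : forall z, Defs.ball n z -> zzt m (G z) = zzt j (G z)).
  { intros z Hz. apply sumC_truncate; auto. intros k Hk. rewrite (Hs z Hz k Hk). apply injective_projections; simpl; ring. }
  assert (Eq : forall z, Defs.ball n z -> typeIV_q m (G z) = typeIV_q j (G z)).
  { intros z Hz. unfold typeIV_q. rewrite En, Ez; auto. }
  assert (Pm : 0 < INR m) by (apply lt_0_INR; lia). assert (Pj : 0 < INR j) by (apply lt_0_INR; lia).
  split; [|split].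
  - intros z Hz k Hk. apply HF; auto. lia.
  - intros z Hz. destruct (HD z Hz) as (_ & A & B). split; [auto|]. rewrite <- En, <- Eq; auto.
  (* The exponent of the Bergman kernel depends on the dimension, which rescales the isometric
     constant. *)
  - exists (INR j / INR m * lambda). split. { apply Rmult_lt_0_compat; auto. apply Rdiv_lt_0_compat; auto. }
    intros z Hz i k Hi Hk. destruct (HL z Hz i k Hi Hk) as (c1 & c2 & L1 & L2 & E).
    exists ((INR j / INR m)%R * c1)%C, c2. split; [|split; auto].
    + assert (L3 := levi_lincomb _ _ _ _ _ _ _ _ (INR j / INR m) 0 L1 L1).
      replace ((INR j / INR m)%R * c1 + 0%R * c1)%C with ((INR j / INR m)%R * c1)%C in L3 by cring.
      eapply levi_ext; [exact Hz|exact Hi| |exact L3]. intros w Hw. cbv beta. unfold logK_IV. rewrite Eq by auto. field. lra.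
    + rewrite E. apply injective_projections; simpl; ring.
Qed.

Lemma biholo_aut_id n : biholo_aut n (Defs.ball n) (fun z => z).
Proof.
  assert (H : holomorphic n n (Defs.ball n) (fun z => z)).
  { intros z Hz k Hk. apply holo_at_is_grad. apply is_grad_coord. }
  split; auto. split; auto. exists (fun z => z). auto.
Qed.

(* A map G into D^IV_{2n+2} (values supported on indices < 2n+2) is, as a
   [vec]-valued map, literally the map (G, 0) into D^IV_m. *)
Theorem mainTheorem1 (n m : nat) (Hn : (2 <= n)%nat) (Hm : (2 * n + 2 < m)%nat)
  (F : vec -> vec) (HF : holo_isometry_ball_IV n m F) :
  exists G : vec -> vec,
    holo_isometry_ball_IV n (2 * n + 2) G /\
    equivalent_ball_IV n m F G.
Proof.
  destruct (kill_coordinates n m F (m - (2 * n + 2)) Hn ltac:(lia) HF) as (G & phi & Ha & HG & Hs & E).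
  { replace (2 * n + 2 + (m - (2 * n + 2)))%nat with m by lia. intros z Hz. apply HF; auto. }
  exists G. split.
  - eapply (isometry_truncate n (2 * n + 2) m); auto; lia.
  - exists (fun z => z), phi. split; [apply biholo_aut_id|]. split; [apply holo_aut_biholo; auto|]. exact E.
Qed.
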